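(* For every prime $p\ge5$, every integer $n$ with $3\le n\le p-1$, and every $a\in\mathbb{F}_p^\times$, the monic irreducible polynomial $P_a=T^{p}-T-a\in\mathbb{F}_p[T]$ and the $p$-magic number $i=p^{n}-1$ satisfy $$\deg_X g\big(X,\omega_{P_a}^{\,i}\big)=n-1\ge2.$$ In particular Goss's conjecture (stated in the context) is false; there are infinitely many such triples $(p,P_a,i)$, and the excess over the conjectured bound, $\deg_X g(X,\omega_{P_a}^{\,i})-1=n-2$, is unbounded over these triples, attaining $p-3$ at $n=p-1$. For $p\in\{2,3\}$ the construction produces no counterexample: for $1\le n\le p-1$ and $a\in\mathbb{F}_p^\times$, $\deg_X g(X,\omega_{P_a}^{\,p^n-1})=n-1\le p-2\le1$.
   Context: Let $q$ be a power of a prime $p$, $A=\mathbb{F}_q[T]$, $k=\mathbb{F}_q(T)$, and let $\infty$ be the place of $k$ at infinity (valuation $-\deg$), which has degree 1. Let $P\in A$ be a monic irreducible polynomial (''prime'') of degree $d$. For $P_a$ one takes $q=p$. Cyclotomic function field: let $C$ be the Carlitz module over $A$, $C_T(x)=Tx+x^q$, and let $\Lambda_P=\{\lambda\in\overline{k}: C_P(\lambda)=0\}$. Then $K_P=k(\Lambda_P)$, and $\mathrm{Gal}(K_P/k)\cong(A/P)^\times$, where the class of $b\in A$ prime to $P$ corresponds to the automorphism $\sigma_b$ with $\sigma_b(\lambda)=C_b(\lambda)$ for $\lambda\in\Lambda_P$. Teichmüller character: fix an embedding $\overline{\mathbb{Q}}\hookrightarrow\overline{\mathbb{Q}}_p$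 and an embedding of $A/P$ into the residue field of $\overline{\mathbb{Q}}_p$. The character $\omega_P:\mathrm{Gal}(K_P/k)\cong(A/P)^\times\to\mu_{q^d-1}\subset\overline{\mathbb{Q}}$ sends $x$ to the unique $(q^d-1)$-th root of unity whose reduction in the residue field of $\overline{\mathbb{Q}}_p$ is the image of $x$. Artin $L$-function: for a nontrivial character $\chi$ of $\mathrm{Gal}(K_P/k)$ with values in $\overline{\mathbb{Q}}^\times$, $L(X,\chi)=\prod_{v}(1-\chi(v)X^{\deg v})^{-1}$, the product over all places $v$ of $k$ (including $\infty$), where $\chi(v)$ is the value of $\chi$ at the Frobenius of $v$ if $v$ is unramified in the fixed field $K_P^{\ker\chi}$, and $\chi(v)=0$ if $v$ is ramified there. It is a polynomial in $X$ with algebraic-integer coefficients and constant term $1$. Congruent-to-one part: write $L(X,\chi)=\prod_j(1-\alpha_jX)$ with $\alpha_j\in\overline{\mathbb{Q}}_p$ (with multiplicity). Then $g(X,\chi)=\prod_{j:\,v_p(\alpha_j-1)>0}(1-\alpha_jX)$, where $v_p$ is the valuation on $\overline{\mathbb{Q}}_p$ with $v_p(p)=1$. $q$-magic number: an integer $i\ge0$ of the form $i=c\,q^{n}+q^{n}-1$ with $c\in\{0,\dots,q-2\}$ and $n\in\mathbb{N}$ (where $n=0$ is allowed). Goss's conjecture: for every prime power $q$, every monic irreducible $P\in\mathbb{F}_q[T]$ of degree $d$, and every $q$-magic number $i$ with $1\le i\le q^d-2$, one has $\deg_X g(X,\omega_P^{\,i})\le1$. *)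

(* Defs.v *)
From HB Require Import structures.
From mathcomp Require Import all_boot all_order all_algebra all_fingroup.
From mathcomp Require Import all_field.
From mathcomp Require Import generic_quotient ring_quotient fraction qpoly qfpoly.
From mathcomp Require Import boolp classical_sets cardinality constructive_ereal.
Set Implicit Arguments.
Unset Strict Implicit.
Unset Printing Implicit Defensive.

Import Order.TTheory GRing.Theory Num.Theory.
Local Open Scope ring_scope.
Local Open Scope quotient_scope.

Record valuation (R : realDomainType) (E : fieldType) := Valuation {
  val_fun :> E -> \bar R;
  val_fun0 : val_fun 0 = +oo%E;
  val_fun_fin : forall x, x != 0 -> val_fun x \is a fin_num;
  val_funM : forall x y, val_fun (x * y) = (val_fun x + val_fun y)%E;
  val_funD : forall x y,
    (Order.min (val_fun x) (val_fun y) <= val_fun (x + y))%E }.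

Section ResidueField.
Variables (R : realDomainType) (E : fieldType) (v : valuation R E).

Definition val_ring : {pred E} := fun x => (0 <= v x)%E.

Let v1 : v 1%R = 0%E.
Proof.
have := val_fun_fin v (oner_neq0 E).
have : v 1%R = (v 1%R + v 1%R)%E by rewrite -val_funM mulr1.
case: (v 1%R) => [r||] //= + _; case => /eqP.
by rewrite -subr_eq subrr eq_sym => /eqP ->.
Qed.

Let vN x : v (- x) = v x.
Proof.
have vm1 : v (-1)%R = 0%E.
  have n0 : (-1 : E) != 0 by rewrite oppr_eq0 oner_eq0.
  have := val_fun_fin v n0.
  have : (v (-1)%R + v (-1)%R)%E = 0%E by rewrite -val_funM mulrNN mulr1 v1.
  case: (v (-1)%R) => [r||] //= + _; case => /eqP.
  by rewrite -mulr2n mulrn_eq0 /= => /eqP ->.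
by rewrite -mulN1r val_funM vm1 add0e.
Qed.

Let val_ring_subring : subring_closed val_ring.
Proof.
split=> [|x y|x y]; rewrite !unfold_in ?v1 //.
- move=> vx vy; apply: le_trans (val_funD v x (- y)).
  by rewrite vN le_min vx vy.
- by move=> vx vy; rewrite val_funM adde_ge0.
Qed.

HB.instance Definition _ := GRing.isSubringClosed.Build E val_ring
  val_ring_subring.

Record val_int := ValInt { int_val :> E; _ : int_val \in val_ring }.
HB.instance Definition _ := [isSub for int_val].
HB.instance Definition _ := [Choice of val_int by <:].
HB.instance Definition _ := [SubChoice_isSubComNzRing of val_int by <:].

Definition val_max : {pred val_int} := fun x => (0 < v (int_val x))%E.

Let val_max_ideal : idealr_closed val_max.
Proof.
split=> [||a x y]; rewrite !unfold_in.
- by rewrite -[int_val _]/(\val (0 : val_int)) raddf0 val_fun0 ltry.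
- by rewrite -[int_val _]/(\val (1 : val_int)) rmorph1 v1 ltxx.
- move=> vx vy; have va : (0 <= v (int_val a))%E by case: a.
  rewrite -[int_val _]/(\val (a * x + y)) rmorphD rmorphM /=.
  apply: lt_le_trans (val_funD v _ _).
  rewrite lt_min vy andbT val_funM.
  by apply: (lt_le_trans vx); rewrite leeDr.
Qed.

HB.instance Definition _ := isIdealr.Build val_int val_max val_max_ideal.

Definition residue_field := {ideal_quot val_max}.

(** The reduction map; elements outside the valuation ring are sent to 0. *)
Definition residue (x : E) : residue_field :=
  \pi_({ideal_quot val_max}) (insubd (0 : val_int) x).

End ResidueField.

Definition vp_cauchy (E : fieldType) (v : valuation rat E) (u : nat -> rat) :=
  forall N : nat, exists m0 : nat, forall m n : nat, (m0 <= m)%N ->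
    (m0 <= n)%N -> (N%:R%:E <= v (ratr (u m) - ratr (u n))%R)%E.

Definition vp_limit (E : fieldType) (v : valuation rat E) (u : nat -> rat)
    (x : E) :=
  forall N : nat, exists m0 : nat, forall n : nat, (m0 <= n)%N ->
    (N%:R%:E <= v (ratr (u n) - x)%R)%E.

Definition vp_adherent (E : fieldType) (v : valuation rat E) (x : E) :=
  exists u : nat -> rat, vp_limit v u x.

(** An algebraic closure of Q_p with its valuation normalised by v_p(p) = 1.
    Inside it, Q_p is the topological closure of Q ([vp_adherent]); it is
    required to be complete, and the whole field to be algebraic over it. These
    conditions determine the valued field up to isomorphism. *)
Record padic_closure (p : nat) := PadicClosure {
  Qpbar :> closedFieldType;
  Qpbar_char0 : [pchar Qpbar] =i pred0;
  vp : valuation rat Qpbar;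
  vp_p : vp p%:R%R = 1%:E;
  vp_complete : forall u, vp_cauchy vp u -> exists x, vp_limit vp u x;
  Qpbar_algebraic : forall x, exists f : {poly Qpbar},
    [/\ f != 0, root f x & forall j, vp_adherent vp f`_j] }.

(** Qbar is realised as [algC]. *)
Record padic_setup (p : nat) := PadicSetup {
  setup_closure :> padic_closure p;
  setup_embed : {rmorphism algC -> Qpbar setup_closure} }.

Section CongruentToOne.
Variables (p : nat) (S : padic_setup p).

(** A list of the alpha_j; it is unique up to order and insertion of zeros,
    and zeros are never retained in [congr1_part]. *)
Definition recip_roots (L : {poly algC}) : seq (Qpbar S) :=
  xget [::] [set s : seq (Qpbar S) |
    map_poly (setup_embed S) L = \prod_(x <- s) (1 - x *: 'X)]%classic.

Definition congr1_part (L : {poly algC}) : {poly Qpbar S} :=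
  \prod_(x <- recip_roots L | (0 < vp S (x - 1)%R)%E) (1 - x *: 'X).

End CongruentToOne.

(** [carlitz a] is C_a(x), a polynomial in x (the outer variable) over
    A = F[T] (so T is the inner variable): C_(T^j) is the j-fold iterate of
    C_T(x) = T x + x^q, and C is F-linear. *)
Definition carlitz (F : finFieldType) (a : {poly F}) : {poly {poly F}} :=
  \sum_(j < size a) (a`_j)%:P *: iter j (fun f => 'X *: f + f ^+ #|F|) 'X.

Definition poly_deg (R : nzRingType) (f : {poly R}) : nat := (size f).-1.

Section Places.
Variable F : finFieldType.
Notation k := {fraction {poly F}}.

(** The places of k: [Fin Q] is meant for Q monic irreducible only. *)
Inductive place := Fin of {poly F} | Infty.

Definition place_deg (v : place) : nat :=
  if v is Fin Q then poly_deg Q else 1.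

(** The normalised valuation of a place, on nonzero elements of A; it
    determines the valuation on k. *)
Definition place_val (v : place) (f : {poly F}) : int :=
  if v is Fin Q then (\max_(n < size f | (Q ^+ n %| f)%R) n)%N%:Z
  else - (poly_deg f)%:Z.

(** Places of a finite extension of k. *)
Record place_of (M : fieldType) := PlaceOf {
  place_fun :> valuation int M;
  place_normalised : exists x, place_fun x = 1%:E }.

(** [w] lies above [v] with ramification index [e]. *)
Definition lies_above (M : fieldExtType k) (w : place_of M) (v : place)
    (e : nat) :=
  (0 < e)%N /\ forall f : {poly F}, f != 0 ->
    w ((tofrac f)%:A)%R = (e%:Z * place_val v f)%:E.

(** Residue extensions are separable here (residue fields are finite). *)
Definition unramified (M : fieldExtType k) (v : place) :=
  forall (w : place_of M) e, lies_above w v e -> e = 1%N.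

Section ArtinL.
Variables (K : splittingFieldType k) (chi : gal_of {:K} -> algC).

Definition char_field : {subfield K} :=
  [aspace of fixedField [set s in 'Gal({:K} / 1)%g | chi s == 1]].

(** [s] in Gal(K/k) restricts to the Frobenius of [v] on [char_field]. For [x]
    in [char_field], [s x] is again in it, so [vsproj] only changes its type. *)
Definition is_frobenius (v : place) (s : gal_of {:K}) :=
  s \in 'Gal({:K} / 1)%g /\
  forall (w : place_of (subvs_of char_field)) e, lies_above w v e ->
  forall x : subvs_of char_field, (0 <= w x)%E ->
    (0 < w (vsproj char_field (s (vsval x)) - x ^+ (#|F| ^ place_deg v))%R)%E.

Definition char_at (v : place) : algC :=
  if `[< unramified (subvs_of char_field) v >]
  then xget 0 [set chi s | s in is_frobenius v]%classic
  else 0.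

(** (1 - chi(v) X^(deg v))^-1 as a geometric series, truncated so as to be
    correct up to degree N. *)
Definition euler_factor (N : nat) (v : place) : {poly algC} :=
  \sum_(j < N.+1) (char_at v *: 'X^(place_deg v)) ^+ j.

(** The coefficient of X^N in the Euler product: only the places of degree at
    most N contribute. *)
Definition artin_coef (N : nat) : algC :=
  (euler_factor N Infty *
   \prod_(Q : {poly_N.+1 F} | (val Q \is monic) && `[< irreducible_poly (val Q) >])
     euler_factor N (Fin (val Q)))`_N.

(** The polynomial with these coefficients (0 if there is none). *)
Definition artin_L : {poly algC} :=
  xget 0 [set L : {poly algC} | forall N, L`_N = artin_coef N]%classic.

End ArtinL.
End Places.

Section Cyclotomic.
Variables (p : nat) (S : padic_setup p) (F : finFieldType) (P : {poly F}).
Notation k := {fraction {poly F}}.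

Definition carlitz_over (K : fieldExtType k) (a : {poly F}) : {poly K} :=
  map_poly (in_alg K \o @tofrac _) (carlitz a).

(** K_P = k(Lambda_P) is a splitting field of C_P over k, Lambda_P being the
    set of all roots of C_P. *)
Record cyclotomic_data := CyclotomicData {
  cyc_prime : monic_irreducible_poly P;
  cyc_field : splittingFieldType k;
  cyc_fieldP : splittingFieldFor 1 (carlitz_over cyc_field P) {:cyc_field};
  cyc_embed : {rmorphism {poly %/ P with cyc_prime} -> residue_field (vp S)} }.

Variable D : cyclotomic_data.
Notation A_P := {poly %/ P with cyc_prime D}.
Notation K := (cyc_field D).

(** Meant for x != 0 only. *)
Definition teichmuller (x : A_P) : algC :=
  xget 0 [set z : algC | z ^+ (#|F| ^ poly_deg P).-1 = 1 /\
                 residue (vp S) (setup_embed S z) = cyc_embed D x]%classic.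

(** The class b in (A/P)^* such that s = sigma_b. *)
Definition artin_class (s : gal_of {:K}) : A_P :=
  xget 0 [set b : A_P | b != 0 /\ forall z : K, root (carlitz_over K P) z ->
                 s z = (carlitz_over K (val b)).[z]]%classic.

Definition omega_pow (i : nat) (s : gal_of {:K}) : algC :=
  teichmuller (artin_class s) ^+ i.

Definition deg_g (i : nat) : nat :=
  poly_deg (congr1_part S (artin_L (omega_pow i))).

End Cyclotomic.

Definition q_magic (q i : nat) :=
  exists c n : nat, (c <= q - 2)%N /\ i = (c * q ^ n + q ^ n - 1)%N.

(** Goss's conjecture, for a choice of embeddings of Qbar in the algebraic
    closures of the Q_p. *)
Definition goss_conjecture (S : forall p, prime p -> padic_setup p) :=
  forall (p : nat) (pr : prime p) (F : finFieldType) (P : {poly F}) (i : nat),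
    p \in [pchar F] -> P \is monic -> irreducible_poly P -> q_magic #|F| i ->
    (1 <= i <= #|F| ^ poly_deg P - 2)%N ->
    forall D : cyclotomic_data (S p pr) P, (deg_g D i <= 1)%N.

Definition artin_schreier (p : nat) (a : 'F_p) : {poly 'F_p} :=
  'X^p - 'X - a%:P.

(* Main.v *)
(** Let theta be the class of T in A/P, P = T^p - T - a, so that
    theta^(p^n) = theta + n a. For a nontrivial even power chi of omega_P, the
    element sigma_Q is the Frobenius at Q <> P, P is ramified and infinity splits
    in the field cut out by chi. Hence the coefficient of X^N in L(X, chi) is the
    sum of chi(b) over the monic b of degree at most N, where the partial sums
    come from the Euler factor 1/(1 - X) at infinity; it vanishes for N >= p - 1.

    For chi = omega_P^(p^n - 1) the monic b of degree j contribute, modulo p,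
    S_j(n) = sum_b b(theta + n a) / b(theta). This is a polynomial in theta + n a
    of degree at most j which vanishes for n < j, hence S_j(n) = g_j C(n, j). Now
    sum_j S_j(n) = 0 for 0 < n < p forces g_j = (-1)^j, so that L(X, chi) is
    congruent to sum_N (-1)^N C(n - 1, N) X^N = (1 - X)^(n - 1), and exactly
    n - 1 of the alpha_j are congruent to 1. *)
Require Import Defs.
From mathcomp Require Import all_boot all_order all_algebra all_field.
From mathcomp Require Import classical_sets cardinality.
From HB Require Import structures.
From mathcomp Require Import all_fingroup all_solvable.
From mathcomp Require Import fraction qpoly qfpoly ring_quotient generic_quotient.
From mathcomp Require Import boolp constructive_ereal.
From mathcomp Require Import zify ring lra.
Set Implicit Arguments.
Unset Strict Implicit.
Unset Printing Implicit Defensive.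
Import Order.TTheory GRing.Theory Num.Theory.
Local Open Scope ring_scope.

(** * Valuations *)

(** The L-function is defined through valuations: [unramified] and [is_frobenius] quantify over the
    places above a given one, and [char_at] picks a Frobenius by choice. A local value is therefore
    known only once places above exist (otherwise the quantifiers are vacuous and every automorphism
    counts as a Frobenius) and all Frobenius elements give chi the same value. Existence comes from
    Chevalley's theorem, which yields valuation rings; algebraicity of bounded degree makes these
    discrete.

    The vanishing of S_j(n) for n < j comes from p^n - 1 < p^(j-1): for an exponent that small,
    summing over the coefficients of degree below j - 1 gives a value which does not depend on the
    coefficient of T^(j-1), and the q choices of that coefficient then contribute a factor q = 0.
    The bound n < p makes the character nontrivial, because theta + n a differs from theta; the
    bound j < p keeps the j interpolation nodes theta + i a distinct. *)

Section ValuationTheory.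
Variables (R : realDomainType) (E : fieldType) (v : valuation R E).

(* [ord 0] is a junk value: [fine +oo = 0]. *)
Definition ord (x : E) : R := fine (v x).

(** Stated with [v] and not with [ord], so that it holds at 0 and estimates need no case split on
    vanishing. *)
Definition vge (n : R) (x : E) : bool := (n%:E <= v x)%E.

Lemma ordE x : x != 0 -> v x = (ord x)%:E.
Proof. by move=> x0; rewrite /ord fineK // val_fun_fin. Qed.

Lemma vgeE n x : x != 0 -> vge n x = (n <= ord x).
Proof. by move=> x0; rewrite /vge ordE // lee_fin. Qed.

Lemma vge0 n : vge n 0.
Proof. by rewrite /vge val_fun0 leey. Qed.

Lemma ordM x y : x != 0 -> y != 0 -> ord (x * y) = ord x + ord y.
Proof.
move=> x0 y0; have xy0 : x * y != 0 by rewrite mulf_neq0.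
by have := val_funM v x y; rewrite !ordE // => -[].
Qed.

Lemma ord_one : ord 1 = 0.
Proof.
have := ordM (oner_neq0 E) (oner_neq0 E); rewrite mulr1 => /eqP.
by rewrite -subr_eq subrr eq_sym => /eqP.
Qed.

Lemma ordN x : ord (- x) = ord x.
Proof.
have [->|x0] := eqVneq x 0; first by rewrite oppr0.
have m0 : (-1 : E) != 0 by rewrite oppr_eq0 oner_eq0.
rewrite -mulN1r ordM //; have := ordM m0 m0; rewrite mulrNN mulr1 ord_one => /esym/eqP.
by rewrite -mulr2n mulrn_eq0 /= => /eqP->; rewrite add0r.
Qed.

Lemma ordV x : x != 0 -> ord x^-1 = - ord x.
Proof.
move=> x0; have xV0 : x^-1 != 0 by rewrite invr_eq0.
by apply/eqP; rewrite -addr_eq0 -ordM // mulVf // ord_one.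
Qed.

Lemma ordX x n : x != 0 -> ord (x ^+ n) = ord x *+ n.
Proof.
move=> x0; elim: n => [|n IH]; first by rewrite expr0 ord_one.
by rewrite exprS ordM ?expf_neq0 // IH mulrS.
Qed.

Lemma ord_prod I (r : seq I) (P : pred I) (F : I -> E) :
  (forall i, P i -> F i != 0) ->
  ord (\prod_(i <- r | P i) F i) = \sum_(i <- r | P i) ord (F i).
Proof.
move=> F0; suff [] : \prod_(i <- r | P i) F i != 0 /\
  ord (\prod_(i <- r | P i) F i) = \sum_(i <- r | P i) ord (F i) by [].
apply: (big_rec2 (fun x y => x != 0 /\ ord x = y)) => [|i y x Pi [x0 <-]].
  by rewrite oner_neq0 ord_one.
by rewrite mulf_neq0 ?F0 ?ordM ?F0.
Qed.

Lemma vgeW m n x : m <= n -> vge n x -> vge m x.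
Proof. by move=> mn; apply: le_trans; rewrite lee_fin. Qed.

Lemma vgeD n x y : vge n x -> vge n y -> vge n (x + y).
Proof.
move=> vx vy; apply: le_trans (val_funD v x y).
by rewrite le_min [X in X && _]vx.
Qed.

Lemma vgeM m n x y : vge m x -> vge n y -> vge (m + n) (x * y).
Proof. by move=> vx vy; rewrite /vge val_funM EFinD leeD. Qed.

Lemma vgeN n x : vge n (- x) = vge n x.
Proof.
have [->|x0] := eqVneq x 0; first by rewrite oppr0.
by rewrite !vgeE ?ordN ?oppr_eq0.
Qed.

Lemma vgeB n x y : vge n x -> vge n y -> vge n (x - y).
Proof. by move=> vx vy; rewrite vgeD ?vgeN. Qed.

Lemma vge_sum n I (r : seq I) (P : pred I) (F : I -> E) :
  (forall i, P i -> vge n (F i)) -> vge n (\sum_(i <- r | P i) F i).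
Proof. by move=> vF; elim/big_ind: _ => [|x y|//]; [exact: vge0 | exact: vgeD]. Qed.

Lemma vge1 : vge 0 1.
Proof. by rewrite vgeE ?oner_neq0 // ord_one. Qed.

Lemma vgeX n x k : vge n x -> vge (n *+ k) (x ^+ k).
Proof.
move=> vx; elim: k => [|k IH]; first exact: vge1.
by rewrite exprS mulrS vgeM.
Qed.

Lemma vge0X x k : vge 0 x -> vge 0 (x ^+ k).
Proof. by move=> /(vgeX k); rewrite mul0rn. Qed.

Lemma vge0M x y : vge 0 x -> vge 0 y -> vge 0 (x * y).
Proof. by move=> vx vy; rewrite -[0 : R]addr0 vgeM. Qed.

Lemma vge_nat k : vge 0 k%:R.
Proof. by elim: k => [|k IH]; rewrite ?vge0 // mulrS vgeD ?vge1. Qed.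

Lemma vge_prod I (r : seq I) (P : pred I) (F : I -> E) :
  (forall i, P i -> vge 0 (F i)) -> vge 0 (\prod_(i <- r | P i) F i).
Proof. by move=> vF; elim/big_ind: _ => [|x y|//]; [exact: vge1 | exact: vge0M]. Qed.

Lemma vge_gt_neq0 n x : ~~ vge n x -> x != 0.
Proof. by apply: contraNneq => ->; exact: vge0. Qed.

(** The inequality is conditional on [y != 0] because [ord 0] is a junk value; this covers [y = 0]
    as well. *)
Lemma ord_dominant x y : x != 0 -> (y != 0 -> ord x < ord y) ->
  x + y != 0 /\ ord (x + y) = ord x.
Proof.
move=> x0; have [->|y0 /(_ isT) xy] := eqVneq y 0; first by rewrite addr0.
have xy0 : x + y != 0.
  by apply: contraTneq xy => /eqP; rewrite addr_eq0 => /eqP->; rewrite ordN ltxx.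
split=> //; apply/eqP; rewrite eq_le; apply/andP; split; last first.
  by rewrite -vgeE // vgeD // vgeE // ltW.
rewrite leNgt; apply: contraTN xy => xy; rewrite -leNgt.
(* If x + y had larger order than x, then so would x = (x + y) - y, unless y has order at most that
   of x. *)
have : vge (Order.min (ord (x + y)) (ord y)) (x + y - y).
  by rewrite vgeB // vgeE // ge_min lexx ?orbT.
rewrite addrK vgeE // ge_min => /orP[|//].
by rewrite leNgt xy.
Qed.

(** Valuation rings are integrally closed: for [ord x < 0] the leading power has smaller order than
    all lower terms, which therefore cannot cancel it. *)
Lemma vge_integral (f : {poly E}) x : f \is monic -> root f x ->
  (forall i, vge 0 f`_i) -> vge 0 x.
Proof.
move=> fm fx vf; have [->|x0] := eqVneq x 0; first exact: vge0.
rewrite vgeE // leNgt; apply/negP => xneg.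
have sf : size f = (size f).-1.+1.
  by rewrite prednK // size_poly_gt0 monic_neq0.
have /eqP fm1 : lead_coef f == 1 by rewrite -/(f \is monic).
move: fx; rewrite /root horner_coef sf big_ord_recr /= -lead_coefE fm1 mul1r.
rewrite addrC addr_eq0 => /eqP fx.
have [n0|n0] := posnP (size f).-1.
  by move: fx; rewrite n0 big_ord0 => /eqP; rewrite expr0 oppr0 oner_eq0.
have : vge (ord x *+ (size f).-2) (x ^+ (size f).-1).
  rewrite fx vgeN; apply: vge_sum => i _; rewrite -[X in vge X]add0r vgeM //.
  apply: (@vgeW _ (ord x *+ i)); last by rewrite vgeE ?expf_neq0 // ordX.
  rewrite -(@subnK i (size f).-2); last by rewrite -ltnS prednK.
  by rewrite mulrnDr gerDr mulrn_wle0 // ltW.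
rewrite vgeE ?expf_neq0 // ordX // -(prednK n0) mulrS.
by rewrite lerDr leNgt xneg.
Qed.

End ValuationTheory.

(** * Normalisation of integer-valued valuations *)

Section PlaceConstruction.
Variables (K : fieldType) (w : K -> int).
Hypothesis wM : forall x y : K, x != 0 -> y != 0 -> w (x * y) = w x + w y.
Hypothesis wD : forall x y : K, x != 0 -> y != 0 -> x + y != 0 ->
  Order.min (w x) (w y) <= w (x + y).

Let w1 : w 1 = 0.
Proof.
have := wM (oner_neq0 K) (oner_neq0 K); rewrite mulr1 => /eqP.
by rewrite -subr_eq subrr eq_sym => /eqP.
Qed.

Let wV (x : K) : x != 0 -> w x^-1 = - w x.
Proof.
move=> x0.
by have := wM x0 (invr_neq0 x0); rewrite mulfV // w1 => h; apply/eqP; rewrite -addr_eq0 addrC -h.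
Qed.

Let wX (x : K) n : x != 0 -> w (x ^ n) = n * w x.
Proof.
have wXn m (y : K) : y != 0 -> w (y ^+ m) = m%:Z * w y.
  move=> y0; elim: m => [|m IH]; first by rewrite expr0 w1 mul0r.
  by rewrite exprS wM ?expf_neq0 // IH intS mulrDl mul1r.
case: n => n x0; first exact: wXn.
by rewrite NegzE -exprnN wV ?expf_neq0 // wXn // mulNr.
Qed.

(** The values of [w] form a nontrivial subgroup of the integers, and [g] is its positive generator.
    It is returned because it becomes a ramification index. *)
Lemma normalised_place : (exists2 x : K, x != 0 & w x != 0) ->
  exists (v : place_of K) (g : nat), (0 < g)%N /\
    forall x : K, x != 0 -> w x = g%:Z * ord v x.
Proof.
move=> [x0 x0n wx0].
pose P n := `[< (0 < n)%N /\ exists2 x : K, x != 0 & w x = n%:Z >].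
have exP : exists n, P n.
  exists `|w x0|%N; apply/asboolP; split; first by rewrite absz_gt0.
  have [wpos|wneg] := leP 0 (w x0); first by exists x0 => //; lia.
  by exists x0^-1; rewrite ?invr_neq0 // wV //; lia.
case: (ex_minnP exP) => g /asboolP[g0 [y y0 wy]] gmin.
(* The remainder of [w x] modulo [g] is again a value of [w], so the minimality of [g] makes it
   0. *)
have dvdg (x : K) : x != 0 -> w x = g%:Z * (w x %/ g)%Z.
  move=> xn; have := divz_eq (w x) g; set r := (_ %% _)%Z => wxE.
  have r0 : 0 <= r by rewrite modz_ge0 // -lt0n.
  have rg : r < g by rewrite ltz_pmod.
  have zE : w (x * y ^ (- (w x %/ g)%Z)) = r.
    by rewrite wM ?expfz_neq0 // wX // wy; lia.
  have [r00|rn0] := eqVneq r 0; first by rewrite {1}wxE r00; lia.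
  have : P `|r|%N.
    apply/asboolP; split; first by rewrite absz_gt0.
    exists (x * y ^ (- (w x %/ g)%Z)); last by lia.
    by rewrite mulf_neq0 ?expfz_neq0.
  by move=> /gmin; lia.
pose v (x : K) : \bar int := if x == 0 then +oo%E else (w x %/ g)%Z%:E.
have vE (x : K) : x != 0 -> v x = (w x %/ g)%Z%:E by rewrite /v => /negPf->.
have v0 : v 0 = +oo%E by rewrite /v eqxx.
have vfin (x : K) : x != 0 -> v x \is a fin_num by move=> xn; rewrite vE.
have vM (x z : K) : v (x * z) = (v x + v z)%E.
  have [->|xn] := eqVneq x 0.
    by rewrite mul0r v0; have [->|zn] := eqVneq z 0; rewrite ?v0 // vE.
  have [->|zn] := eqVneq z 0; first by rewrite mulr0 v0 vE.
  rewrite !vE ?mulf_neq0 // -EFinD; congr (_%:E).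
  have := dvdg _ (mulf_neq0 xn zn); rewrite wM // (dvdg _ xn) (dvdg _ zn).
  by rewrite -mulrDr => /mulfI -> //; rewrite ?mulKz //; lia.
have vD (x z : K) : (Order.min (v x) (v z) <= v (x + z)%R)%E.
  have [->|xn] := eqVneq x 0; first by rewrite add0r ge_min lexx orbT.
  have [->|zn] := eqVneq z 0; first by rewrite addr0 ge_min lexx.
  have [->|xzn] := eqVneq (x + z) 0; first by rewrite v0 leey.
  rewrite !vE // ge_min !lee_fin; have := wD xn zn xzn.
  have mono (a b : int) : a <= b -> ((a %/ g)%Z <= (b %/ g)%Z) by exact: lez_pdiv2r.
  by rewrite ge_min => /orP[] /mono ->; rewrite ?orbT.
have norm : exists x, (Valuation v0 vfin vM vD : K -> \bar int) x = 1%:E.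
  by exists y; rewrite /= vE // wy divzz; case: eqP => //; lia.
exists (PlaceOf norm), g; split=> // x xn; rewrite {1}(dvdg _ xn); congr (_ * _).
by rewrite /ord /= vE.
Qed.

End PlaceConstruction.

(** * Chevalley's theorem: enlarging a subring to a valuation ring *)

Section Chevalley.
Variables (K : fieldType).

Definition is_subring (B : K -> Prop) :=
  [/\ B 1, forall x y, B x -> B y -> B (x - y) & forall x y, B x -> B y -> B (x * y)].

Definition is_valring (O : K -> Prop) :=
  is_subring O /\ forall x, x != 0 -> O x \/ O x^-1.

Section Subring.
Variables (B : K -> Prop) (HB : is_subring B).

Lemma subring0 : B 0.
Proof. by case: HB => B1 BB _; rewrite -(subrr 1); apply: BB. Qed.
Lemma subringN x : B x -> B (- x).
Proof. by case: HB => B1 BB _ Bx; rewrite -sub0r; apply: BB => //; exact: subring0. Qed.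
Lemma subringD x y : B x -> B y -> B (x + y).
Proof. by move=> Bx By; case: (HB) => _ BB _; rewrite -[y]opprK; apply/BB/subringN. Qed.
Lemma subringM x y : B x -> B y -> B (x * y).
Proof. by case: HB => _ _; exact. Qed.
Lemma subring1 : B 1. Proof. by case: HB. Qed.
Lemma subringX x n : B x -> B (x ^+ n).
Proof.
move=> Bx; elim: n => [|n IH]; first by rewrite expr0; exact: subring1.
by rewrite exprS; apply: subringM.
Qed.
Lemma subring_sum I (r : seq I) (P : pred I) (F : I -> K) :
  (forall i, P i -> B (F i)) -> B (\sum_(i <- r | P i) F i).
Proof. by move=> BF; elim/big_ind: _ => //; [exact: subring0 | exact: subringD]. Qed.
End Subring.

Definition adjoin (B : K -> Prop) (x y : K) :=
  exists2 f : {poly K}, (forall i, B f`_i) & y = f.[x].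

Lemma adjoin_subring B x : is_subring B -> is_subring (adjoin B x).
Proof.
move=> HB; split.
- exists 1; last by rewrite hornerC.
  by move=> [|i]; rewrite coef1 /=; [exact: subring1 | exact: subring0].
- move=> _ _ [f Bf ->] [g Bg ->]; exists (f - g); last by rewrite !hornerE.
  by move=> i; rewrite coefB; case: HB => _ BB _; apply: BB.
- move=> _ _ [f Bf ->] [g Bg ->]; exists (f * g); last by rewrite hornerM.
  by move=> i; rewrite coefM; apply: subring_sum => // j _; apply: subringM.
Qed.

Lemma adjoin_sub B x y : is_subring B -> B y -> adjoin B x y.
Proof.
move=> HB By; exists y%:P; last by rewrite hornerC.
by move=> [|i]; rewrite coefC //=; exact: subring0.
Qed.

Lemma adjoin_gen B x : is_subring B -> adjoin B x x.
Proof.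
move=> HB; exists 'X; last by rewrite hornerX.
by move=> i; rewrite coefX; case: eqP => _; [exact: subring1 | exact: subring0].
Qed.

(* If both [x] and [x^-1] made [pi] invertible, a pair of relations of minimal
   degree could be shortened by substituting one into the other. *)
Lemma inverse_adjoin_contra (B : K -> Prop) (pi x : K) : is_subring B -> B pi ->
  pi != 0 -> x != 0 ->
  (forall b, B b -> 1 - pi * b != 0 /\ B (1 - pi * b)^-1) ->
  adjoin B x pi^-1 -> adjoin B x^-1 pi^-1 -> False.
Proof.
move=> HB Bpi pi0.
pose rel x n := exists f : {poly K}, [/\ forall i, B f`_i, (size f <= n)%N & pi * f.[x] = 1].
have relP y : adjoin B y pi^-1 -> exists n, rel y n.
  by move=> [f Bf fE]; exists (size f), f; rewrite -fE mulfV.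
move=> x0 units /relP[n0 r0] /relP[m0 s0].
have shorten N : forall n m y, y != 0 -> (n + m <= N)%N -> rel y n -> rel y^-1 m ->
    False.
  elim: N => [|N IH] n m y y0 nmN rn rm.
    case: rn => f [_ sf]; have -> : f = 0 by apply/eqP; rewrite -size_poly_leq0; lia.
    by rewrite horner0 mulr0 => /esym/eqP; rewrite oner_eq0.
  (* The situation is symmetric under exchanging [y] with its inverse. *)
  wlog mn : n m y y0 nmN rn rm / (m <= n)%N => [wl|].
    case: (leqP m n) => [|nm]; first exact: (wl n m y).
    by apply: (wl m n y^-1) => //; rewrite ?invr_eq0 ?invrK 1?addnC // ltnW.
  have [f [Bf sf fE]] := rn; have [g [Bg sg gE]] := rm.
  case: n => [|n] in nmN rn mn sf *.
    move: fE; have -> : f = 0 by apply/eqP; rewrite -size_poly_leq0.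
    by rewrite horner0 mulr0 => /esym/eqP; rewrite oner_eq0.
  case: m => [|m] in nmN rm mn sg *.
    move: gE; have -> : g = 0 by apply/eqP; rewrite -size_poly_leq0.
    by rewrite horner0 mulr0 => /esym/eqP; rewrite oner_eq0.
  have [u0 Bu] := units _ (Bg 0%N); set u := 1 - _ in u0 Bu.
  have [n1|npos] := posnP n.
    move: fE gE; rewrite (size1_polyC (leq_trans sf _)) ?n1 // hornerC => fE _.
    have [] := units _ (Bf 0%N); by rewrite fE subrr eqxx.
  (* u = pi * sum_(1 <= j <= m) g_j y^-j, so y^n = u^-1 pi sum g_j y^(n-j) *)
  have uE : y ^+ n = u^-1 * pi * \sum_(j < m) g`_j.+1 * y ^+ (n - j.+1).
    apply: (mulfI u0); rewrite -!mulrA mulVKf //.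
    move: gE; rewrite (horner_coef_wide _ sg) big_ord_recl expr0 mulr1 mulrDr => gE.
    rewrite /u -[in LHS]gE addrC addKr -mulrA; congr (_ * _); rewrite mulr_suml.
    apply: eq_bigr => j _; rewrite -mulrA; congr (_ * _).
    have jn : (j.+1 <= n)%N by have := ltn_ord j; lia.
    rewrite -{1}(subnK jn) exprD mulrCA /= /bump /= add1n exprVn mulVf ?mulr1 //.
    by rewrite expf_neq0.
  pose h := \poly_(i < n) (f`_i) + (f`_n * u^-1 * pi) *: 
     \sum_(j < m) g`_j.+1 *: 'X^(n - j.+1).
  apply: (IH n m.+1 y) => //.
  exists h; split.
  - move=> i; rewrite coefD coefZ coef_poly; apply: subringD => //.
      by case: ifP => _ //; exact: subring0.
    apply: subringM => //.
      by do 2?apply: subringM.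
    rewrite coef_sum; apply: subring_sum => // j _; rewrite coefZ coefXn.
    by apply: subringM => //; case: eqP => _; [exact: subring1 | exact: subring0].
  - rewrite (leq_trans (size_polyD _ _)) // geq_max size_poly /=.
    rewrite (leq_trans (size_scale_leq _ _)) // (leq_trans (size_sum _ _ _)) //.
    apply/bigmax_leqP => j _; rewrite (leq_trans (size_scale_leq _ _)) //.
    by rewrite size_polyXn; lia.
  - rewrite -fE (horner_coef_wide _ sf) big_ord_recr /= hornerD; congr (_ * (_ + _)).
      by rewrite horner_poly.
    rewrite hornerZ uE -!mulrA; do 3!congr (_ * _); rewrite horner_sum.
    by apply: eq_bigr => j _; rewrite hornerZ hornerXn.
exact: (shorten (n0 + m0)%N n0 m0 x).
Qed.

(** Zorn's lemma for the rings containing [B] and omitting [pi^-1]. In a maximal such [O] all 1 - pi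
    b are units, and an [x] with neither [x] nor [x^-1] in [O] would put [pi^-1] in both
    adjunctions. *)
Lemma chevalley (B : K -> Prop) (pi : K) : is_subring B -> B pi -> pi != 0 ->
  ~ B pi^-1 ->
  exists O, [/\ is_valring O, (forall x, B x -> O x) & ~ O pi^-1].
Proof.
move=> HB Bpi pi0 piV.
pose P : set (set K) := [set R | R = set0 \/
   [/\ is_subring R, (forall x, B x -> R x) & ~ R pi^-1]]%classic.
have [F FP Ftot|O [PO Omax]] := @Zorn_bigcup _ P.
  have [[R0 FR0 R0n]|Fno] := pselect (exists2 R, F R & R <> set0); last first.
    left; apply/seteqP; split=> // x [R FR Rx]; exfalso; apply: Fno; exists R => //.
    by move=> R0; move: Rx; rewrite R0.
  have good R x : F R -> R x -> [/\ is_subring R, (forall x, B x -> R x) & ~ R pi^-1].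
    by move=> FR Rx; case: (FP _ FR) => // RE; move: Rx; rewrite RE.
  have [HR0 BR0 _] : [/\ is_subring R0, (forall x, B x -> R0 x) & ~ R0 pi^-1].
    by case: (FP _ FR0).
  right; split.
  - have join x y : (\bigcup_(X in F) X)%classic x -> (\bigcup_(X in F) X)%classic y ->
        exists R, [/\ F R, R x, R y & is_subring R].
      move=> [R FR Rx] [R' FR' R'y]; have [HR _ _] := good _ _ FR Rx.
      have [HR' _ _] := good _ _ FR' R'y.
      case: (Ftot _ _ FR FR') => sub; first by exists R'; split=> //; exact: sub.
      by exists R; split=> //; exact: sub.
    split.
    + by exists R0 => //; exact: subring1.
    + move=> x y Ux Uy; have [R [FR Rx Ry [_ RB _]]] := join _ _ Ux Uy.
      by exists R => //; exact: RB.
    + move=> x y Ux Uy; have [R [FR Rx Ry HR]] := join _ _ Ux Uy.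
      by exists R => //; exact: subringM.
  - by move=> x Bx; exists R0 => //; exact: BR0.
  - by move=> [R FR Rpi]; have [_ _] := good _ _ FR Rpi.
have [HO BO piO] : [/\ is_subring O, (forall x, B x -> O x) & ~ O pi^-1].
  case: PO => // OE; exfalso; apply: (Omax B); last by right.
  by rewrite OE; split; [move=> x [] | move=> /(_ 1); apply; exact: subring1].
have grow x : ~ O x -> adjoin O x pi^-1.
  move=> Ox; have [//|xpi] := pselect (adjoin O x pi^-1); exfalso.
  apply: (Omax (adjoin O x)).
    split; first by move=> y; exact: adjoin_sub.
    by move=> /(_ x) sub; apply/Ox/sub/adjoin_gen.
  right; split=> //; first exact: adjoin_subring.
  by move=> y By; apply: adjoin_sub => //; exact: BO.
exists O; split=> //; split=> // x x0.
have [|Ox] := pselect (O x); first by left.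
right; have [//|OxV] := pselect (O x^-1); exfalso.
apply: (@inverse_adjoin_contra O pi x) => //; [exact: BO | | exact: grow | exact: grow].
move=> b Ob; have s0 : 1 - pi * b != 0.
  rewrite subr_eq0; apply/eqP => pb; apply: piO.
  by rewrite -[pi^-1]mulr1 pb mulKf.
split=> //; have [//|/grow[f Of fE]] := pselect (O (1 - pi * b)^-1); exfalso.
(* clearing denominators in pi^-1 = f((1 - pi b)^-1) gives s^k = pi * r *)
set s := 1 - pi * b in s0 fE.
have Os k : exists2 c, O c & s ^+ k = 1 - pi * c.
  have Opi : O pi by exact: BO.
  elim: k => [|k [c Oc kE]]; first by exists 0; [exact: subring0 | rewrite mulr0 subr0].
  exists (b + c - pi * b * c).
    have Opb : O (pi * b) by exact: subringM.
    case: (HO) => _ OB _; apply: OB; first exact: subringD.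
    exact: subringM.
  by rewrite exprS kE /s; ring.
have [c Oc cE] := Os (size f).-1.
have Or : O (\sum_(i < size f) f`_i * s ^+ ((size f).-1 - i)).
  apply: subring_sum => // i _; apply: subringM => //; apply: subringX => //.
  case: (HO) => O1 OB _; apply: OB => //; apply: subringM => //; exact: BO.
have rE : s ^+ (size f).-1 = pi * \sum_(i < size f) f`_i * s ^+ ((size f).-1 - i).
  rewrite -[LHS]mul1r -(mulfV pi0) fE -mulrA; congr (_ * _).
  rewrite horner_coef mulr_suml; apply: eq_bigr => i _; rewrite -mulrA; congr (_ * _).
  have ilt : (i <= (size f).-1)%N by have := ltn_ord i; lia.
  by rewrite -{1}(subnK ilt) exprD mulrCA exprVn mulVf ?mulr1 ?expf_neq0.
apply: piO; suff -> : pi^-1 = c + \sum_(i < size f) f`_i * s ^+ ((size f).-1 - i).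
  exact: subringD.
apply: (mulfI pi0); rewrite mulfV // mulrDr -rE cE; ring.
Qed.

End Chevalley.

(** * From a valuation ring to a discrete place *)

Section ValringPlace.
Variables (K : fieldType) (O : K -> Prop) (HO : is_valring O).

Definition ring_unit (x : K) := [/\ x != 0, O x & O x^-1].

Let HO1 : is_subring O. Proof. by case: HO. Qed.

Lemma ring_unit1 : ring_unit 1.
Proof. by split; rewrite ?invr1 ?oner_neq0 //; exact: subring1. Qed.

Lemma ring_unitM x y : ring_unit x -> ring_unit y -> ring_unit (x * y).
Proof.
move=> [x0 Ox OxV] [y0 Oy OyV]; split; first by rewrite mulf_neq0.
  exact: subringM.
by rewrite invfM; apply: subringM.
Qed.

Lemma ring_unitV x : ring_unit x -> ring_unit x^-1.
Proof. by move=> [x0 Ox OxV]; split; rewrite ?invrK ?invr_eq0. Qed.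

Lemma ring_unit_div x y : ring_unit x -> ring_unit y -> ring_unit (x / y).
Proof. by move=> ux uy; apply: ring_unitM => //; exact: ring_unitV. Qed.

Lemma ring_unitXn x n : ring_unit x -> ring_unit (x ^+ n).
Proof.
move=> ux; elim: n => [|n IH]; first exact: ring_unit1.
by rewrite exprS; exact: ring_unitM.
Qed.

Lemma ring_unitXnV x n : (0 < n)%N -> x != 0 -> ring_unit (x ^+ n) -> ring_unit x.
Proof.
move=> n0 x0 [_ Ox OxV].
have aux y : y != 0 -> O y -> O (y ^+ n)^-1 -> O y^-1.
  move=> y0 Oy OyV; have -> : y^-1 = y ^+ n.-1 * (y ^+ n)^-1.
    by rewrite -{2}(prednK n0) exprS invfM mulrCA mulfV ?mulr1 // expf_neq0.
  by apply: subringM => //; exact: subringX.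
case: (HO) => _ /(_ x x0) [Oy|Oy]; first by split=> //; exact: aux.
split=> //; rewrite -[x]invrK; apply: aux; rewrite ?invr_neq0 //.
by rewrite exprVn invrK.
Qed.

(** In a vanishing sum the least valuation is attained at least twice. Equality of valuations is
    expressed by the quotient being a unit of [O], the value group being K^*/O^*. *)
Lemma vanishing_sum_associated (I : eqType) (s : seq I) (F : I -> K) : uniq s ->
  (0 < size s)%N -> (forall i, i \in s -> F i != 0) -> \sum_(i <- s) F i = 0 ->
  exists i j, [/\ i \in s, j \in s, i != j & ring_unit (F i / F j)].
Proof.
move=> us s0 F0 sum0.
(* [F m] has least valuation; totality of [O] makes the terms comparable. *)
have [m ms mmax] : exists2 m, m \in s & forall i, i \in s -> O (F i / F m).
  elim: s s0 F0 {us sum0} => // a s IH _ F0.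
  case: s => [|b s] in IH F0 *.
    exists a; first exact: mem_head.
    move=> i; rewrite inE => /eqP->; rewrite divff ?F0 ?mem_head //.
    exact: subring1.
  have [i si|m ms mmax] := IH isT; first by apply: F0; rewrite inE si orbT.
  have Fa : F a != 0 by apply: F0; rewrite mem_head.
  have Fm : F m != 0 by apply: F0; rewrite inE ms orbT.
  have [Oam|Oma] : O (F a / F m) \/ O (F m / F a).
    by case: (HO) => _ /(_ (F a / F m)); rewrite invf_div; apply; rewrite mulf_neq0 ?invr_eq0.
  - exists m; first by rewrite inE ms orbT.
    by move=> i; rewrite inE => /predU1P[->|/mmax].
  - exists a; first exact: mem_head.
    move=> i; rewrite inE => /predU1P[->|/mmax Oim].
      by rewrite divff //; exact: subring1.
    have -> : F i / F a = F i / F m * (F m / F a) by rewrite mulrA divfK.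
    exact: subringM.
have [|no] := pselect (exists2 i, i \in s & i != m /\ O (F m / F i)).
  move=> [i si [im Omi]]; exists i, m; split=> //; split.
  - by rewrite mulf_neq0 ?invr_eq0 ?F0.
  - exact: mmax.
  - by rewrite invf_div.
exfalso.
(* The maximal ideal is closed under addition. Its element 0 is listed apart, since [0^-1 = 0] lies
   in [O]. *)
have maxid (x y : K) : (x = 0 \/ O x /\ ~ O x^-1) -> (y = 0 \/ O y /\ ~ O y^-1) ->
    x + y = 0 \/ O (x + y) /\ ~ O (x + y)^-1.
  move=> [->|[Ox Ox']] [->|[Oy Oy']]; rewrite ?addr0 ?add0r; [by left|by right|by right|].
  have [xy0|xy0] := eqVneq (x + y) 0; first by left.
  right; split; first exact: subringD.
  have x0 : x != 0 by apply/eqP => x0; rewrite x0 invr0 in Ox'; apply: Ox'; exact: subring0.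
  have y0 : y != 0 by apply/eqP => y0; rewrite y0 invr0 in Oy'; apply: Oy'; exact: subring0.
  move=> Oxy; have [Oq|Oq] : O (x / y) \/ O (y / x).
    by case: (HO) => _ /(_ (x / y)); rewrite invf_div; apply; rewrite mulf_neq0 ?invr_eq0.
  - apply: Oy'; have -> : y^-1 = (x / y + 1) * (x + y)^-1 by field; rewrite xy0.
    by apply: subringM => //; apply: subringD => //; exact: subring1.
  - apply: Ox'; have -> : x^-1 = (1 + y / x) * (x + y)^-1 by field; rewrite xy0.
    by apply: subringM => //; apply: subringD => //; exact: subring1.
(* If no other term had the valuation of [F m], these quotients would lie in the maximal ideal, but
   their sum -1 is a unit. *)
have : \sum_(i <- s | i != m) F i / F m = -1.
  have : \sum_(i <- s) F i / F m = 0 by rewrite -mulr_suml sum0 mul0r.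
  rewrite (bigD1_seq m) //= divff ?F0 // addrC => /eqP.
  by rewrite addr_eq0 => /eqP.
have : \sum_(i <- s | i != m) F i / F m = 0 \/ O (\sum_(i <- s | i != m) F i / F m) /\
   ~ O (\sum_(i <- s | i != m) F i / F m)^-1.
  rewrite big_seq_cond; elim/big_ind: _; [by left | exact: maxid |].
  move=> i /andP[si im]; right; split; first exact: mmax.
  by rewrite invf_div => Omi; apply: no; exists i.
move=> + E; rewrite E => -[/eqP|[_]]; first by rewrite oppr_eq0 oner_eq0.
by rewrite invrN invr1; apply; apply: subringN => //; exact: subring1.
Qed.

(** Two terms of an equation of [x] over [k0] have the same valuation, so some power of [x] with
    exponent at most [N] is a power of [pi] up to a unit. The exponent m = N! serves all [x] at
    once: the valuation of [x] in units of [pi] lies in (1/m)Z. *)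
Lemma valring_place (k0 : K -> Prop) (pi : K) (N : nat) :
  O pi -> pi != 0 -> ~ O pi^-1 ->
  (forall y, k0 y -> y != 0 -> exists n : int, ring_unit (y / pi ^ n)) ->
  (forall x, exists f : {poly K}, [/\ f != 0, (size f <= N.+1)%N, root f x &
     forall i, k0 f`_i]) ->
  exists (w : place_of K) (e : nat), (0 < e)%N /\
    forall y (n : int), y != 0 -> ring_unit (y / pi ^ n) -> ord w y = e%:Z * n.
Proof.
move=> Opi pi0 piV Hk0 Halg; pose m := N`!.
have pi_pow_unit (n : int) : ring_unit (pi ^ n) -> n = 0.
  have aux k : ~ ring_unit (pi ^+ k.+1).
    move=> /ring_unitXnV; move=> /(_ isT pi0)[_ _]; exact: piV.
  case: n => [[|k] //|k]; first by move=> /aux.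
  by rewrite NegzE -exprnN => /ring_unitV; rewrite invrK => /aux.
pose W (x : K) (n : int) := ring_unit (x ^+ m / pi ^ n).
have W_uniq x n n' : W x n -> W x n' -> n = n'.
  move=> Wn Wn'; have [xm0|xm0] := eqVneq (x ^+ m) 0.
    by case: Wn; rewrite xm0 mul0r eqxx.
  apply/eqP; rewrite -subr_eq0; apply/eqP/pi_pow_unit.
  have := ring_unit_div Wn' Wn; congr ring_unit.
  by rewrite expfzDr // -invr_expz; field; rewrite xm0 !expfz_neq0.
have W_ex x : x != 0 -> exists n, W x n.
  move=> x0; have [f [f0 sf /rootP fx kf]] := Halg x.
  pose s := [seq i <- iota 0 (size f) | f`_i != 0].
  have [||i||i [j [si sj ij]]] := @vanishing_sum_associated _ s (fun i => f`_i * x ^+ i).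
  - by rewrite filter_uniq // iota_uniq.
  - rewrite lt0n size_eq0 -has_filter; apply/hasP; exists (size f).-1.
      by rewrite mem_iota /= add0n prednK // lt0n size_poly_eq0.
    by rewrite -lead_coefE lead_coef_eq0.
  - by rewrite mem_filter => /andP[fi _]; rewrite mulf_neq0 // expf_neq0.
  - rewrite big_filter big_mkcond -[RHS]fx horner_coef /=.
    rewrite -(big_mkord xpredT (fun i => f`_i * x ^+ i)) /index_iota subn0.
    by apply: eq_bigr => i _; case: eqP => // ->; rewrite mul0r.
  - wlog ij' : i j si sj ij / (j < i)%N => [wl|].
      case: (ltngtP j i) => [|ij'|E]; first exact: (wl i j).
        by move=> /ring_unitV; rewrite invf_div; apply: (wl j i) => //; rewrite eq_sym.
      by move: ij; rewrite E eqxx.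
    move: si sj; rewrite !mem_filter !mem_iota !add0n => /andP[fi isz] /andP[fj jsz] u.
    have [a ua] := Hk0 _ (kf i) fi; have [b ub] := Hk0 _ (kf j) fj.
    have ux : ring_unit (x ^+ (i - j) / pi ^ (b - a)).
      have := ring_unitM (ring_unit_div u ua) ub.
      congr ring_unit; rewrite expfzDr // -invr_expz exprB ?unitfE //; last exact: ltnW.
      field.
      by rewrite fi fj !expf_neq0 // !expfz_neq0.
    (* Both indices are below [size f], so i - j is at most N and divides N!. *)
    have dm : (i - j %| m)%N by apply: dvdn_fact; lia.
    exists ((b - a) * (m %/ (i - j))%N%:Z).
    have := ring_unitXn (m %/ (i - j)) ux.
    by rewrite exprMn exprVn -exprM mulnC divnK // exprnP exprz_exp.
pose w (x : K) : int := xget 0 [set n | W x n]%classic.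
have wP x : x != 0 -> W x (w x).
  by move=> /W_ex[n Wn]; rewrite /w; case: xgetP => [y ->//|/(_ n)].
have wE x n : x != 0 -> W x n -> w x = n by move=> x0; apply: W_uniq (wP _ x0).
have wM (x y : K) : x != 0 -> y != 0 -> w (x * y) = w x + w y.
  move=> x0 y0; apply: wE; first by rewrite mulf_neq0.
  have := ring_unitM (wP _ x0) (wP _ y0); congr ring_unit.
  by rewrite exprMn expfzDr // mulf_div.
have m0 : (0 < m)%N by rewrite fact_gt0.
have wO (z : K) : z != 0 -> O z -> 0 <= w z.
  move=> z0 Oz; have [//|wneg] := leP 0 (w z); exfalso.
  have Opiw : O (pi ^ (- w z))^-1.
    have [_ _ Oinv] := wP _ z0; rewrite -invr_expz invrK.
    have -> : pi ^ w z = z ^+ m * (z ^+ m / pi ^ w z)^-1.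
      by rewrite invf_div mulrCA mulfV ?mulr1 // expf_neq0.
    by apply: subringM => //; exact: subringX.
  move: Opiw; have -> : - w z = `|w z|%N.-1.+1%:Z by lia.
  rewrite -exprnP => Opiw; apply: piV.
  have -> : pi^-1 = pi ^+ `|w z|.-1 * (pi ^+ `|w z|.-1.+1)^-1.
    by rewrite exprS invfM mulrCA mulfV ?mulr1 // expf_neq0.
  by apply: subringM => //; exact: subringX.
have Ow (z : K) : z != 0 -> 0 <= w z -> O z.
  move=> z0 wz; case: (HO) => _ /(_ z z0) [//|OzV].
  have := wO _ (invr_neq0 z0) OzV.
  have w1 : w 1 = 0
    by apply: wE; rewrite ?oner_neq0 // /W expr1n expr0z divr1; exact: ring_unit1.
  have := wM _ _ z0 (invr_neq0 z0); rewrite mulfV // w1 => wV wzV.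
  have w0 : w z = 0 by lia.
  have := wP _ z0; rewrite /W w0 expr0z divr1 => /ring_unitXnV.
  by move=> /(_ m0 z0)[].
have w1 : w 1 = 0
    by apply: wE; rewrite ?oner_neq0 // /W expr1n expr0z divr1; exact: ring_unit1.
have wV (x : K) : x != 0 -> w x^-1 = - w x.
  by move=> x0; have := wM _ _ x0 (invr_neq0 x0); rewrite mulfV // w1 => h; lia.
have wD (x y : K) : x != 0 -> y != 0 -> x + y != 0 -> Order.min (w x) (w y) <= w (x + y).
  wlog xy : x y / w x <= w y => [wl|x0 y0 xy0].
    have [|/ltW yx] := leP (w x) (w y); first by
      move=> h x0 y0 xy0; have := wl _ _ h x0 y0 xy0; rewrite min_l.
    by move=> x0 y0; rewrite addrC => xy0; have := wl _ _ yx y0 x0 xy0; rewrite min_l.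
  rewrite min_l //; have q0 : y / x != 0 by rewrite mulf_neq0 ?invr_eq0.
  have Oq : O (y / x) by apply: Ow => //; rewrite wM ?invr_eq0 // wV //; lia.
  have s0 : 1 + y / x != 0 by rewrite -(mulfV x0) -mulrDl mulf_neq0 ?invr_eq0.
  have : 0 <= w (1 + y / x) by apply: wO => //; apply: subringD => //; exact: subring1.
  have -> : x + y = x * (1 + y / x) by rewrite mulrDr mulr1 mulrCA mulfV // mulr1.
  by rewrite wM //; lia.
have wn y (n : int) : y != 0 -> ring_unit (y / pi ^ n) -> w y = m%:Z * n.
  move=> y0 u; apply: wE => //; have := ring_unitXn m u; congr ring_unit.
  by rewrite exprMn exprVn -[((pi ^ n) ^+ m)]/((pi ^ n) ^ m%:Z) exprz_exp [n * _]mulrC.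
have wpi : w pi = m by rewrite (wn _ 1) ?mulr1 // expr1z divff //; exact: ring_unit1.
have [|v [g [g0 vE]]] := normalised_place wM wD.
  by exists pi => //; rewrite wpi; lia.
(* Normalising divides [w] by [g]; as [w pi = m], the index is m / g. *)
have gm : (g%:Z %| m%:Z)%Z by rewrite -wpi vE // dvdz_mulr.
exists v, (m %/ g)%N; split; first by rewrite divn_gt0 // dvdn_leq.
move=> y n y0 /(wn _ _ y0); rewrite vE //.
have -> : m%:Z = g%:Z * (m %/ g)%N%:Z by rewrite -PoszM mulnC divnK.
by rewrite -mulrA => /mulfI->; rewrite //; lia.
Qed.

End ValringPlace.

(** * Extension and restriction of places *)

Section SubfieldPlaces.
Variables (k : fieldType) (K : fieldExtType k).

(** The degree bound is uniform in [x], as [valring_place] requires. *)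
Lemma subfield_poly_root (E : {subfield K}) (x : K) : exists f : {poly K},
  [/\ f != 0, (size f <= (\dim {:K}).+1)%N, root f x & forall i, f`_i \in E].
Proof.
exists (minPoly E x); split.
- exact/monic_neq0/monic_minPoly.
- rewrite size_minPoly ltnS.
  apply: leq_trans (dimvS (subvf <<E; x>>%VS)); rewrite dim_Fadjoin.
  by rewrite leq_pmulr // adim_gt0.
- exact: root_minPoly.
- exact/polyOverP/minPolyOver.
Qed.

(** Chevalley's theorem for the valuation ring of [w]. The ring [O] contains the inverses of the
    units of [w], so each nonzero element of [E] is a power of the uniformiser [p] times a unit of
    [O]. *)
Lemma extend_place (E : {subfield K}) (w : place_of (subvs_of E)) :
  exists (w' : place_of K) (e : nat), (0 < e)%N /\
    forall x : subvs_of E, x != 0 -> ord w' (vsval x) = e%:Z * ord w x.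
Proof.
pose B (x : K) := exists2 y : subvs_of E, vsval y = x & vge w 0 y.
have HB : is_subring B.
  split.
  - by exists 1; [exact: rmorph1 | exact: vge1].
  - by move=> _ _ [x <- wx] [y <- wy]; exists (x - y); rewrite ?raddfB ?vgeB.
  - by move=> _ _ [x <- wx] [y <- wy]; exists (x * y); rewrite ?rmorphM ?vge0M.
have [p wp] := place_normalised w.
have p0 : p != 0 by apply: contra_eq_neq wp => ->; rewrite val_fun0.
have op : ord w p = 1 by rewrite /ord wp.
have vs0 (x : subvs_of E) : (vsval x == 0) = (x == 0).
  by rewrite -(inj_eq val_inj).
have pi0 : vsval p != 0 by rewrite vs0.
have [|||O [HO BO Opi]] := @chevalley _ B (vsval p) HB.
- by exists p => //; rewrite vgeE // op.
- by [].
- move=> [y yE]; have y0 : y != 0 by rewrite -vs0 yE invr_eq0.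
  have -> : y = p^-1 by apply: val_inj; rewrite /= yE -fmorphV.
  by rewrite vgeE ?invr_eq0 // ordV // op.
have unitE (x : subvs_of E) : x != 0 -> ring_unit O (vsval x / vsval p ^ ord w x).
  move=> x0; have -> : vsval x / vsval p ^ ord w x = vsval (x / p ^ ord w x).
    by rewrite rmorphM fmorphV rmorphXz ?unitfE.
  have oz (n : int) : ord w (p ^ n) = n.
    case: n => n; first by rewrite -exprnP ordX // op natz.
    by rewrite NegzE -exprnN ordV ?expf_neq0 // ordX // op natz.
  have q0 : x / p ^ ord w x != 0 by rewrite mulf_neq0 // invr_eq0 expfz_neq0.
  have qo : ord w (x / p ^ ord w x) = 0.
    by rewrite ordM // ?invr_eq0 ?expfz_neq0 // ordV ?expfz_neq0 // oz subrr.
  split; first by rewrite vs0.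
    by apply: BO; exists (x / p ^ ord w x) => //; rewrite vgeE // qo.
  apply: BO; exists (x / p ^ ord w x)^-1; first by rewrite fmorphV.
  by rewrite vgeE ?invr_eq0 // ordV // qo oppr0.
have [||x|w' [e [e0 we]]] := @valring_place _ O HO (fun x => x \in E) (vsval p) (\dim {:K}) _ pi0 Opi.
- by apply: BO; exists p => //; rewrite vgeE // op.
- move=> y Ey y0; exists (ord w (vsproj E y)).
  have {1}-> : y = vsval (vsproj E y) by rewrite vsprojK.
  by apply: unitE; rewrite -vs0 vsprojK.
- exact: subfield_poly_root.
exists w', e; split=> // x x0; apply: we; first by rewrite vs0.
exact: unitE.
Qed.

(** The element [a] excludes a trivial restriction, which could not be normalised. *)
Lemma restrict_place (E : {subfield K}) (w : place_of K) (a : K) : a \in E ->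
  a != 0 -> ord w a != 0 ->
  exists (w' : place_of (subvs_of E)) (e : nat), (0 < e)%N /\
    forall x : subvs_of E, x != 0 -> ord w (vsval x) = e%:Z * ord w' x.
Proof.
move=> Ea a0 wa.
have vs0 (x : subvs_of E) : (vsval x == 0) = (x == 0).
  by rewrite -(inj_eq val_inj).
apply: (@normalised_place _ (fun x : subvs_of E => ord w (vsval x))).
- by move=> x y x0 y0; rewrite rmorphM ordM ?vs0.
- move=> x y x0 y0 xy0; rewrite -vgeE; last by rewrite vs0.
  by rewrite raddfD vgeD // vgeE ?vs0 // ge_min lexx ?orbT.
- by exists (vsproj E a); rewrite -?vs0 vsprojK.
Qed.

End SubfieldPlaces.

(** * The Carlitz module *)

Lemma card_finField_pnat (F : finFieldType) p : p \in [pchar F] -> p.-nat #|F|.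
Proof.
move=> pF; have /abelem_pgroup := fin_ring_pchar_abelem pF.
by rewrite /pgroup cardsT.
Qed.

Section Frobenius.
Variables (F : finFieldType) (R : comNzRingType) (f : {rmorphism F -> R}).
Notation q := #|F|.

Lemma finField_card_gt1 : (1 < q)%N.
Proof. exact: finNzRing_gt1. Qed.

Lemma finField_card_gt0 : (0 < q)%N.
Proof. exact: ltnW finField_card_gt1. Qed.

Lemma exprDcard (x y : R) : (x + y) ^+ q = x ^+ q + y ^+ q.
Proof.
have [p pr pF] := finPcharP F; have pR := rmorph_pchar f pF.
apply: exprDn_pchar; apply: sub_in_pnat (card_finField_pnat pF) => l _.
by move=> /eqP->.
Qed.

Lemma exprDcardX n (x y : R) : (x + y) ^+ (q ^ n) = x ^+ (q ^ n) + y ^+ (q ^ n).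
Proof.
elim: n x y => [|n IH] x y; first by rewrite !expr1.
by rewrite expnSr !exprM IH exprDcard.
Qed.

Lemma exprcard0 n : (0 : R) ^+ (q ^ n) = 0.
Proof. by rewrite expr0n expn_eq0 eqn0Ngt finField_card_gt0. Qed.

Lemma expr_card_sum n I (r : seq I) (P : pred I) (G : I -> R) :
  (\sum_(i <- r | P i) G i) ^+ (q ^ n) = \sum_(i <- r | P i) G i ^+ (q ^ n).
Proof. by apply: (big_morph _ (exprDcardX n)); exact: exprcard0. Qed.

Lemma rmorph_expr_card n (c : F) : f c ^+ (q ^ n) = f c.
Proof.
have cE : c ^+ (q ^ n) = c by elim: n => // n IH; rewrite expnS exprM expf_card.
by rewrite -rmorphXn cE.
Qed.

End Frobenius.

Section CarlitzOperator.
Variables (F : finFieldType) (R : comNzRingType) (f : {rmorphism {poly F} -> R}).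
Notation q := #|F|.
Let fC : {rmorphism F -> R} := (f \o polyC)%FUN.

(* [ctwist] is C_T and [cop a] is C_a, as operators on an F[T]-algebra. *)
Definition ctwist (z : R) : R := f 'X * z + z ^+ q.

Definition cop (a : {poly F}) (z : R) : R :=
  \sum_(j < size a) f (a`_j)%:P * iter j ctwist z.

Lemma cop_wide n (a : {poly F}) z : (size a <= n)%N ->
  cop a z = \sum_(j < n) f (a`_j)%:P * iter j ctwist z.
Proof.
move=> an; rewrite /cop (big_ord_widen n (fun j => f (a`_j)%:P * iter j ctwist z)) //.
rewrite big_mkcond /=; apply: eq_bigr => i _; case: ltnP => // ai.
by rewrite nth_default // rmorph0 mul0r.
Qed.

Lemma ctwistD x y : ctwist (x + y) = ctwist x + ctwist y.
Proof. by rewrite /ctwist (exprDcard fC) mulrDr addrACA. Qed.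

Lemma ctwist0 : ctwist 0 = 0.
Proof. by rewrite /ctwist mulr0 add0r; have := exprcard0 F R 1; rewrite expn1. Qed.

Lemma ctwistC c x : ctwist (f c%:P * x) = f c%:P * ctwist x.
Proof.
rewrite /ctwist exprMn; have := rmorph_expr_card fC 1 c; rewrite expn1 /= => ->.
by rewrite mulrDr mulrCA.
Qed.

Lemma iter_ctwistD j x y : iter j ctwist (x + y) = iter j ctwist x + iter j ctwist y.
Proof. by elim: j => //= j ->; rewrite ctwistD. Qed.

Lemma iter_ctwist0 j : iter j ctwist 0 = 0.
Proof. by elim: j => //= j ->; rewrite ctwist0. Qed.

Lemma ctwist_sum I (r : seq I) (P : pred I) (G : I -> R) :
  ctwist (\sum_(i <- r | P i) G i) = \sum_(i <- r | P i) ctwist (G i).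
Proof. exact: (big_morph _ ctwistD ctwist0). Qed.

Lemma copDl a b z : cop (a + b) z = cop a z + cop b z.
Proof.
pose n := maxn (size a) (size b).
rewrite !(@cop_wide n) ?leq_maxl ?leq_maxr ?size_polyD // -big_split /=.
by apply: eq_bigr => i _; rewrite coefD polyCD rmorphD mulrDl.
Qed.

Lemma copDr a x y : cop a (x + y) = cop a x + cop a y.
Proof.
rewrite /cop -big_split /=; apply: eq_bigr => i _.
by rewrite iter_ctwistD mulrDr.
Qed.

Lemma copr0 a : cop a 0 = 0.
Proof. by rewrite /cop big1 // => i _; rewrite iter_ctwist0 mulr0. Qed.

Lemma cop0 z : cop 0 z = 0.
Proof. by rewrite /cop size_poly0 big_ord0. Qed.

Lemma copN a z : cop (- a) z = - cop a z.
Proof. by apply/eqP; rewrite -addr_eq0 -copDl addNr cop0. Qed.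

Lemma copBl a b z : cop (a - b) z = cop a z - cop b z.
Proof. by rewrite copDl copN. Qed.

Lemma copC c z : cop c%:P z = f c%:P * z.
Proof. by rewrite (@cop_wide 1) ?size_polyC ?leq_b1 // big_ord1 coefC. Qed.

Lemma cop1 z : cop 1 z = z.
Proof. by rewrite copC rmorph1 mul1r. Qed.

Lemma cop_mulX_add a c z : cop (a * 'X + c%:P) z = cop a (ctwist z) + f c%:P * z.
Proof.
rewrite (@cop_wide (size a).+1); last first.
  rewrite (leq_trans (size_polyD _ _)) // geq_max (leq_trans (size_polyMleq _ _)).
    by rewrite size_polyC; case: (c == 0).
  by rewrite size_polyX addn2.
rewrite big_ord_recl coefD coefMX coefC eqxx add0r addrC; congr (_ + _).
by apply: eq_bigr => i _; rewrite coefD coefMX coefC /= addr0 -iterS iterSr.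
Qed.

Lemma cop_ctwist a z : cop a (ctwist z) = ctwist (cop a z).
Proof.
rewrite /cop ctwist_sum; apply: eq_bigr => i _.
by rewrite ctwistC -iterS iterSr.
Qed.

(** Horner induction on [a], using that C_b commutes with C_T and with constants. *)
Lemma copM a b z : cop (a * b) z = cop a (cop b z).
Proof.
elim/poly_ind: a b z => [|a c IH] b z; first by rewrite mul0r !cop0.
rewrite cop_mulX_add mulrDl copDl -mulrA IH; congr (cop a _ + _).
  by rewrite mulrC -[b * 'X]addr0 -polyC0 cop_mulX_add rmorph0 mul0r addr0 cop_ctwist.
rewrite mul_polyC (@cop_wide (size b)) ?size_scale_leq // mulr_sumr.
by apply: eq_bigr => i _; rewrite coefZ polyCM rmorphM mulrA.
Qed.

End CarlitzOperator.

Section CarlitzCoefficients.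
Variable F : finFieldType.
Notation q := #|F|.

(* [ctau j i] is the coefficient of x^(q^i) in the [j]-fold iterate of
   x |-> T x + x^q. *)
Fixpoint ctau (j i : nat) : {poly F} :=
  if j is j'.+1 then 'X * ctau j' i + (if i is i'.+1 then ctau j' i' ^+ q else 0)
  else (i == 0)%:R.

Lemma ctauS j i : ctau j.+1 i =
  'X * ctau j i + (if i is i'.+1 then ctau j i' ^+ q else 0).
Proof. by []. Qed.

Lemma ctau_big j i : (j < i)%N -> ctau j i = 0.
Proof.
elim: j i => [|j IH] [|i] //= ji; rewrite !IH //; last by lia.
by rewrite mulr0 add0r expr0n eqn0Ngt finField_card_gt0.
Qed.

Lemma ctau_diag j : ctau j j = 1.
Proof. by elim: j => //= j ->; rewrite ctau_big // mulr0 add0r expr1n. Qed.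

Lemma ctau0 j : ctau j 0 = 'X^j.
Proof. by elim: j => //= j ->; rewrite addr0 exprS. Qed.

(* The same recursion with the two factors of the iterate exchanged. *)
Lemma ctau_recr j i :
  ctau j.+1 i = 'X^(q ^ i) * ctau j i + (if i is i'.+1 then ctau j i' else 0).
Proof.
elim: j i => [|j IH] i.
  case: i => [|[|i]] /=; rewrite ?expr1 ?mulr0 ?add0r ?addr0 ?expr1n //.
  by rewrite expr0n eqn0Ngt finField_card_gt0.
case: i => [|i]; first by rewrite !ctau0 expn0 addr0 exprS.
have dq : (if i is i'.+1 then ctau j i' else 0) ^+ q =
    (if i is i'.+1 then ctau j i' ^+ q else 0).
  by case: (i) => // ; rewrite expr0n eqn0Ngt finField_card_gt0.
rewrite ctauS [in LHS]IH [in LHS]IH (exprDcard (@polyC F)) exprMn -exprM -expnSr dq.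
rewrite [ctau j.+1 i.+1]ctauS [ctau j.+1 i]ctauS.
by rewrite !mulrDr !addrA mulrCA; congr (_ + _); rewrite -!addrA; congr (_ + _); rewrite addrC.
Qed.

(* The coefficient of x^(q^i) in C_a. *)
Definition ccoef (a : {poly F}) (i : nat) : {poly F} :=
  \sum_(j < size a) a`_j *: ctau j i.

Lemma ccoef_size (a : {poly F}) i : (size a <= i)%N -> ccoef a i = 0.
Proof.
move=> ai; rewrite /ccoef big1 // => j _; rewrite ctau_big ?scaler0 //.
exact: leq_trans (ltn_ord j) ai.
Qed.

Lemma ccoef_lead (a : {poly F}) : ccoef a (size a).-1 = (lead_coef a)%:P.
Proof.
have [->|a0] := eqVneq a 0; first by rewrite /ccoef size_poly0 big_ord0 lead_coef0.
move: a0; rewrite -size_poly_eq0 /ccoef lead_coefE; case: (size a) => // m _.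
rewrite big_ord_recr /= ctau_diag alg_polyC big1 ?add0r // => i _.
by rewrite ctau_big // scaler0.
Qed.

Lemma ccoef0 a : ccoef a 0 = a.
Proof.
rewrite -[RHS]coefK poly_def /ccoef; apply: eq_bigr => i _.
by rewrite ctau0.
Qed.

(* C_a commutes with C_T. *)
Lemma ccoef_rec a i :
  ccoef a i.+1 * ('X^(q ^ i.+1) - 'X) = ccoef a i ^+ q - ccoef a i.
Proof.
suff E : 'X * ccoef a i.+1 + ccoef a i ^+ q = 'X^(q ^ i.+1) * ccoef a i.+1 + ccoef a i.
  rewrite mulrBr [_ * 'X^_]mulrC [_ * 'X]mulrC.
  have -> : 'X^(q ^ i.+1) * ccoef a i.+1 = 'X * ccoef a i.+1 + ccoef a i ^+ q - ccoef a i.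
    by rewrite E addrK.
  by move: ('X * ccoef a i.+1) (ccoef a i ^+ q) (ccoef a i) => u v w; ring.
rewrite /ccoef; have := expr_card_sum (@polyC F) 1; rewrite expn1 => ->.
rewrite !mulr_sumr -!big_split /=; apply: eq_bigr => j _.
rewrite exprZn -/(_ ^+ q) expf_card -!scalerAr -!scalerDr.
by congr (_ *: _); have := ctau_recr j i.+1.
Qed.

Lemma iter_carlitz_coef j :
  iter j (fun g : {poly {poly F}} => 'X *: g + g ^+ q) 'X =
  \sum_(i < j.+1) ctau j i *: 'X^(q ^ i).
Proof.
elim: j => [|j IH]; first by rewrite big_ord1 /= scale1r expr1.
rewrite iterS IH.
have := expr_card_sum (polyC \o polyC : {rmorphism F -> {poly {poly F}}}) 1; rewrite expn1 => ->.
rewrite scaler_sumr [in RHS]big_ord_recl /= addr0.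
rewrite [X in X + _]big_ord_recl /= scalerA.
under [X in _ = _ + X]eq_bigr do rewrite /bump /= add1n scalerDl.
rewrite big_split /= addrA; congr (_ + _ + _).
  rewrite [RHS]big_ord_recr /= ctau_big // mulr0 scale0r addr0.
  by apply: eq_bigr => i _; rewrite scalerA /bump /= add1n.
by apply: eq_bigr => i _; rewrite exprZn -exprM -expnSr.
Qed.

Lemma carlitzE (a : {poly F}) :
  carlitz a = \sum_(i < size a) ccoef a i *: 'X^(q ^ i).
Proof.
rewrite /carlitz.
under eq_bigr do rewrite iter_carlitz_coef.
have E (j : 'I_(size a)) : \sum_(i < j.+1) ctau j i *: 'X^(q ^ i) =
    \sum_(i < size a) ctau j i *: 'X^(q ^ i) :> {poly {poly F}}.
  rewrite (big_ord_widen (size a) (fun i => ctau j i *: 'X^(q ^ i))) //.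
  rewrite big_mkcond; apply: eq_bigr => i _; case: ltnP => // ij.
  by rewrite ctau_big // scale0r.
under eq_bigr do rewrite E scaler_sumr.
rewrite exchange_big; apply: eq_bigr => i _ /=.
by rewrite /ccoef scaler_suml; apply: eq_bigr => j _; rewrite scalerA mul_polyC.
Qed.

End CarlitzCoefficients.

(** * Places of F(T) *)

Lemma fracE (R : idomainType) (c : {fraction R}) :
  exists f g : R, g != 0 /\ c = tofrac f / tofrac g.
Proof.
elim/quotW: c => x; exists x.1, x.2; split; first exact: denom_ratioP.
have d0 : tofrac x.2 != 0 by rewrite tofrac_eq0 denom_ratioP.
apply: (mulIf d0); rewrite divfK //.
rewrite /tofrac; unlock FracField.tofrac; rewrite -[LHS]FracField.pi_mul.
apply/eqmodP; rewrite /= FracField.equivfE /FracField.mulf.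
have dx : \d_x != 0 by exact: denom_ratioP.
have n1 : (1 : R) != 0 := oner_neq0 R.
rewrite !numden_Ratio ?n1 ?mulf_neq0 ?mulr1 //.
by rewrite mulrC.
Qed.

Section FinitePlaces.
Variables (F : finFieldType) (Q : {poly F}) (HQ : monic_irreducible_poly Q).
Notation q := #|F|.
Notation A_Q := {poly %/ Q with HQ}.
Notation dQ := (size Q).-1.

Lemma monic_irreducible_monic : Q \is monic.
Proof. by case: HQ. Qed.

Lemma monic_irreducible_neq0 : Q != 0.
Proof. exact/monic_neq0/monic_irreducible_monic. Qed.

Lemma monic_irreducible_size : (1 < size Q)%N.
Proof. by case: HQ => -[]. Qed.

Lemma coprimep_irreducible f : coprimep Q f = ~~ (Q %| f).
Proof. by apply: irreducible_poly_coprime; case: HQ. Qed.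

Lemma dvdp_irreducibleM f g : (Q %| f * g) = (Q %| f) || (Q %| g).
Proof.
apply/idP/orP => [Qfg|[Qf|Qg]]; [|exact: dvdp_mulr|exact: dvdp_mull].
have [Qf|] := boolP (Q %| f); first by left.
by rewrite -coprimep_irreducible => /Gauss_dvdpr <-; right.
Qed.

Definition residue_class (f : {poly F}) : A_Q := in_qpoly Q f.
Notation red := residue_class.

Fact residue_class_zmod : zmod_morphism red. Proof. exact: raddfB. Qed.
Fact residue_class_monoid : monoid_morphism red.
Proof. exact: in_qpoly_monoid_morphism. Qed.
HB.instance Definition _ :=
  GRing.isZmodMorphism.Build {poly F} A_Q red residue_class_zmod.
HB.instance Definition _ :=
  GRing.isMonoidMorphism.Build {poly F} A_Q red residue_class_monoid.

Lemma residue_class_eq0 (f : {poly F}) : (red f == 0) = (Q %| f).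
Proof.
rewrite /red -(inj_eq val_inj) /= mk_monicE //.
by rewrite -Pdiv.IdomainMonic.modpE ?monic_irreducible_monic.
Qed.

Lemma residue_classK (x : A_Q) : red (val x) = x.
Proof.
by apply: val_inj; exact: (in_qpoly_small (size_mk_monic x)).
Qed.

Lemma size_val_qpoly (x : A_Q) : (size (val x) <= dQ)%N.
Proof.
rewrite -ltnS prednK ?size_poly_gt0 ?monic_irreducible_neq0 //.
by have := size_mk_monic x; rewrite [in X in (_ < X)%N -> _](mk_monicE HQ).
Qed.

(** Otherwise the class of ['X], and with it all of A/Q, would be fixed by the q^i-power map; then
    ['X^(q ^ i) - 'X] would have q^dQ roots, more than its degree. *)
Lemma dvdp_irreducible_XqX i : (0 < i < dQ)%N -> ~~ (Q %| 'X^(q ^ i) - 'X).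
Proof.
move=> /andP[i0 idQ]; apply/negP; rewrite -residue_class_eq0 rmorphB rmorphXn subr_eq0 => /eqP xE.
pose iC : {rmorphism F -> A_Q} := (red \o polyC)%FUN.
have allE (y : A_Q) : y ^+ (q ^ i) = y.
  rewrite -(residue_classK y) -[val y]coefK poly_def rmorph_sum /=.
  rewrite (expr_card_sum iC); apply: eq_bigr => j _.
  rewrite -mul_polyC rmorphM rmorphXn exprMn -exprM mulnC exprM xE.
  by have := rmorph_expr_card iC i (val y)`_j => /= ->.
have qi : (1 < q ^ i)%N by have : (q ^ 0 < q ^ i)%N by rewrite ltn_exp2l ?finField_card_gt1.
have sp : size ('X^(q ^ i) - 'X : {poly A_Q}) = (q ^ i).+1.
  by rewrite size_polyDl size_polyXn // size_polyN size_polyX.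
have p0 : 'X^(q ^ i) - 'X != 0 :> {poly A_Q} by rewrite -size_poly_gt0 sp.
have allr : all (root ('X^(q ^ i) - 'X)) (enum A_Q).
  by apply/allP => y _; rewrite /root !hornerE allE subrr.
have := max_poly_roots p0 allr (enum_uniq _).
by rewrite -cardE card_qfpoly sp ltnS leq_exp2l ?finField_card_gt1 // leqNgt idQ.
Qed.

(** By induction along [ccoef_rec]: Q divides the right-hand side of the recursion, but not the
    factor T^(q^(i+1)) - T. Thus C_Q reduces to x^(q^dQ) modulo Q. *)
Lemma dvdp_ccoef i : (i < dQ)%N -> Q %| ccoef Q i.
Proof.
elim: i => [|i IH] idQ; first by rewrite ccoef0.
have := ccoef_rec Q i; move=> E.
have : Q %| ccoef Q i.+1 * ('X^(q ^ i.+1) - 'X).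
  have Qi := IH (ltnW idQ); rewrite E dvdp_sub // -(prednK (finField_card_gt0 F)) exprS.
  exact: dvdp_mulr.
by rewrite dvdp_irreducibleM => /orP[//|]; rewrite (negPf (dvdp_irreducible_XqX _)).
Qed.

Lemma ccoef_irreducible_lead : ccoef Q dQ = 1.
Proof. by rewrite ccoef_lead (eqP monic_irreducible_monic). Qed.

Definition poly_red : {rmorphism {poly {poly F}} -> {poly A_Q}} :=
  map_poly red.

Lemma poly_red_eq0 (g : {poly {poly F}}) : poly_red g = 0 -> exists h, g = Q *: h.
Proof.
move=> g0; exists (\poly_(i < size g) (g`_i %/ Q)); apply/polyP => i.
rewrite coefZ coef_poly; case: ltnP => ig; last by rewrite mulr0 nth_default.
rewrite mulrC divpK // -residue_class_eq0.
by have /polyP/(_ i) := g0; rewrite coef_map coef0 => ->.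
Qed.

Lemma poly_red_carlitz : poly_red (carlitz Q) = 'X^(q ^ dQ).
Proof.
rewrite carlitzE rmorph_sum /=.
have := prednK (_ : 0 < size Q)%N; rewrite size_poly_gt0 monic_irreducible_neq0 => /(_ isT) sQ.
rewrite -(big_mkord xpredT (fun i => map_poly red (ccoef Q i *: 'X^(q ^ i)))).
rewrite -sQ big_nat_recr //= ccoef_irreducible_lead scale1r map_polyXn.
rewrite big_nat_cond big1 ?add0r // => i /andP[/andP[_ idQ] _].
rewrite map_polyZ /=; have /eqP -> : red (ccoef Q i) == 0.
  by rewrite residue_class_eq0 dvdp_ccoef.
by rewrite scale0r.
Qed.

(** Modulo Q, C_Q becomes the power x^(q^dQ), and this power map fixes the coefficients in A/Q.
    Evaluated at a torsion point, the identity makes sigma_Q a Frobenius at Q. *)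
Lemma carlitz_frobenius (f : {poly {poly F}}) :
  exists h, f ^+ (q ^ dQ) = f \Po carlitz Q + Q *: h.
Proof.
have [|h hE] := @poly_red_eq0 (f ^+ (q ^ dQ) - (f \Po carlitz Q)).
  rewrite rmorphB rmorphXn /= map_comp_poly -/(poly_red _) poly_red_carlitz.
  set g := map_poly _ f.
  pose iC : {rmorphism F -> {poly A_Q}} := (polyC \o red \o polyC)%FUN.
  rewrite comp_polyE -[g in X in X - _]coefK poly_def (expr_card_sum iC).
  apply/eqP; rewrite subr_eq0; apply/eqP; apply: eq_bigr => i _.
  rewrite exprZn -(card_qfpoly HQ) expf_card -!exprM mulnC //.
by exists h; rewrite -hE addrC subrK.
Qed.

Lemma decompose_poly (f : {poly F}) : f != 0 ->
  exists n g, f = Q ^+ n * g /\ ~~ (Q %| g).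
Proof.
have [m] := ubnP (size f); elim: m f => // m IH f fm f0.
have [Qf|Qf] := boolP (Q %| f); last by exists 0%N, f; rewrite expr0 mul1r.
have fE := divpK Qf; have g0 : f %/ Q != 0 by apply: contraNneq f0 => g0; rewrite -fE g0 mul0r.
have [|n [g [gE Qg]]] := IH (f %/ Q) _ g0.
  rewrite size_divp ?monic_irreducible_neq0 //; have := monic_irreducible_size.
  move: f0 fm; rewrite -size_poly_gt0; move: (size f) (size Q) => a b.
  by lia.
by exists n.+1, g; rewrite -fE gE exprSr mulrAC.
Qed.

Lemma place_val_fin n (g : {poly F}) : ~~ (Q %| g) ->
  place_val (Fin Q) (Q ^+ n * g) = n%:Z.
Proof.
move=> Qg; rewrite /place_val; congr (_%:Z).
have g0 : g != 0 by apply: contraNneq Qg => ->; rewrite dvdp0.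
have Q0 := monic_irreducible_neq0.
apply/eqP; rewrite eqn_leq; apply/andP; split.
  apply/bigmax_leqP => i Qi; rewrite leqNgt; apply: contra Qg => ni.
  move: Qi; rewrite -(subnKC ni) addSnnS exprD dvdp_mul2l ?expf_neq0 //.
  by rewrite exprS; exact: dvdp_trans (dvdp_mulr _ (dvdpp _)).
(* [place_val] takes its maximum over exponents below the size only; the multiplicity lies in that
   range. *)
have ns : (n < size (Q ^+ n * g)%R)%N.
  rewrite size_mul ?expf_neq0 //.
  have : (n < size (Q ^+ n)%R)%N.
    have := size_exp Q n; have := monic_irreducible_size.
    have : (0 < size (Q ^+ n)%R)%N by rewrite size_poly_gt0 expf_neq0.
    case: (size Q) => [|[|m]] //= h _; rewrite mulSn; move: h.
    by case: (size _) => //= k _ ->; rewrite ltnS leq_addr.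
  have sg : (0 < size g)%N by rewrite size_poly_gt0.
  rewrite -(prednK sg) addnS /= => nQ; exact: leq_trans nQ (leq_addr _ _).
apply: (@leq_bigmax_cond _ (fun i : 'I_ _ => Q ^+ i %| Q ^+ n * g) (fun i => i : nat) (Ordinal ns)).
exact: dvdp_mulr.
Qed.

End FinitePlaces.

Section PlacesAbove.
Variables (F : finFieldType) (K : fieldExtType {fraction {poly F}}).
Notation q := #|F|.

Definition iota_K : {rmorphism {poly F} -> K} := (in_alg K \o @tofrac {poly F})%FUN.
Notation i_ := iota_K.

Lemma iota_eq0 (f : {poly F}) : (i_ f == 0) = (f == 0).
Proof. by rewrite /= scaler_eq0 oner_eq0 orbF tofrac_eq0. Qed.

Lemma iota_frac (y : K) : y \in 1%VS ->
  exists f g : {poly F}, g != 0 /\ y = i_ f / i_ g.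
Proof.
move=> /vlineP[c ->]; have [f [g [g0 ->]]] := fracE c; exists f, g; split=> //.
exact: (fmorph_div (in_alg K)).
Qed.

Lemma iota_in1 f : i_ f \in 1%VS.
Proof. by rewrite /= rpredZ // mem1v. Qed.

Lemma lies_above_ord (w : place_of K) v e : lies_above w v e ->
  (0 < e)%N /\ forall f : {poly F}, f != 0 -> ord w (i_ f) = e%:Z * place_val v f.
Proof. by case=> e0 we; split=> // f f0; rewrite /ord [in LHS]/= we. Qed.

Lemma ord_lies_above (w : place_of K) v (e : nat) : (0 < e)%N ->
  (forall f : {poly F}, f != 0 -> ord w (i_ f) = e%:Z * place_val v f) ->
  lies_above w v e.
Proof.
move=> e0 we; split=> // f f0; have := ordE w (_ : i_ f != 0).
by rewrite iota_eq0 => /(_ f0); rewrite we.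
Qed.

Lemma valring_lies_above (O : K -> Prop) (pi : K) (v : place F) : is_valring O ->
  O pi -> pi != 0 -> ~ O pi^-1 ->
  (forall f : {poly F}, f != 0 -> ring_unit O (i_ f / pi ^ place_val v f)) ->
  exists (w : place_of K) (e : nat), lies_above w v e.
Proof.
move=> HO Opi pi0 piV unitO.
have [||w [e [e0 we]]] := @valring_place _ O HO (fun x => x \in 1%VS) pi (\dim {:K}) Opi pi0 piV.
- move=> y /iota_frac[f [g [g0 ->]]] y0.
  have f0 : f != 0 by apply: contraNneq y0 => ->; rewrite rmorph0 mul0r.
  exists (place_val v f - place_val v g).
  have := ring_unit_div HO (unitO _ f0) (unitO _ g0); congr ring_unit.
  by rewrite expfzDr // -invr_expz; field; rewrite iota_eq0 g0 !expfz_neq0.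
- exact: (@subfield_poly_root _ _ 1%AS).
exists w, e; apply: ord_lies_above => // f f0; apply: we; first by rewrite iota_eq0.
exact: unitO.
Qed.

(** If x / pi were in [O], the relation divided by [pi] would put [pi^-1] there. Hence pi / x is in
    [O], and the relation divided by [x] gives [x^-1]. *)
Lemma valring_coprime_inv (O : K -> Prop) (pi x u v : K) : is_valring O ->
  pi != 0 -> ~ O pi^-1 -> O x -> O u -> O v -> x != 0 ->
  (exists2 c, O c & c * (u * x + v * pi) = 1) -> O x^-1.
Proof.
move=> HO pi0 piV Ox Ou Ov x0 [c Oc cE]; have [HS tot] := HO.
have [Oq|Oq] : O (x / pi) \/ O (pi / x).
  by have := tot (x / pi); rewrite invf_div; apply; rewrite mulf_neq0 ?invr_eq0.
- exfalso; apply: piV; have -> : pi^-1 = c * (u * (x / pi) + v).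
    by rewrite -[LHS]mul1r -cE; field.
  by apply: (subringM HS) => //; apply: (subringD HS) => //; exact: (subringM HS).
- have -> : x^-1 = c * (u + v * (pi / x)).
    by rewrite -[LHS]mul1r -cE; field.
  by apply: (subringM HS) => //; apply: (subringD HS) => //; exact: (subringM HS).
Qed.

(** Keeps the quantifiers over places in [unramified] and [is_frobenius] from being vacuous.
    Polynomials prime to Q are units of the valuation ring by a Bezout relation. *)
Lemma exists_place_fin (Q : {poly F}) : monic_irreducible_poly Q ->
  exists (w : place_of K) (e : nat), lies_above w (Fin Q) e.
Proof.
move=> HQ; have Q0 := monic_irreducible_neq0 HQ.
pose B (x : K) := exists f, x = i_ f.
have HB : is_subring B.
  split; first by exists 1; rewrite rmorph1.
    by move=> _ _ [f ->] [g ->]; exists (f - g); rewrite rmorphB.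
  by move=> _ _ [f ->] [g ->]; exists (f * g); rewrite rmorphM.
have pi0 : i_ Q != 0 by rewrite iota_eq0.
have BQ : B (i_ Q) by exists Q.
have [[f fE]|O [HO BO piV]] := chevalley HB BQ pi0.
  have : i_ (f * Q) == i_ 1 by rewrite rmorphM -fE mulVf // rmorph1.
  rewrite -subr_eq0 -rmorphB iota_eq0 subr_eq0 => /eqP fQ.
  have : Q %| 1 by apply/dvdpP; exists f.
  by rewrite dvdp1; have := monic_irreducible_size HQ; case: (size Q) => [|[]].
have BO' f : O (i_ f) by apply: BO; exists f.
apply: (@valring_lies_above O (i_ Q)) => // f f0.
have [n [g [-> Qg]]] := decompose_poly HQ f0.
rewrite (place_val_fin HQ) // rmorphM rmorphXn -exprnP mulrAC divff ?expf_neq0 // mul1r.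
have g0 : g != 0 by apply: contraNneq Qg => ->; rewrite dvdp0.
split; rewrite ?iota_eq0 //.
have : coprimep g Q by rewrite coprimep_sym coprimep_irreducible.
move=> /Bezout_eq1_coprimepP[[u v] /= uvE].
apply: (@valring_coprime_inv O (i_ Q) _ (i_ u) (i_ v)); rewrite ?iota_eq0 //; try exact: BO'.
exists 1; first by apply: subring1; case: HO.
by rewrite mul1r -!rmorphM -rmorphD uvE rmorph1.
Qed.

(** Chevalley's theorem for the ring F[1/T] and its prime 1/T. *)
Lemma exists_place_infty : exists (w : place_of K) (e : nat), lies_above w (Infty F) e.
Proof.
pose T : K := i_ 'X; pose fC : {rmorphism F -> K} := (i_ \o polyC)%FUN.
have T0 : T != 0 by rewrite iota_eq0 polyX_eq0.
pose B (x : K) := exists f : {poly F}, x = (map_poly fC f).[T^-1].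
have HB : is_subring B.
  split; first by exists 1; rewrite rmorph1 hornerC.
    by move=> _ _ [f ->] [g ->]; exists (f - g); rewrite rmorphB !hornerE.
  by move=> _ _ [f ->] [g ->]; exists (f * g); rewrite rmorphM hornerM.
have pi0 : T^-1 != 0 by rewrite invr_eq0.
have evT (f : {poly F}) n : (size f <= n.+1)%N ->
    T ^+ n * (map_poly fC f).[T^-1] = i_ (\sum_(i < n.+1) f`_i *: 'X^(n - i)).
  move=> sf; rewrite (horner_coef_wide _ (leq_trans (size_poly _ _) sf)).
  rewrite mulr_sumr rmorph_sum; apply: eq_bigr => i _; rewrite coef_map.
  rewrite -mul_polyC rmorphM rmorphXn mulrCA; congr (_ * _).
  by rewrite exprVn expfB_cond // ?(negPf T0) // add0n -ltnS.
have BT : B T^-1 by exists 'X; rewrite map_polyX hornerX.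
have [[f fE]|O [HO BO piV]] := chevalley HB BT pi0.
  have := evT f (size f) (leqnSn _); rewrite -fE invrK -exprSr -rmorphXn.
  move=> /eqP; rewrite -subr_eq0 -rmorphB iota_eq0 subr_eq0 => /eqP E.
  have : (size ('X^((size f).+1) : {poly F}) <= (size f).+1)%N.
    rewrite E (leq_trans (size_sum _ _ _)) //; apply/bigmax_leqP => i _.
    by rewrite (leq_trans (size_scale_leq _ _)) // size_polyXn ltnS leq_subr.
  by rewrite size_polyXn ltnn.
rewrite invrK in piV.
have OT : O T^-1 by apply: BO; exists 'X; rewrite map_polyX hornerX.
have OC c : O (fC c) by apply: BO; exists c%:P; rewrite map_polyC hornerC.
apply: (@valring_lies_above O T^-1) => //; first by rewrite invrK.
move=> f f0; rewrite /place_val /poly_deg exprz_inv opprK -exprnP; set m := (size f).-1.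
have sf : size f = m.+1 by rewrite prednK // size_poly_gt0.
(* The reversed polynomial: f(T) = T^m g(1/T). Its constant term is [lead_coef f], so g(1/T) is a
   unit at infinity. *)
pose g := \poly_(i < m.+1) f`_(m - i).
have gE : i_ f = T ^+ m * (map_poly fC g).[T^-1].
  rewrite evT ?size_poly //; congr (i_ _); rewrite -[LHS]coefK poly_def sf.
  rewrite (reindex_inj rev_ord_inj) /=; apply: eq_bigr => i _.
  by rewrite coef_poly ltn_ord subSS.
rewrite gE mulrAC divff ?expf_neq0 // mul1r.
have g0 : (map_poly fC g).[T^-1] != 0.
  by apply: contraNneq f0 => g0; rewrite -iota_eq0 gE g0 mulr0.
have Og (h : {poly F}) : O (map_poly fC h).[T^-1] by apply: BO; exists h.
split=> //.
pose h := \poly_(i < m) g`_i.+1.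
have ghE : (map_poly fC g).[T^-1] = fC (lead_coef f) + (map_poly fC h).[T^-1] * T^-1.
  have -> : g = h * 'X + (lead_coef f)%:P.
    apply/polyP => i; rewrite coefD coefMX coefC; case: i => [|i] /=.
      by rewrite add0r coef_poly subn0 lead_coefE.
    by rewrite addr0 [in RHS]coef_poly; case: ltnP => // mi; rewrite coef_poly ltnS ltnNge mi.
  by rewrite rmorphD rmorphM /= map_polyX map_polyC !hornerE addrC.
have l0 : fC (lead_coef f) != 0 by rewrite fmorph_eq0 lead_coef_eq0.
apply: (@valring_coprime_inv O T^-1 _ 1 (- (map_poly fC h).[T^-1])) => //.
- by rewrite invrK.
- by apply: subring1; case: HO.
- by apply: subringN; [case: HO | exact: Og].
exists (fC (lead_coef f)^-1); first exact: OC.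
by rewrite ghE mul1r mulNr addrK fmorphV mulVf.
Qed.

Section AboveFin.
Variables (Q : {poly F}) (HQ : monic_irreducible_poly Q) (w : place_of K) (e : nat).
Hypothesis wQ : lies_above w (Fin Q) e.

Lemma above_fin_prime : ord w (i_ Q) = e%:Z.
Proof.
have [e0 we] := lies_above_ord wQ; have Q0 := monic_irreducible_neq0 HQ.
have Q1 : ~~ (Q %| 1).
  by rewrite dvdp1; have := monic_irreducible_size HQ; case: (size Q) => [|[]].
rewrite we //; have := place_val_fin HQ 1 Q1; rewrite mulr1 expr1 => ->.
by rewrite mulr1.
Qed.

Lemma above_fin_ge0 f : vge w 0 (i_ f).
Proof.
have [->|f0] := eqVneq f 0; first by rewrite rmorph0 vge0.
have [e0 we] := lies_above_ord wQ.
by rewrite vgeE ?iota_eq0 // we.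
Qed.

Lemma above_fin_dvd f : f != 0 -> exists m : int, ord w (i_ f) = e%:Z * m.
Proof. by move=> f0; have [e0 we] := lies_above_ord wQ; exists (place_val (Fin Q) f); rewrite we. Qed.

End AboveFin.

Section AboveInfty.
Variables (w : place_of K) (e : nat).
Hypothesis wI : lies_above w (Infty F) e.

Lemma above_infty_X : ord w (i_ 'X) = - e%:Z.
Proof.
have [e0 we] := lies_above_ord wI.
by rewrite we ?polyX_eq0 // /place_val /poly_deg size_polyX mulrN mulr1.
Qed.

Lemma above_infty_const c : c != 0 -> ord w (i_ c%:P) = 0.
Proof.
move=> c0; have [e0 we] := lies_above_ord wI.
by rewrite we ?polyC_eq0 // /place_val /poly_deg size_polyC c0 mulrN mulr0.
Qed.

Lemma above_infty_const_ge0 c : vge w 0 (i_ c%:P).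
Proof.
have [->|c0] := eqVneq c 0; first by rewrite rmorph0 vge0.
by rewrite vgeE ?iota_eq0 ?polyC_eq0 // above_infty_const.
Qed.

(** The residue field of k at infinity is F. *)
Lemma above_infty_residue y : y \in 1%VS -> vge w 0 y ->
  exists c : F, vge w 1 (y - i_ c%:P).
Proof.
have [e0 we] := lies_above_ord wI.
move=> /iota_frac[f [g [g0 ->]]]; have [->|f0] := eqVneq f 0.
  by exists 0; rewrite !rmorph0 mul0r subr0 vge0.
have if0 : i_ f != 0 by rewrite iota_eq0.
have ig0 : i_ g != 0 by rewrite iota_eq0.
rewrite vgeE ?mulf_neq0 ?invr_eq0 // ordM ?invr_eq0 // ordV // !we //= /poly_deg.
rewrite -mulrBr pmulr_rge0 ?ltz_nat // opprK addrC subr_ge0 lez_nat => fg.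
(* The value of f/g at infinity; it is 0 when f has the smaller degree. *)
pose c := f`_(size g).-1 / lead_coef g; exists c.
have -> : i_ f / i_ g - i_ c%:P = i_ (f - c *: g) / i_ g.
  have cg (b : F) : i_ (b *: g) = i_ b%:P * i_ g by rewrite -mul_polyC rmorphM.
  by rewrite rmorphB cg mulrBl mulfK.
have [->|h0] := eqVneq (f - c *: g) 0; first by rewrite rmorph0 mul0r vge0.
have sh : (size (f - c *: g)%R <= (size g).-1)%N.
  apply/leq_sizeP => j gj; rewrite coefB coefZ.
  move: gj; rewrite leq_eqVlt => /predU1P[<-|gj].
    by rewrite divfK ?subrr // lead_coef_eq0.
  rewrite !nth_default ?mulr0 ?subrr //.
    by rewrite -(prednK (_ : 0 < size g)%N) // size_poly_gt0.
  by rewrite (leq_trans _ (leq_ltn_trans fg gj)) // leqSpred.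
have : (0 < size (f - c *: g)%R)%N by rewrite size_poly_gt0.
rewrite vgeE ?mulf_neq0 ?invr_eq0 ?iota_eq0 // ordM ?invr_eq0 ?iota_eq0 // ordV // !we //= /poly_deg.
move: sh; move: (size (f - _)%R) (size g).-1 => a b ab a0.
by rewrite -mulrBr; apply: (@le_trans _ _ (e%:Z * 1)); [lia | rewrite ler_pM2l ?ltz_nat //; lia].
Qed.

End AboveInfty.

End PlacesAbove.

Arguments iota_K : simpl never.

(** * The cyclotomic function field *)

Section CarlitzOver.
Variables (F : finFieldType) (K : fieldExtType {fraction {poly F}}).
Notation q := #|F|.
Notation i_ := (iota_K K).

Lemma carlitz_overE (a : {poly F}) :
  carlitz_over K a = \sum_(i < size a) i_ (ccoef a i) *: 'X^(q ^ i).
Proof.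
rewrite /carlitz_over carlitzE -/(iota_K K) rmorph_sum; apply: eq_bigr => i _.
by rewrite /= map_polyZ map_polyXn.
Qed.

Lemma horner_carlitz_over (a : {poly F}) z : (carlitz_over K a).[z] = cop i_ a z.
Proof.
rewrite /carlitz_over /carlitz -/(iota_K K) rmorph_sum horner_sum; apply: eq_bigr => j _.
rewrite /= map_polyZ hornerZ; congr (_ * _).
elim: (j : nat) => [|n IH]; first by rewrite /= map_polyX hornerX.
rewrite !iterS /ctwist -IH rmorphD rmorphXn hornerD horner_exp /=.
by rewrite map_polyZ hornerZ.
Qed.

Lemma cop_coef (a : {poly F}) z :
  cop i_ a z = \sum_(i < size a) i_ (ccoef a i) * z ^+ (q ^ i).
Proof.
rewrite -horner_carlitz_over carlitz_overE horner_sum; apply: eq_bigr => i _.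
by rewrite hornerZ hornerXn.
Qed.

Lemma cop_rmorph (s : {rmorphism K -> K}) a z : (forall f, s (i_ f) = i_ f) ->
  s (cop i_ a z) = cop i_ a (s z).
Proof.
move=> sF; rewrite !cop_coef rmorph_sum; apply: eq_bigr => i _.
by rewrite rmorphM rmorphXn sF.
Qed.

Lemma cop_mem (E : {subfield K}) a z : z \in E -> cop i_ a z \in E.
Proof.
move=> Ez; rewrite cop_coef rpred_sum // => i _; rewrite rpredM ?rpredX //.
exact: (subvP (sub1v E)) (iota_in1 K _).
Qed.

Lemma vge_cop (w : place_of K) a n z : (forall f, vge w 0 (i_ f)) -> 0 <= n ->
  vge w n z -> vge w n (cop i_ a z).
Proof.
move=> wA n0 wz; rewrite cop_coef; apply: vge_sum => i _.
rewrite -[n]add0r vgeM //; have := vgeX (q ^ i) wz; apply: vgeW.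
have : (0 < q ^ i)%N by rewrite expn_gt0 finField_card_gt0.
by case: (q ^ i)%N => // m _; rewrite mulrS lerDl mulrn_wge0.
Qed.

End CarlitzOver.

Section Torsion.
Variables (F : finFieldType) (P : {poly F}) (HP : monic_irreducible_poly P).
Variable (K : splittingFieldType {fraction {poly F}}).
Hypothesis Ksplit : splittingFieldFor 1 (carlitz_over K P) {:K}.
Notation q := #|F|.
Notation i_ := (iota_K K).
Notation d := (size P).-1.
Notation A_P := {poly %/ P with HP}.
Notation C := (cop (iota_K K)).
Notation torsion z := (C P z = 0).

Lemma sizeP : size P = d.+1.
Proof. by rewrite prednK // size_poly_gt0 monic_irreducible_neq0. Qed.

Lemma torsionP z : root (carlitz_over K P) z <-> torsion z.
Proof. by rewrite /root horner_carlitz_over; split=> [/eqP|->]. Qed.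

Lemma carlitz_over_split :
  carlitz_over K P = 'X^(q ^ d) + \sum_(i < d) i_ (ccoef P i) *: 'X^(q ^ i).
Proof.
rewrite carlitz_overE -(big_mkord xpredT (fun i => i_ (ccoef P i) *: 'X^(q ^ i))).
rewrite sizeP big_nat_recr // (ccoef_irreducible_lead HP) rmorph1 scale1r /=.
by rewrite addrC big_mkord.
Qed.

Lemma size_carlitz_tail :
  (size (\sum_(i < d) i_ (ccoef P i) *: 'X^(q ^ i))%R <= q ^ d)%N.
Proof.
rewrite (leq_trans (size_sum _ _ _)) //; apply/bigmax_leqP => i _.
by rewrite (leq_trans (size_scale_leq _ _)) // size_polyXn ltn_exp2l ?finField_card_gt1.
Qed.

Lemma size_carlitz_over : size (carlitz_over K P) = (q ^ d).+1.
Proof.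
by rewrite carlitz_over_split size_polyDl size_polyXn // ltnS size_carlitz_tail.
Qed.

Lemma monic_carlitz_over : carlitz_over K P \is monic.
Proof.
rewrite carlitz_over_split monicE lead_coefDl ?lead_coefXn //.
by rewrite size_polyXn ltnS size_carlitz_tail.
Qed.

Lemma iota_card : (q%:R : K) = 0.
Proof.
have [p pr pF] := finPcharP F.
have pK : p \in [pchar K] := rmorph_pchar (i_ \o polyC)%FUN pF.
have pq : (p %| q)%N.
  have := card_finField_pnat pF => /p_natP[n qE].
  rewrite qE; case: n qE => [|n] qE; last by rewrite expnS dvdn_mulr.
  by have := finField_card_gt1 F; rewrite qE.
by apply/eqP; rewrite -(dvdn_pcharf pK).
Qed.

(** Every exponent q^i with i > 0 is 0 in K, so only the linear coefficient P survives. This gives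
    separability, and P as a product of torsion points. *)
Lemma deriv_carlitz_over : (carlitz_over K P)^`() = (i_ P)%:P.
Proof.
rewrite carlitz_overE linear_sum /=.
have := sizeP; case: (size P) (ccoef_size (a := P)) => // n _ _.
rewrite big_ord_recl /= derivZ derivXn expn0 ccoef0 -mulr_natr mulr1 big1 ?addr0.
  by rewrite expr0 alg_polyC.
move=> j _; rewrite derivZ derivXn /bump /= add1n expnS -mulr_natr natrM.
by rewrite -[q%:R]polyC_natr iota_card mul0r mulr0 scaler0.
Qed.

Lemma separable_carlitz_over : separable_poly (carlitz_over K P).
Proof.
rewrite unlock deriv_carlitz_over; apply/coprimepP => g _.
rewrite -[(i_ P)%:P]alg_polyC => /dvdp_trans; move/(_ 1).
rewrite alg_polyC; have iP0 : i_ P != 0 by rewrite iota_eq0 monic_irreducible_neq0.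
rewrite -size_poly_eq1 => h; have : g %| 1.
  by apply: h; apply/dvdpP; exists (i_ P)^-1%:P; rewrite -polyCM mulVf.
by rewrite dvdp1.
Qed.

Lemma torsion_roots : exists rs : seq K,
  [/\ uniq rs, size rs = (q ^ d)%N, (forall z, z \in rs <-> torsion z),
   carlitz_over K P = \prod_(z <- rs) ('X - z%:P) & <<1 & rs>>%VS = {:K}%VS].
Proof.
case: Ksplit => rs rsE gen; exists rs.
have E : carlitz_over K P = \prod_(z <- rs) ('X - z%:P).
  apply/eqP; rewrite -eqp_monic ?monic_carlitz_over ?monic_prod_XsubC //.
split=> //.
- by rewrite -separable_prod_XsubC -E separable_carlitz_over.
- by apply: succn_inj; rewrite -(size_prod_XsubC rs id) -E size_carlitz_over.
- by move=> z; rewrite -root_prod_XsubC -E; exact: torsionP.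
Qed.

Lemma torsionC a z : torsion z -> torsion (C a z).
Proof. by move=> tz; rewrite -copM mulrC copM tz copr0. Qed.

Lemma exists_torsion : exists2 lam : K, lam != 0 & torsion lam.
Proof.
have [rs [us srs rsP _ _]] := torsion_roots.
have q1 : (1 < size rs)%N.
  rewrite srs -(expn0 q) ltn_exp2l ?finField_card_gt1 //.
  by have := monic_irreducible_size HP; case: (size P) => [|[]].
have [/= z zrs z0] : exists2 z, z \in rs & z != 0.
  apply/hasP; apply: contraTT q1; rewrite -all_predC -leqNgt => /allP all0.
  have : {subset rs <= [:: 0]} by move=> z /all0 /=; rewrite negbK inE.
  by move/(uniq_leq_size us).
by exists z => //; apply/rsP.
Qed.

Lemma torsion_ann lam b : lam != 0 -> torsion lam -> (C b lam = 0) <-> (P %| b).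
Proof.
move=> lam0 tlam; split; last first.
  by move=> /divpK <-; rewrite copM tlam copr0.
move=> Cb; have [//|Pb] := boolP (P %| b); exfalso.
move: Pb; rewrite -(coprimep_irreducible HP) => /Bezout_eq1_coprimepP[[u v] /= uv].
move/eqP: lam0; apply; rewrite -(cop1 i_ lam) -uv copDl !copM tlam Cb.
by rewrite !copr0 addr0.
Qed.

Lemma torsion_ge0 (w : place_of K) z : (forall f, vge w 0 (i_ f)) -> torsion z ->
  vge w 0 z.
Proof.
move=> wA tz; apply: (@vge_integral _ _ w (carlitz_over K P)).
- exact: monic_carlitz_over.
- exact/torsionP.
by move=> i; rewrite /carlitz_over coef_map; exact: wA.
Qed.

Section Generator.
Variables (lam : K) (lam0 : lam != 0) (tlam : torsion lam).

Lemma cop_mod (a : {poly F}) : C (val (residue_class HP a)) lam = C a lam.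
Proof.
apply/eqP; rewrite -subr_eq0 -copBl; apply/eqP/torsion_ann => //.
by rewrite -(residue_class_eq0 HP) rmorphB subr_eq0; apply/eqP/residue_classK.
Qed.

Lemma cop_val_inj : injective (fun b : A_P => C (val b) lam).
Proof.
move=> b c /= /eqP; rewrite -subr_eq0 -copBl => /eqP/torsion_ann -/(_ lam0 tlam).
rewrite -(residue_class_eq0 HP) rmorphB /= !residue_classK subr_eq0.
by move/eqP.
Qed.

(** b |-> C_b(lam) is injective on A/P, whose q^d elements are as many as the roots of C_P. *)
Lemma torsion_gen z : torsion z -> exists b : A_P, z = C (val b) lam.
Proof.
have [rs [us srs rsP _ _]] := torsion_roots.
pose t := [seq C (val b) lam | b : A_P].
have ut : uniq t by rewrite map_inj_uniq ?enum_uniq //; exact: cop_val_inj.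
have st : {subset t <= rs} by move=> _ /mapP[b _ ->]; apply/rsP/torsionC.
have sz : (size rs <= size t)%N by rewrite size_map -cardE card_qfpoly srs.
have [_ tE] := uniq_min_size ut st sz.
by move=> /rsP; rewrite -tE => /mapP[b _ ->]; exists b.
Qed.

Lemma cop_val_neq0 (b : A_P) : (C (val b) lam != 0) = (b != 0).
Proof.
congr (~~ _); apply/eqP/eqP => [|->]; last by rewrite [val _]/(polyn _) /= cop0.
by rewrite -(cop0 i_ lam) => h; apply: cop_val_inj; rewrite /= h.
Qed.

Lemma gen_full : <<1; lam>>%VS = {:K}%VS.
Proof.
apply/eqP; rewrite eqEsubv subvf /=.
have [rs [_ _ rsP _ <-]] := torsion_roots.
apply/Fadjoin_seqP; split; first exact: sub1v.
move=> z /rsP /torsion_gen[b ->]; apply: (@cop_mem _ _ <<1; lam>>%AS).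
exact: memv_adjoin.
Qed.

Section Ramified.
Variables (w : place_of K) (e : nat) (wP : lies_above w (Fin P) e).

(** Any two nonzero torsion points are images of each other under some C_b, and C_b does not lower a
    nonnegative order. *)
Lemma ord_torsion z : z != 0 -> torsion z -> ord w z = ord w lam.
Proof.
have aux x y : x != 0 -> torsion x -> y != 0 -> torsion y -> (exists b, y = C b x) ->
    ord w x <= ord w y.
  move=> x0 tx y0 ty [b bE]; rewrite -vgeE // bE.
  apply: vge_cop; first exact: (above_fin_ge0 wP).
    by rewrite -vgeE ?(torsion_ge0 (above_fin_ge0 wP)).
  by rewrite vgeE.
move=> z0 tz; have [b zE] := torsion_gen tz.
have b0 : b != 0 by rewrite -cop_val_neq0 -zE.
apply/eqP; rewrite eq_le !aux //; first by exists (val b).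
exists (val b^-1); rewrite zE -copM.
have redE : residue_class HP (val b^-1 * val b) = 1.
  by rewrite rmorphM -(mulVf b0); congr (_ * _); exact: residue_classK.
by rewrite -cop_mod redE [val _]/(1 : {poly F}) cop1.
Qed.

(** P is the derivative of C_P at 0, hence the product of [- z] over the q^d - 1 nonzero torsion
    points, all of the same order. *)
Lemma ord_prime_torsion : e%:Z = (q ^ d).-1%:Z * ord w lam.
Proof.
have [rs [us srs rsP rsE _]] := torsion_roots.
have rs0 : 0 \in rs by apply/rsP; exact: copr0.
rewrite -(above_fin_prime HP wP).
have -> : i_ P = \prod_(z <- rem 0 rs) (- z).
  have := congr1 (fun f => f.[0]) deriv_carlitz_over; rewrite hornerC => <-.
  rewrite rsE (perm_big _ (perm_to_rem rs0)) big_cons subr0 derivM derivX mul1r.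
  rewrite hornerD hornerM hornerX mul0r addr0 horner_prod.
  by apply: eq_bigr => z _; rewrite !hornerE.
have z0 z : z \in rem 0 rs -> z != 0 /\ torsion z.
  by rewrite mem_rem_uniq // !inE => /andP[? /rsP].
rewrite big_seq ord_prod; last by move=> z /z0[]; rewrite oppr_eq0.
rewrite (eq_bigr (fun=> ord w lam)); last first.
  by move=> z /z0[h tz]; rewrite ordN ord_torsion.
rewrite -big_seq big_const_seq count_predT size_rem // srs iter_addr_0.
by rewrite -mulr_natl natz.
Qed.

Lemma ord_lam_gt0 : 0 < ord w lam.
Proof.
have [e0 _] := wP; have := ord_prime_torsion.
have : 0 <= ord w lam by rewrite -vgeE ?(torsion_ge0 (above_fin_ge0 wP)).
by rewrite le_eqVlt => /predU1P[<-|//]; rewrite mulr0; lia.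
Qed.

(** Total ramification bounds the degree. In a shorter equation of lam over k two terms would have
    equal order, but the orders e m + i ord(lam), with e = (q^d - 1) ord(lam), are distinct for
    distinct i < q^d - 1. *)
Lemma dim_ge : ((q ^ d).-1 <= \dim {:K})%N.
Proof.
rewrite -gen_full dim_Fadjoin dimv1 muln1 leqNgt; apply/negP => dlt.
have [f0 fr fO] : [/\ minPoly 1 lam != 0, root (minPoly 1 lam) lam &
    forall i, (minPoly 1 lam)`_i \in 1%VS].
  by split; [exact/monic_neq0/monic_minPoly | exact: root_minPoly | exact/polyOverP/minPolyOver].
have sf := size_minPoly 1 lam; set f := minPoly 1 lam in f0 fr fO sf.
have HO : is_valring (fun x => vge w 0 x).
  split; first by split; [exact: vge1 | exact: vgeB | exact: vge0M].
  move=> x x0; rewrite !vgeE ?invr_eq0 // ordV //.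
  by have [h|h] := leP 0 (ord w x); [left | right; rewrite oppr_ge0 ltW].
pose s := [seq i <- iota 0 (size f) | f`_i != 0].
have [||i||i [j [si sj ij]]] := @vanishing_sum_associated _ _ HO _ s (fun i => f`_i * lam ^+ i).
- by rewrite filter_uniq // iota_uniq.
- rewrite lt0n size_eq0 -has_filter; apply/hasP; exists (size f).-1.
    by rewrite mem_iota /= add0n prednK // lt0n size_poly_eq0.
  by rewrite -lead_coefE lead_coef_eq0.
- by rewrite mem_filter => /andP[fi _]; rewrite mulf_neq0 // expf_neq0.
- move: fr => /rootP fx.
  rewrite big_filter big_mkcond -[RHS]fx horner_coef /=.
  rewrite -(big_mkord xpredT (fun i => f`_i * lam ^+ i)) /index_iota subn0.
  by apply: eq_bigr => i _; case: eqP => // ->; rewrite mul0r.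
move: si sj; rewrite !mem_filter !mem_iota !add0n /= => /andP[fi isz] /andP[fj jsz] [u0 u1 u2].
move: u1 u2; rewrite !vgeE ?invr_eq0 // ordV // => u1 u2.
have : ord w (f`_i * lam ^+ i / (f`_j * lam ^+ j)) = 0.
  by apply/eqP; rewrite eq_le u1 -oppr_ge0 u2.
rewrite ordM ?mulf_neq0 ?invr_eq0 ?mulf_neq0 ?expf_neq0 // ordV ?mulf_neq0 ?expf_neq0 //.
rewrite !ordM ?expf_neq0 // !ordX // -[ord w lam *+ i]mulr_natr -[ord w lam *+ j]mulr_natr !natz.
have ordk y : y \in 1%VS -> y != 0 -> exists m : int, ord w y = e%:Z * m.
  move=> /iota_frac[g [h [h0 ->]]] y0.
  have g0 : g != 0 by apply: contraNneq y0 => ->; rewrite rmorph0 mul0r.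
  have [m1 E1] := above_fin_dvd wP g0; have [m2 E2] := above_fin_dvd wP h0.
  exists (m1 - m2); rewrite ordM ?invr_eq0 ?iota_eq0 // ordV ?iota_eq0 // E1 E2.
  by rewrite mulrBr.
have [mi ->] := ordk _ (fO i) fi; have [mj ->] := ordk _ (fO j) fj.
rewrite ord_prime_torsion; have := ord_lam_gt0; set c := ord w lam; set N := (q ^ d).-1.
move=> c0 E.
have iN : (i < N)%N by apply: leq_trans isz _; rewrite sf.
have jN : (j < N)%N by apply: leq_trans jsz _; rewrite sf.
have {}E : c * (N%:Z * (mi - mj) + (i%:Z - j%:Z)) = 0 by rewrite -[RHS]E; ring.
move/eqP: E; rewrite mulf_eq0 gt_eqF //= => /eqP E.
have [mm|mm] := eqVneq mi mj; first by move: ij; rewrite mm subrr mulr0 add0r in E; lia.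
by nia.
Qed.

End Ramified.

Notation G := ('Gal({:K} / 1)%g).

Lemma gal_all (s : gal_of {:K}) : s \in G.
Proof. by rewrite gal_kAut ?sub1v // kAut1E subvf. Qed.

Lemma gal_iota (s : gal_of {:K}) f : s (i_ f) = i_ f.
Proof. exact: (fixed_gal (sub1v _) (gal_all s) (iota_in1 K f)). Qed.

Lemma gal_cop (s : gal_of {:K}) a z : s (C a z) = C a (s z).
Proof. exact: (@cop_rmorph _ _ (s : {rmorphism K -> K}) a z (gal_iota s)). Qed.

Lemma gal_torsion (s : gal_of {:K}) z : torsion z -> torsion (s z).
Proof. by move=> tz; rewrite -gal_cop tz rmorph0. Qed.

Lemma galois_K : galois 1 {:K}.
Proof.
apply/splitting_galoisField; exists (carlitz_over K P); split=> //.
- apply/polyOverP => i; rewrite /carlitz_over coef_map; exact: iota_in1.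
- exact: separable_carlitz_over.
Qed.

Lemma gal_eq_gen (s t : gal_of {:K}) : s lam = t lam -> s = t.
Proof.
move=> st; apply/eqP/gal_eqP => x _.
have : x \in <<1; lam>>%VS by rewrite gen_full memvf.
move=> /Fadjoin_polyP[f fO ->].
rewrite -!horner_map /= st; congr (_.[_]).
apply/polyP => i; rewrite !coef_map /=.
have fx (u : gal_of {:K}) : u f`_i = f`_i.
  by apply: (fixed_gal (sub1v _) (gal_all u)); exact/polyOverP.
by rewrite !fx.
Qed.

(** s |-> s(lam) injects G into the q^d - 1 nonzero torsion points, and [dim_ge] supplies as many
    automorphisms; so every class b is realised. *)
Lemma card_G : #|G| = (q ^ d).-1 /\ forall b : A_P, b != 0 ->
  exists s : gal_of {:K}, s lam = C (val b) lam.
Proof.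
have [w [e wP]] := exists_place_fin K HP.
have [rs [us srs rsP _ _]] := torsion_roots.
pose t := [seq s lam | s : gal_of {:K}].
have ut : uniq t by rewrite map_inj_uniq ?enum_uniq // => s s'; exact: gal_eq_gen.
have st : {subset t <= rem 0 rs}.
  move=> _ /mapP[s _ ->]; rewrite mem_rem_uniq // !inE fmorph_eq0 lam0 /=.
  by apply/rsP/gal_torsion.
have GT : #|G| = #|{: gal_of {:K}}| by apply: eq_card => s; rewrite gal_all.
have sz : (size (rem 0%R rs) <= size t)%N.
  have rs0 : 0 \in rs by apply/rsP; exact: copr0.
  rewrite size_rem // srs size_map -cardE -GT -galois_dim ?galois_K // dimv1 divn1.
  exact: (dim_ge wP).
have [tsz tE] := uniq_min_size ut st sz; split.
  have rs0 : 0 \in rs by apply/rsP; exact: copr0.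
  by rewrite GT cardE -(size_map (fun s : gal_of _ => s lam)) tsz size_rem // srs.
move=> b b0; have : C (val b) lam \in rem 0 rs.
  by rewrite mem_rem_uniq // !inE cop_val_neq0 b0 /=; apply/rsP/torsionC.
by rewrite -tE => /mapP[s _ ->]; exists s.
Qed.

End Generator.

Lemma gal_class (s : gal_of {:K}) : exists b : A_P, b != 0 /\
  forall z, torsion z -> s z = C (val b) z.
Proof.
have [lam lam0 tlam] := exists_torsion.
have [b bE] := torsion_gen lam0 tlam (gal_torsion s tlam).
exists b; split; first by rewrite -(cop_val_neq0 lam0 tlam) -bE fmorph_eq0.
move=> z /(torsion_gen lam0 tlam)[c ->]; rewrite gal_cop bE -!copM mulrC //.
Qed.

Lemma class_gal (b : A_P) : b != 0 -> exists s : gal_of {:K},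
  forall z, torsion z -> s z = C (val b) z.
Proof.
have [lam lam0 tlam] := exists_torsion => b0.
have [_ /(_ b b0)[s sE]] := card_G lam0 tlam.
exists s => z /(torsion_gen lam0 tlam)[c ->]; rewrite gal_cop sE -!copM mulrC //.
Qed.

Lemma class_inj (b c : A_P) : (forall z, torsion z -> C (val b) z = C (val c) z) -> b = c.
Proof.
have [lam lam0 tlam] := exists_torsion.
by move=> /(_ _ tlam)/(cop_val_inj lam0 tlam).
Qed.

Lemma gal_eq_torsion (s t : gal_of {:K}) : (forall z, torsion z -> s z = t z) -> s = t.
Proof.
have [lam lam0 tlam] := exists_torsion.
by move=> /(_ _ tlam)/(gal_eq_gen lam0 tlam).
Qed.

End Torsion.

(** * Frobenius elements *)

Section FrobeniusFinite.
Variables (F : finFieldType) (P : {poly F}) (HP : monic_irreducible_poly P).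
Variable (K : splittingFieldType {fraction {poly F}}).
Hypothesis Ksplit : splittingFieldFor 1 (carlitz_over K P) {:K}.
Notation q := #|F|.
Notation i_ := (iota_K K).
Notation d := (size P).-1.
Notation C := (cop (iota_K K)).
Notation torsion z := (C P z = 0).
Variables (Q : {poly F}) (HQ : monic_irreducible_poly Q).
Variables (lam : K) (lam0 : lam != 0) (tlam : torsion lam).
Variable (sigma : gal_of {:K}).
Hypothesis sigmaE : sigma lam = C Q lam.
Variables (w : place_of K) (e : nat) (wQ : lies_above w (Fin Q) e).
Notation N := (q ^ (size Q).-1)%N.

(** The image of [ev] is the ring R = A[lam], on which sigma and the N-power map agree modulo Q. *)
Let ev (f : {poly {poly F}}) : K := (map_poly i_ f).[lam].

Let evD f g : ev (f + g) = ev f + ev g.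
Proof. by rewrite /ev rmorphD hornerD. Qed.
Let evM f g : ev (f * g) = ev f * ev g.
Proof. by rewrite /ev rmorphM hornerM. Qed.
Let evN f : ev (- f) = - ev f.
Proof. by rewrite /ev rmorphN hornerN. Qed.
Let evX f n : ev (f ^+ n) = ev f ^+ n.
Proof. by rewrite /ev rmorphXn horner_exp. Qed.
Let evC g : ev g%:P = i_ g.
Proof. by rewrite /ev map_polyC hornerC. Qed.
Let evZ g f : ev (g *: f) = i_ g * ev f.
Proof. by rewrite -mul_polyC evM evC. Qed.
Let ev1 : ev 1 = 1.
Proof. by rewrite /ev rmorph1 hornerC. Qed.

Let ev0 : ev 0 = 0.
Proof. by rewrite /ev rmorph0 horner0. Qed.

Let ev_sigma f : sigma (ev f) = ev (f \Po carlitz Q).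
Proof.
rewrite /ev map_comp_poly horner_comp -/(carlitz_over K Q) horner_carlitz_over -sigmaE.
rewrite -horner_map /=; congr (_.[_]); apply/polyP => i.
by rewrite !coef_map /= gal_iota.
Qed.

Let ev_frob f : exists h, ev f ^+ N = sigma (ev f) + i_ Q * ev h.
Proof.
have [h hE] := carlitz_frobenius HQ f; exists h.
by rewrite -evX hE evD evZ ev_sigma.
Qed.

(** The error stays divisible by Q because N is a power of q: (g + Q h)^N = g^N + Q^N h^N. *)
Let ev_frob_iter m f : exists g h, (sigma ^+ m)%g (ev f) = ev g /\
  ev f ^+ (N ^ m) = ev g + i_ Q * ev h.
Proof.
elim: m f => [|m IH] f.
  by exists f, 0; rewrite expg0 gal_id expn0 expr1 ev0 mulr0 addr0.
have [g [h [gE hE]]] := IH f; have [h' h'E] := ev_frob g.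
exists (g \Po carlitz Q), (h' + Q ^+ N.-1 *: h ^+ N); split.
  by rewrite expgSr galM ?memvf // gE ev_sigma.
have fC : {rmorphism F -> K} := (i_ \o polyC)%FUN.
rewrite expnSr exprM hE (exprDcardX fC) h'E ev_sigma -addrA; congr (_ + _).
rewrite evD evZ rmorphXn evX mulrDr; congr (_ + _).
rewrite exprMn mulrA -exprS prednK // expn_gt0 finField_card_gt0 //.
Qed.

Let ev_ge0 f : vge w 0 (ev f).
Proof.
rewrite /ev horner_coef; apply: vge_sum => i _; rewrite vge0M //.
  by rewrite coef_map (above_fin_ge0 wQ).
by apply: vge0X; apply: torsion_ge0 tlam => //; exact: (above_fin_ge0 wQ).
Qed.

Let ord_Q : ord w (i_ Q) = e%:Z.
Proof. exact: (above_fin_prime HQ wQ). Qed.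

Let iQ0 : i_ Q != 0.
Proof. by rewrite iota_eq0 (monic_irreducible_neq0 HQ). Qed.

Let e_gt0 : (0 < e)%N. Proof. by case: wQ. Qed.

(* R/QR is reduced, with x^(N^m) = x for m the order of sigma. *)
Let ev_split f : ev f != 0 -> 0 < ord w (ev f) ->
  exists y z, [/\ ev y != 0, ord w (ev y) = 0 & ev f * ev y = i_ Q * ev z].
Proof.
move=> f0 wf; pose m := #[sigma]%g.
have [g [h [gE hE]]] := ev_frob_iter m f.
move: gE; rewrite expg_order gal_id => gE; rewrite -gE in hE.
have Nm : (1 < N ^ m)%N.
  have N1 : (q ^ 0 < N)%N.
    rewrite ltn_exp2l ?finField_card_gt1 //; have := monic_irreducible_size HQ.
    by case: (size Q) => [|[]].
  have : (N ^ 0 < N ^ m)%N by rewrite ltn_exp2l // order_gt0.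
  by [].
(* y = f^(N^m - 1) - 1 is a unit at [w], as f has positive order, and f y = f^(N^m) - f is a
   multiple of Q. *)
have yE : ev (f ^+ (N ^ m).-1 - 1) = -1 + ev f ^+ (N ^ m).-1.
  by rewrite evD evN evX ev1 addrC.
have [] := @ord_dominant _ _ w (-1) (ev f ^+ (N ^ m).-1).
- by rewrite oppr_eq0 oner_eq0.
- move=> _; rewrite ordN ord_one ordX //.
  have : (0 < (N ^ m).-1)%N by rewrite -ltnS prednK // ltnW.
  by case: (N ^ m).-1 => // k _; rewrite pmulrn_lgt0.
rewrite -yE ordN ord_one => y0 wy.
exists (f ^+ (N ^ m).-1 - 1), h; split=> //.
rewrite yE mulrDr mulrN1 -exprS prednK ?(ltnW Nm) // hE addrA addNr add0r //.
Qed.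

(** Descent: each use of [ev_split] removes a factor Q, of order e, and leaves an element of R
    again. *)
Let ord_ev_dvd n f : ev f != 0 -> ord w (ev f) = n%:Z -> (e %| n)%N.
Proof.
have [k] := ubnP n; elim: k n f => // k IH n f nk f0 fE.
have [->|n0] := posnP n; first exact: dvdn0.
have [|y [z [y0 wy zE]]] := ev_split f0; first by rewrite fE ltz_nat.
have z0 : ev z != 0.
  by apply/eqP => z0; move: zE; rewrite z0 mulr0 => /eqP; rewrite mulf_eq0 (negPf f0) (negPf y0).
have := congr1 (ord w) zE; rewrite !ordM // wy ord_Q fE addr0 => nE.
have : 0 <= ord w (ev z) by rewrite -vgeE // ev_ge0.
case zn : (ord w (ev z)) => [j|//] _.
have {}nE : n = (e + j)%N by apply/eqP; rewrite -eqz_nat nE zn.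
rewrite nE dvdn_addr //; apply: (IH j z) => //.
by rewrite -ltnS; apply: leq_trans nk; rewrite ltnS nE -add1n leq_add2r.
Qed.

Let ev_frac x : exists f g, g != 0 /\ x = ev f / i_ g.
Proof.
have : x \in <<1; lam>>%VS by rewrite (gen_full HP Ksplit lam0 tlam) memvf.
move=> /Fadjoin_polyP[p pO ->]; rewrite horner_coef.
elim/big_ind: _ => [|_ _ [f [g [g0 ->]]] [f' [g' [g'0 ->]]]|i _].
- by exists 0, 1; rewrite oner_neq0 ev0 mul0r.
- exists (g' *: f + g *: f'), (g * g'); rewrite mulf_neq0 //; split=> //.
  by rewrite evD !evZ rmorphM; field; rewrite !iota_eq0 g0 g'0.
- have /iota_frac[a [b [b0 ->]]] : p`_i \in 1%VS by exact/polyOverP.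
  exists (a *: 'X^i), b; split=> //; rewrite evZ evX /ev map_polyX hornerX.
  by rewrite mulrAC.
Qed.

(** K is the fraction field of R, where all orders are multiples of e; yet some element of K has
    order 1. *)
Lemma frobenius_unramified : e = 1%N.
Proof.
have [x wx] := place_normalised w.
have x0 : x != 0 by apply: contra_eq_neq wx => ->; rewrite val_fun0.
have ox : ord w x = 1 by rewrite /ord wx.
have [f [g [g0 xE]]] := ev_frac x.
have f0 : ev f != 0 by apply: contraNneq x0 => f0; rewrite xE f0 mul0r.
have ig0 : ev g%:P != 0 by rewrite evC iota_eq0.
have := ox; rewrite xE -(evC g) ordM ?invr_eq0 // ordV //.
have : 0 <= ord w (ev f) by rewrite -vgeE // ev_ge0.
have : 0 <= ord w (ev g%:P) by rewrite -vgeE // ev_ge0.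
case gE : (ord w (ev g%:P)) => [j|//] _; case fE : (ord w (ev f)) => [i|//] _ ij.
have := ord_ev_dvd f0 fE; have := ord_ev_dvd ig0 gE => ej ei.
have iE : i = (j + 1)%N by lia.
by move: ei; rewrite iE dvdn_addr // dvdn1 => /eqP.
Qed.

Let ev_strip j f : ev f != 0 -> j%:Z <= ord w (ev f) ->
  exists y z, [/\ ev y != 0, ord w (ev y) = 0 & ev f * ev y = i_ Q ^+ j * ev z].
Proof.
move=> f0; elim: j => [|j IH] jf.
  by exists 1, f; rewrite ev1 oner_neq0 ord_one mulr1 expr0 mul1r.
have [|y [z [y0 wy zE]]] := IH; first by apply: le_trans jf; rewrite lez_nat.
have z0 : ev z != 0.
  by apply/eqP => z0; move: zE; rewrite z0 mulr0 => /eqP; rewrite mulf_eq0 (negPf f0) (negPf y0).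
have := congr1 (ord w) zE; rewrite !ordM ?expf_neq0 // wy ordX // ord_Q addr0.
rewrite frobenius_unramified => fz.
have [|y' [z' [y'0 wy' z'E]]] := ev_split z0.
  by move: jf; rewrite fz natz; lia.
exists (y * y'), z'; rewrite !evM mulf_neq0 // ordM // wy wy' addr0; split=> //.
by rewrite mulrA zE -mulrA z'E exprSr mulrA.
Qed.

(** Numerator and denominator are both divided by the power of Q contained in the denominator, up to
    factors that are units at [w]. *)
Let ev_local x : vge w 0 x -> exists a b, [/\ ev b != 0, ord w (ev b) = 0 & x * ev b = ev a].
Proof.
have [->|x0] := eqVneq x 0.
  by exists 0, 1; rewrite ev1 oner_neq0 ord_one mul0r ev0.
rewrite vgeE // => wx; have [f [g [g0 xE]]] := ev_frac x.
have f0 : ev f != 0 by apply: contraNneq x0 => f0; rewrite xE f0 mul0r.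
have ig0 : ev g%:P != 0 by rewrite evC iota_eq0.
have : 0 <= ord w (ev g%:P) by rewrite -vgeE // ev_ge0.
case gE : (ord w (ev g%:P)) => [j|//] _.
have [|y [z [y0 wy zE]]] := @ev_strip j _ ig0; first by rewrite gE.
have [|y' [z' [y'0 wy' z'E]]] := @ev_strip j _ f0.
  have : ord w (x * ev g%:P) = ord w (ev f) by rewrite xE evC divfK // iota_eq0.
  by rewrite ordM // gE => <-; rewrite -subr_ge0 addrK.
have z0 : ev z != 0.
  by apply/eqP => z0; move: zE; rewrite z0 mulr0 => /eqP; rewrite mulf_eq0 (negPf ig0) (negPf y0).
exists (z' * y), (y' * z); rewrite !evM mulf_neq0 //; split=> //.
  have := congr1 (ord w) zE; rewrite !ordM ?expf_neq0 // wy ordX // ord_Q gE wy'.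
  by rewrite frobenius_unramified natz; clear; lia.
have Qj0 : i_ Q ^+ j != 0 by rewrite expf_neq0.
apply: (mulfI Qj0); rewrite [RHS]mulrA -z'E xE -(evC g).
have -> : i_ Q ^+ j * (ev f / ev g%:P * (ev y' * ev z)) =
  ev f / ev g%:P * ev y' * (i_ Q ^+ j * ev z) by ring.
by rewrite -zE; field.
Qed.

Lemma frobenius_congr x : vge w 0 x -> vge w 1 (sigma x - x ^+ N).
Proof.
move=> /ev_local[a [b [b0 wb abE]]].
have [h hE] := ev_frob a; have [h' h'E] := ev_frob b.
have wQ1 y : vge w 1 (i_ Q * ev y).
  by rewrite -[1]addr0 vgeM ?ev_ge0 // vgeE // ord_Q frobenius_unramified.
have sb : sigma (ev b) != 0 /\ ord w (sigma (ev b)) = 0.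
  have -> : sigma (ev b) = ev b ^+ N + - (i_ Q * ev h') by rewrite h'E addrK.
  have [||-> ->] := @ord_dominant _ _ w (ev b ^+ N) (- (i_ Q * ev h')).
  - by rewrite expf_neq0.
  - rewrite oppr_eq0 => n0; rewrite ordX // wb mul0rn ordN.
    by have := wQ1 h'; rewrite vgeE.
  by rewrite ordX // wb mul0rn.
have [-> | n0] := eqVneq (sigma x - x ^+ N) 0; first exact: vge0.
(* For x = a/b this clears the denominators sigma(b) and b^N, both of order 0, and reduces the claim
   to the congruences for a and b. *)
have E : (sigma x - x ^+ N) * (sigma (ev b) * ev b ^+ N) =
    i_ Q * ev (a ^+ N * h' - h * b ^+ N).
  rewrite evD evN !evM !evX.
  have -> : (sigma x - x ^+ N) * (sigma (ev b) * ev b ^+ N) =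
     sigma (x * ev b) * ev b ^+ N - (x * ev b) ^+ N * sigma (ev b).
    by rewrite rmorphM exprMn; ring.
  by rewrite abE hE h'E; ring.
have := wQ1 (a ^+ N * h' - h * b ^+ N); rewrite -E.
case: sb => sb0 wsb; rewrite !vgeE ?mulf_neq0 ?expf_neq0 //.
by rewrite !ordM ?mulf_neq0 ?expf_neq0 // wsb ordX // wb mul0rn !addr0.
Qed.

End FrobeniusFinite.

(** * Places of K and of its subfields above a place of k *)

Section PlacesOfSubfields.
Variables (F : finFieldType) (K : fieldExtType {fraction {poly F}}).
Variable E : {subfield K}.
Notation M := (subvs_of E).

Lemma vsval_iota f : vsval (iota_K M f) = iota_K K f.
Proof. exact: (rmorph_alg (vsval : {lrmorphism M -> K})). Qed.

Lemma vsvalX (x : M) n : vsval (x ^+ n) = vsval x ^+ n.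
Proof. exact: rmorphXn. Qed.

Lemma vsval_eq0 (x : M) : (vsval x == 0) = (x == 0).
Proof. by rewrite -(inj_eq val_inj). Qed.

Lemma extend_above (w : place_of M) v e : lies_above w v e ->
  exists (w' : place_of K) (g : nat), [/\ (0 < g)%N, lies_above w' v (g * e)%N &
    forall x : M, x != 0 -> ord w' (vsval x) = g%:Z * ord w x].
Proof.
move=> /lies_above_ord[e0 we]; have [w' [g [g0 w'E]]] := extend_place w.
exists w', g; split=> //; apply: ord_lies_above; first by rewrite muln_gt0 g0.
move=> f f0; rewrite -vsval_iota w'E; last by rewrite iota_eq0.
by rewrite we // mulrA.
Qed.

(** [f] shows that the restriction is not trivial, and e is read off from its order. The absolute
    value is there for the place at infinity, where T has value -1. *)
Lemma restrict_above (w' : place_of K) v e' : lies_above w' v e' ->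
  (exists2 f : {poly F}, f != 0 & `|place_val v f|%N = 1%N) ->
  exists (w : place_of M) (g e : nat), [/\ (0 < g)%N, lies_above w v e, e' = (g * e)%N &
    forall x : M, x != 0 -> ord w' (vsval x) = g%:Z * ord w x].
Proof.
move=> /lies_above_ord[e0 we] [f f0 vf].
have [|||w [g [g0 wE]]] := @restrict_place _ _ E w' (iota_K K f).
- by rewrite -vsval_iota subvsP.
- by rewrite iota_eq0.
- by rewrite we // mulf_neq0 //; lia.
have wv (h : {poly F}) : h != 0 -> e'%:Z * place_val v h = g%:Z * ord w (iota_K M h).
  by move=> h0; rewrite -we // -vsval_iota wE ?iota_eq0.
have eE : e' = (g * `|ord w (iota_K M f)|)%N.
  by have := congr1 absz (wv f f0); rewrite !abszM /= vf muln1.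
exists w, g, `|ord w (iota_K M f)|%N; split=> //; apply: ord_lies_above.
  by move: e0; rewrite eE muln_gt0 => /andP[].
move=> h h0; have := wv h h0; rewrite {1}eE PoszM -mulrA => /mulfI -> //.
by rewrite -lt0n.
Qed.

End PlacesOfSubfields.

(** * The field cut out by a character *)

Section CharacterField.
Variables (F : finFieldType) (P : {poly F}) (HP : monic_irreducible_poly P).
Variable (K : splittingFieldType {fraction {poly F}}).
Hypothesis Ksplit : splittingFieldFor 1 (carlitz_over K P) {:K}.
Notation q := #|F|.
Notation i_ := (iota_K K).
Notation d := (size P).-1.
Notation C := (cop (iota_K K)).
Notation torsion z := (C P z = 0).
Variable chi : gal_of {:K} -> algC.
Hypothesis chiM : forall s t : gal_of {:K}, chi (s * t)%g = chi s * chi t.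
Hypothesis chi_neq0 : forall s, chi s != 0.
Notation E := (char_field chi).

Lemma chi1 : chi 1%g = 1.
Proof. by apply: (mulfI (chi_neq0 1%g)); rewrite -chiM mulg1 mulr1. Qed.

Lemma chiV s : chi s^-1%g = (chi s)^-1.
Proof. by apply: (mulfI (chi_neq0 s)); rewrite -chiM mulgV chi1 mulfV. Qed.

Lemma galC (s t : gal_of {:K}) : (s * t = t * s)%g.
Proof.
apply: (gal_eq_torsion HP Ksplit) => z tz.
have [b [_ bE]] := gal_class HP Ksplit s; have [c [_ cE]] := gal_class HP Ksplit t.
rewrite !galM ?memvf // (bE z tz) (cE z tz) !gal_cop (bE z tz) (cE z tz).
by rewrite -!copM mulrC.
Qed.

Lemma char_fieldP x : (x \in E) <-> (forall s : gal_of {:K}, chi s = 1 -> s x = x).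
Proof.
split=> [/mem_fixedFieldP[_ xE] s s1|xE].
  by apply: xE; rewrite inE gal_all s1 eqxx.
by apply/fixedFieldP => [|s]; rewrite ?memvf // inE => /andP[_ /eqP /xE].
Qed.

Lemma chi_fix (s : gal_of {:K}) : (forall x, x \in E -> s x = x) -> chi s = 1.
Proof.
move=> sE; pose H := [set t in 'Gal({:K} / 1)%g | chi t == 1].
have HG : group_set H.
  apply/group_setP; split; first by rewrite inE gal_all chi1 eqxx.
  by move=> x y; rewrite !inE !gal_all chiM => /= /eqP-> /eqP->; rewrite mulr1.
have := gal_fixedField (Group HG) => /setP/(_ s).
rewrite [in RHS]inE gal_all /= => HE.
apply/eqP; rewrite -HE gal_kHom ?subvf //; apply/kAHomP => x xE.
exact: sE.
Qed.

Lemma char_field_gal (s : gal_of {:K}) x : x \in E -> s x \in E.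
Proof.
move=> /char_fieldP xE; apply/char_fieldP => t t1.
have -> : t (s x) = (s * t)%g x by rewrite galM ?memvf.
by rewrite galC galM ?memvf // (xE t t1).
Qed.

Lemma gal_exp_card (s : gal_of {:K}) : (s ^+ (q ^ d).-1 = 1)%g.
Proof.
have [lam lam0 tlam] := exists_torsion HP Ksplit.
have [<- _] := card_G HP Ksplit lam0 tlam.
by apply/eqP; rewrite -order_dvdn order_dvdG // gal_all.
Qed.

(* Put [tau = s / t] and [D = tau - 1]. If [D] maps the valuation ring into
   [pi^j], then [tau^m x = x + m D x] modulo [pi^(j+1)]; for [m = q^d - 1] this
   is [x], and [m] is invertible, so that [D] maps it into [pi^(j+1)]. *)
Lemma frobenius_unique (w : place_of K) (g : nat) (pi : K) N (s t : gal_of {:K}) :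
  (0 < g)%N -> (0 < N)%N ->
  pi \in E -> pi != 0 -> (forall u : gal_of {:K}, u pi = pi) -> ord w pi = g%:Z ->
  (forall x, x \in E -> vge w 0 x -> vge w g%:Z (s x - x ^+ N)) ->
  (forall x, x \in E -> vge w 0 x -> vge w g%:Z (t x - x ^+ N)) ->
  chi s = chi t.
Proof.
move=> g0 N0 piE pi0 pifix wpi ws wt.
pose O x := x \in E /\ vge w 0 x.
have Ot x : O x -> O (t x).
  move=> [xE wx]; split; first exact: char_field_gal.
  rewrite -[t x](subrK (x ^+ N)) vgeD ?vge0X //.
  by apply: vgeW (wt _ xE wx); rewrite lez_nat.
have Otn n x : O x -> O ((t ^+ n)%g x).
  move=> Ox; elim: n => [|n IH]; first by rewrite expg0 gal_id.
  by rewrite expgSr galM ?memvf //; exact: Ot.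
(* The congruence makes [O] stable under [t], hence under [t^-1], which is a power of [t]. *)
have OtV x : O x -> O (t^-1%g x).
  have -> : (t^-1 = t ^+ (q ^ d).-2)%g.
    have qd : (0 < (q ^ d).-1)%N.
      have q1 : (q ^ 0 < q ^ d)%N.
        rewrite ltn_exp2l ?finField_card_gt1 //; have := monic_irreducible_size HP.
        by case: (size P) => [|[]].
      by rewrite -ltnS prednK // ltnW.
    apply/eqP; rewrite eq_invg_mul -expgS prednK //; exact/eqP/gal_exp_card.
  exact: Otn.
pose tau := (t^-1 * s)%g.
pose D x := tau x - x.
have D1 x : O x -> vge w g%:Z (D x).
  move=> Ox; have [yE wy] := OtV _ Ox; rewrite /D /tau galM ?memvf //.
  have tyE : t (t^-1%g x) = x by rewrite -galM ?memvf // mulVg gal_id.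
  set y := t^-1%g x in yE wy tyE *; rewrite -tyE.
  have -> : s y - t y = (s y - y ^+ N) - (t y - y ^+ N) by ring.
  by rewrite vgeB ?ws ?wt.
have DD x y : D (x + y) = D x + D y by rewrite /D raddfD; ring.
have DM (j : nat) y : D (pi ^+ j * y) = pi ^+ j * D y.
  by rewrite /D rmorphM rmorphXn /= pifix mulrBr.
have OE x : O x -> D x \in E by move=> [xE _]; rewrite rpredB // char_field_gal.
have vpi (j : nat) y : vge w (g * j)%N y -> y \in E -> exists2 z, O z & y = pi ^+ j * z.
  move=> wy yE; exists (y / pi ^+ j); last by rewrite mulrCA mulfV ?mulr1 // expf_neq0.
  split; first by rewrite rpredM // rpredVr ?rpredX.
  have [->|y0] := eqVneq y 0; first by rewrite mul0r vge0.
  rewrite vgeE ?mulf_neq0 ?invr_eq0 ?expf_neq0 // ordM ?invr_eq0 ?expf_neq0 //.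
  rewrite ordV ?expf_neq0 // ordX // wpi subr_ge0 -mulr_natr natz -PoszM.
  by rewrite -vgeE.
have qd1 : ((q ^ d).-1%:R : K) = -1.
  apply/eqP; rewrite -addr_eq0 natr1 prednK ?expn_gt0 ?finField_card_gt0 //.
  have : (0 < d)%N by have := monic_irreducible_size HP; case: (size P) => [|[]].
  by case: (d) => // k _; rewrite expnS natrM (iota_card K) mul0r.
have Dj (j : nat) x : O x -> vge w (g * j.+1)%N (D x).
  elim: j x => [|j IH] x Ox; first by rewrite muln1; exact: D1.
  have pow n : vge w (g * j.+2)%N ((tau ^+ n)%g x - x - n%:R * D x).
    elim: n => [|n IHn]; first by rewrite expg0 gal_id subrr mul0r subr0 vge0.
    have -> : (tau ^+ n.+1)%g x - x - n.+1%:R * D x =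
       (tau ^+ n)%g x - x - n%:R * D x + D ((tau ^+ n)%g x - x).
      rewrite expgSr galM ?memvf // /D raddfB /= -natr1; ring.
    apply: vgeD => //.
    have xnE : (tau ^+ n)%g x - x \in E.
      by case: (Ox) => xE _; rewrite rpredB // char_field_gal.
    have wn : vge w (g * j.+1)%N ((tau ^+ n)%g x - x).
      rewrite -[_ - x](subrK (n%:R * D x)) vgeD //.
        by apply: vgeW IHn; rewrite lez_nat leq_mul2l ltnW ?orbT.
      by rewrite -[Posz _]add0r vgeM ?vge_nat ?IH.
    have [z Oz ->] := vpi _ _ wn xnE; rewrite DM.
    apply: (@vgeW _ _ _ _ ((g * j.+1)%N%:Z + (g * j.+1)%N%:Z)).
      by rewrite -PoszD lez_nat -mulnDr leq_mul2l; apply/orP; right; lia.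
    rewrite vgeM ?IH // vgeE ?expf_neq0 // ordX // wpi -mulr_natr natz -PoszM //.
  have := pow (q ^ d).-1; rewrite gal_exp_card gal_id subrr qd1 mulN1r opprK add0r //.
have D0 x : O x -> D x = 0.
  move=> Ox; apply/eqP; apply/negPn/negP => Dx0.
  have := Dj `|ord w (D x)|%N x Ox; rewrite vgeE // => h.
  have lt : (`|ord w (D x)| < g * `|ord w (D x)|.+1)%N.
    by rewrite -[X in (X < _)%N]mul1n; apply: (@leq_trans (1 * `|ord w (D x)|.+1));
      rewrite ?mul1n // leq_pmull.
  have : ord w (D x) < (g * `|ord w (D x)|.+1)%N%:Z.
    by apply: le_lt_trans (lez_abs _) _; rewrite ltz_nat.
  by rewrite ltNge h.
have tauE x : x \in E -> tau x = x.
  move=> xE; have [->|x0] := eqVneq x 0; first by rewrite raddf0.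
  have [wx|wx] := leP 0 (ord w x).
    by apply/eqP; rewrite -subr_eq0; apply/eqP/D0; split=> //; rewrite vgeE.
  have : D x^-1 = 0.
    apply: D0; split; first by rewrite rpredVr.
    by rewrite vgeE ?invr_eq0 // ordV // oppr_ge0 ltW.
  by rewrite /D fmorphV => /eqP; rewrite subr_eq0 => /eqP/invr_inj.
have := chi_fix tauE; rewrite /tau chiM chiV => h.
by rewrite -[chi s](mulVKf (chi_neq0 t)) h mulr1.
Qed.

End CharacterField.

(** * Local values of the characters *)

Lemma val_gt0_int (E : fieldType) (v : valuation int E) x : (0 < v x)%E = vge v 1 x.
Proof.
have [->|x0] := eqVneq x 0; first by rewrite vge0 val_fun0 ltry.
by rewrite vgeE // ordE // lte_fin gtz0_ge1.
Qed.

Lemma exists_max (T : eqType) (s : seq T) (f : T -> int) : (0 < size s)%N ->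
  exists2 x, x \in s & forall y, y \in s -> f y <= f x.
Proof.
elim: s => // a [|b s] IH _.
  by exists a => [|y]; rewrite inE // => /eqP->.
have [x xs xmax] := IH isT; have [ax|xa] := leP (f a) (f x).
  by exists x => [|y]; rewrite inE ?xs ?orbT // => /predU1P[->|/xmax].
exists a => [|y]; rewrite inE ?eqxx // => /predU1P[->|/xmax yx] //.
exact: le_trans yx (ltW xa).
Qed.

Section CharAt.
Variables (F : finFieldType) (P : {poly F}) (HP : monic_irreducible_poly P).
Variable (K : splittingFieldType {fraction {poly F}}).
Hypothesis Ksplit : splittingFieldFor 1 (carlitz_over K P) {:K}.
Notation q := #|F|.
Notation i_ := (iota_K K).
Notation d := (size P).-1.
Notation C := (cop (iota_K K)).
Notation torsion z := (C P z = 0).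
Variable chi : gal_of {:K} -> algC.
Hypothesis chiM : forall s t : gal_of {:K}, chi (s * t)%g = chi s * chi t.
Hypothesis chi_neq0 : forall s, chi s != 0.
Notation E := (char_field chi).
Notation M := (subvs_of (char_field chi)).

Lemma vge_sub (w : place_of M) (w' : place_of K) (g : nat) (n : int) (x : M) :
  (0 < g)%N -> (forall x : M, x != 0 -> ord w' (vsval x) = g%:Z * ord w x) ->
  vge w n x = vge w' (g%:Z * n) (vsval x).
Proof.
move=> g0 ww; have [->|x0] := eqVneq x 0; first by rewrite !raddf0 !vge0.
by rewrite !vgeE ?vsval_eq0 // ww // ler_pM2l.
Qed.

(** Moves the congruence of [is_frobenius] from the field of chi to K, where positive order at [w]
    becomes order at least g at [w']. *)
Lemma frobenius_transfer (w : place_of M) (w' : place_of K) (g N : nat) (s : gal_of {:K}) :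
  (0 < g)%N -> (forall x : M, x != 0 -> ord w' (vsval x) = g%:Z * ord w x) ->
  (forall x : M, (0 <= w x)%E -> (0 < w (vsproj E (s (vsval x)) - x ^+ N)%R)%E) <->
  (forall x, x \in E -> vge w' 0 x -> vge w' g%:Z (s x - x ^+ N)).
Proof.
move=> g0 ww.
have valE (x : M) : vsval (vsproj E (s (vsval x)) - x ^+ N) = s (vsval x) - vsval x ^+ N.
  rewrite raddfB /= vsprojK; first by congr (_ - _); exact: vsvalX.
  exact: (char_field_gal HP Ksplit) (subvsP _).
split=> [ws x xE wx|ws x wx].
- have := ws (vsproj E x); rewrite -/(vge w 0 _) val_gt0_int !(vge_sub _ _ g0 ww).
  by rewrite mulr0 mulr1 valE vsprojK //; exact.
- rewrite val_gt0_int (vge_sub _ _ g0 ww) mulr1 valE; apply: ws; first exact: subvsP.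
  by rewrite -[0](mulr0 g%:Z) -(vge_sub _ _ g0 ww).
Qed.

(** [char_at] takes the value at an arbitrarily chosen Frobenius, so all of them must agree. *)
Lemma char_at_eq v s0 : unramified M v -> is_frobenius chi v s0 ->
  (forall s, is_frobenius chi v s -> chi s = chi s0) -> char_at chi v = chi s0.
Proof.
move=> ur f0 uniq; rewrite /char_at; case: asboolP => // _.
case: xgetP => [x _ /= [s fs <-]|no]; first exact: uniq.
by have := no (chi s0); case; exists s0.
Qed.

Lemma char_at_fin (Q : {poly F}) (s0 : gal_of {:K}) : monic_irreducible_poly Q ->
  (forall z, torsion z -> s0 z = C Q z) -> char_at chi (Fin Q) = chi s0.
Proof.
move=> HQ s0E; have [lam lam0 tlam] := exists_torsion HP Ksplit.
have s0l := s0E _ tlam; have Q0 := monic_irreducible_neq0 HQ.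
have Q1 : `|place_val (Fin Q) Q|%N = 1%N.
  have Qn1 : ~~ (Q %| 1).
    by rewrite dvdp1; have := monic_irreducible_size HQ; case: (size Q) => [|[]].
  by have := place_val_fin HQ 1 Qn1; rewrite mulr1 expr1 => ->.
apply: char_at_eq.
- move=> w e /extend_above[w' [g [g0 w'Q _]]].
  have := frobenius_unramified HP Ksplit HQ lam0 tlam s0l w'Q.
  by move=> /eqP; rewrite muln_eq1 => /andP[_ /eqP].
- split; first exact: gal_all.
  move=> w e /extend_above[w' [g [g0 w'Q ww]]].
  have ge := frobenius_unramified HP Ksplit HQ lam0 tlam s0l w'Q.
  have g1 : g = 1%N by move/eqP: ge; rewrite muln_eq1 => /andP[/eqP].
  apply/(frobenius_transfer _ _ g0 ww) => x _ wx; rewrite g1.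
  exact: (frobenius_congr HP Ksplit HQ lam0 tlam s0l w'Q).
- move=> s [_ sF]; have [w' [e' w'Q]] := exists_place_fin K HQ.
  have e1 := frobenius_unramified HP Ksplit HQ lam0 tlam s0l w'Q.
  have [|w [g [e [g0 wQ geE ww]]]] := restrict_above E w'Q; first by exists Q.
  have g1 : g = 1%N by move/eqP: e1; rewrite geE muln_eq1 => /andP[/eqP].
  have iQ0 : i_ Q != 0 by rewrite iota_eq0.
  apply: (@frobenius_unique _ _ HP _ Ksplit _ chiM chi_neq0 w' 1 (i_ Q) (q ^ (size Q).-1)) => //.
  + by rewrite expn_gt0 finField_card_gt0.
  + exact: (subvP (sub1v E)) (iota_in1 K Q).
  + by move=> u; exact: gal_iota.
  + by rewrite (above_fin_prime HQ w'Q) e1.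
  + by rewrite -g1; apply/(frobenius_transfer _ _ g0 ww); exact: sF wQ.
  + by move=> x _ wx; exact: (frobenius_congr HP Ksplit HQ lam0 tlam s0l w'Q).
Qed.

(** If P were unramified in [E], orders on [E] would be multiples of e' = (q^d - 1) ord(lam). The
    norm of lam to [E] has order |H| ord(lam) with H = Gal(K/E), and 0 < |H| < q^d - 1 since chi is
    nontrivial. *)
Lemma char_at_ramified : (exists s, chi s != 1) -> char_at chi (Fin P) = 0.
Proof.
move=> [s1 chis1]; rewrite /char_at; case: asboolP => // ur; exfalso.
have [lam lam0 tlam] := exists_torsion HP Ksplit.
have P0 := monic_irreducible_neq0 HP.
have P1 : `|place_val (Fin P) P|%N = 1%N.
  have Pn1 : ~~ (P %| 1).
    by rewrite dvdp1; have := monic_irreducible_size HP; case: (size P) => [|[]].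
  by have := place_val_fin HP 1 Pn1; rewrite mulr1 expr1 => ->.
have [w' [e' w'P]] := exists_place_fin K HP.
have [|w [g [e [g0 wP geE ww]]]] := restrict_above E w'P; first by exists P.
have e1 := ur _ _ wP; rewrite e1 muln1 in geE.
have e'E := ord_prime_torsion HP Ksplit lam0 tlam w'P.
have o0 := ord_lam_gt0 HP Ksplit lam0 tlam w'P.
pose H := ('Gal({:K} / E))%g; pose y := galNorm E {:K} lam.
have yE : y \in E.
  by apply: mem_galNorm; [exact: fixedField_galois | exact: memvf].
have y0 : y != 0 by rewrite galNorm_eq0.
have oy : ord w' y = #|H|%:Z * ord w' lam.
  rewrite /y /galNorm ord_prod; last by move=> s _; rewrite fmorph_eq0.
  rewrite (eq_bigr (fun=> ord w' lam)); last first.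
    move=> s _; apply: (ord_torsion HP Ksplit lam0 tlam w'P); first by rewrite fmorph_eq0.
    exact: gal_torsion.
  by rewrite sumr_const -mulr_natl natz.
have cardH : (#|H| < (q ^ d).-1)%N.
  have [<- _] := card_G HP Ksplit lam0 tlam.
  apply: proper_card; rewrite properE; apply/andP; split.
    by apply/fintype.subsetP => s _; rewrite gal_all.
  apply/fintype.subsetPn; exists s1; first exact: gal_all.
  apply: contra chis1 => s1H; apply/eqP; apply: (chi_fix chiM chi_neq0) => x xE.
  by apply: (fixed_gal _ s1H xE); exact: subvf.
have H0 : (0 < #|H|)%N by exact: cardG_gt0.
have := ww (vsproj E y); rewrite -vsval_eq0 vsprojK // oy => /(_ y0).
rewrite -geE e'E; set o := ord w' lam in o0 *; set m := ord w _ => E0.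
have {}E0 : #|H|%:Z = (q ^ d).-1%:Z * m.
  by apply: (mulIf (lt0r_neq0 o0)); rewrite E0 mulrAC.
have m0 : 0 < m by rewrite -(pmulr_rgt0 m (_ : 0 < (q ^ d).-1%:Z)) -?E0 ltz_nat //; lia.
have : (q ^ d).-1%:Z * 1 <= #|H|%:Z by rewrite E0 ler_pM2l ?ltz_nat //; lia.
by rewrite mulr1 lez_nat leqNgt cardH.
Qed.

(** * Orders of torsion points at infinity *)

Section Infinity.
Variables (w : place_of K) (e : nat) (wI : lies_above w (Infty F) e).

Let e_gt0 : (0 < e)%N. Proof. by case: wI. Qed.
Let T0 : i_ 'X != 0. Proof. by rewrite iota_eq0 polyX_eq0. Qed.
Let q1 : 1 <= q%:Z - 1.
Proof. have := finField_card_gt1 F; lia. Qed.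

Lemma torsion_const c z : torsion z -> torsion (i_ c%:P * z).
Proof. by rewrite -copC; exact: torsionC. Qed.

Lemma torsionB x y : torsion x -> torsion y -> torsion (x - y).
Proof.
move=> tx ty; rewrite copDr tx add0r -mulN1r -(rmorph1 i_) -rmorphN -polyC1 -polyCN.
exact: torsion_const.
Qed.

Lemma torsion_twist z : torsion z -> torsion (ctwist i_ z).
Proof. by move=> tz; rewrite cop_ctwist tz ctwist0. Qed.

(** T z and z^q have equal order exactly when (q - 1) ord(z) = -e. Above this threshold T z
    dominates and C_T lowers the order by e; below it z^q dominates. *)
Lemma ord_twist_high z : z != 0 -> - e%:Z < (q%:Z - 1) * ord w z ->
  ctwist i_ z != 0 /\ ord w (ctwist i_ z) = ord w z - e%:Z.
Proof.
move=> z0 wz; have [||n0 ->] := @ord_dominant _ _ w (i_ 'X * z) (z ^+ q).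
- by rewrite mulf_neq0.
- move=> _; rewrite ordM // (above_infty_X wI) ordX // -mulr_natl natz; lia.
- by split=> //; rewrite ordM // (above_infty_X wI) addrC.
Qed.

Lemma ord_twist_low z : z != 0 -> (q%:Z - 1) * ord w z < - e%:Z ->
  ctwist i_ z != 0 /\ ord w (ctwist i_ z) < ord w z.
Proof.
move=> z0 wz; rewrite /ctwist addrC.
have [||n0 ->] := @ord_dominant _ _ w (z ^+ q) (i_ 'X * z).
- by rewrite expf_neq0.
- move=> _; rewrite ordM // (above_infty_X wI) ordX // -mulr_natl natz; lia.
- by split=> //; rewrite ordX // -mulr_natl natz; lia.
Qed.

(** C_T would map a torsion point of least order below the threshold to one of still smaller
    order. *)
Lemma torsion_bottom z : z != 0 -> torsion z -> - e%:Z <= (q%:Z - 1) * ord w z.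
Proof.
have [rs [us srs rsP _ _]] := torsion_roots HP Ksplit.
have mem z' : z' != 0 -> torsion z' -> z' \in rem 0 rs.
  by move=> z'0 tz'; rewrite mem_rem_uniq // !inE z'0; apply/rsP.
move=> z0 tz; have zrs := mem _ z0 tz.
have [|x xrs xmin] := @exists_max _ (rem 0%R rs) (fun x => - ord w x).
  by case: (rem _ _) zrs.
have [x0 tx] : x != 0 /\ torsion x.
  by move: xrs; rewrite mem_rem_uniq // !inE => /andP[? /rsP].
have xz : ord w x <= ord w z by rewrite -lerN2 xmin.
apply: (@le_trans _ _ ((q%:Z - 1) * ord w x)); last by rewrite ler_pM2l //; lia.
rewrite leNgt; apply/negP => /(ord_twist_low x0)[y0 yx].
by have := xmin _ (mem _ y0 (torsion_twist tx)); rewrite lerN2 leNgt yx.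
Qed.

Let fC : {rmorphism F -> K} := (i_ \o polyC)%FUN.

Let artin_schreier_prod (u : K) : u ^+ q - u = \prod_(c : F) (u - i_ c%:P).
Proof.
have := congr1 (fun f => (map_poly fC f).[u]) (finField_genPoly F).
rewrite rmorphB rmorphXn /= map_polyX !hornerE => ->.
rewrite rmorph_prod horner_prod; apply: eq_bigr => c _.
by rewrite rmorphB /= map_polyX map_polyC !hornerE.
Qed.

(** Induction on the height above the threshold. C_T lowers both orders by e there, and a congruence
    between the images pulls back; at the threshold itself the ratio is a root of u^q - u to first
    order. *)
Lemma torsion_ratio (z z' : K) : z != 0 -> torsion z -> z' != 0 -> torsion z' ->
  ord w z' = ord w z -> exists c : F, vge w (ord w z + 1) (z' - i_ c%:P * z).
Proof.
have [n] := ubnP (absz ((q%:Z - 1) * ord w z + e%:Z)).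
elim: n z z' => // n IH z z' zn z0 tz z'0 tz' zz'.
have := torsion_bottom z0 tz; rewrite le_eqVlt => /predU1P[bot|high].
- (* here T z and z^q cancel to first order, so (z'/z)^(q-1) = 1 *)
  have tw x : x != 0 -> torsion x -> ord w x = ord w z -> vge w (ord w z) (ctwist i_ x).
    move=> x0 tx xz; have [->|y0] := eqVneq (ctwist i_ x) 0; first exact: vge0.
    rewrite vgeE //; have := torsion_bottom y0 (torsion_twist tx).
    by rewrite bot ler_pM2l //; lia.
  pose u := z' / z.
  have uE : u ^+ q - u = (ctwist i_ z' - u * ctwist i_ z) / z ^+ q.
    rewrite /ctwist /u expr_div_n; field; by rewrite z0 expf_neq0.
  have ou : ord w u = 0 by rewrite ordM ?invr_eq0 // ordV // zz' subrr.
  have u0 : u != 0 by rewrite mulf_neq0 ?invr_eq0.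
  have : vge w 1 (u ^+ q - u).
    rewrite uE; apply: (@vgeW _ _ _ _ (ord w z - ord w z *+ q)).
      rewrite -mulr_natl natz; lia.
    rewrite vgeM //; last by rewrite vgeE ?invr_eq0 ?expf_neq0 // ordV ?expf_neq0 // ordX.
    rewrite vgeB ?tw // -[ord w z]add0r vgeM ?tw //; by rewrite vgeE // ou.
  rewrite artin_schreier_prod => wprod.
  have [[c wc]|no] := pselect (exists c : F, vge w 1 (u - i_ c%:P)).
    exists c; have -> : z' - i_ c%:P * z = z * (u - i_ c%:P) by rewrite /u; field.
    by rewrite vgeM // vgeE.
  exfalso; have nc c : u - i_ c%:P != 0 /\ ord w (u - i_ c%:P) <= 0.
    have h : ~~ vge w 1 (u - i_ c%:P) by apply/negP => h; apply: no; exists c.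
    have n0 := vge_gt_neq0 h; split=> //; move: h; rewrite vgeE //; lia.
  have p0 : \prod_(c : F) (u - i_ c%:P) != 0 by apply/prodf_neq0 => c _; case: (nc c).
  move: wprod; rewrite vgeE // ord_prod; last by move=> c _; case: (nc c).
  have S0 : \sum_(c : F) ord w (u - i_ c%:P) <= 0.
    by apply: sumr_le0 => c _; case: (nc c).
  by move=> S1; have := le_trans S1 S0.
- have [y0 yz] := ord_twist_high z0 high.
  have high' : - e%:Z < (q%:Z - 1) * ord w z' by rewrite zz'.
  have [y'0 yz'] := ord_twist_high z'0 high'.
  have [||c wc] := IH (ctwist i_ z) (ctwist i_ z') _ y0 (torsion_twist tz) y'0 (torsion_twist tz').
  + have := torsion_bottom y0 (torsion_twist tz); rewrite yz mulrBr => bot.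
    have p : 0 < (q%:Z - 1) * e%:Z by rewrite mulr_gt0 //; lia.
    move: zn high bot p; move: ((q%:Z - 1) * ord w z) ((q%:Z - 1) * e%:Z) => A B'.
    by lia.
  + by rewrite yz yz' ?zz'.
  exists c; set h := z' - _.
  have th : torsion h by apply: torsionB => //; exact: torsion_const.
  have [->|h0] := eqVneq h 0; first exact: vge0.
  have hz : ord w z <= ord w h.
    rewrite -vgeE // vgeB //; first by rewrite vgeE // zz'.
    by rewrite -[ord w z]add0r vgeM ?(above_infty_const_ge0 wI) // vgeE.
  (* If h had the order of z, C_T h would have order exactly ord(z) - e, whereas [wc] gives at least
     one more. *)
  rewrite vgeE // lezD1 lt_neqAle hz andbT; apply/eqP => ohz.
  have highh : - e%:Z < (q%:Z - 1) * ord w h by rewrite -ohz.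
  have [k0 kh] := ord_twist_high h0 highh.
  move: wc; have -> : ctwist i_ z' - i_ c%:P * ctwist i_ z = ctwist i_ h.
    by rewrite /h -[in RHS]mulNr -rmorphN -polyCN ctwistD ctwistC polyCN rmorphN mulNr.
  by rewrite vgeE // kh yz ohz; lia.
Qed.

(** Two points of the largest order agree to first order up to a constant; the corrected difference
    is a torsion point of still larger order, hence 0. *)
Lemma torsion_top : exists lam, [/\ lam != 0, torsion lam &
  forall z, z != 0 -> torsion z -> ord w z < ord w lam \/ exists c : F, z = i_ c%:P * lam].
Proof.
have [rs [us srs rsP _ _]] := torsion_roots HP Ksplit.
have mem z' : z' != 0 -> torsion z' -> z' \in rem 0 rs.
  by move=> z'0 tz'; rewrite mem_rem_uniq // !inE z'0; apply/rsP.
have [l l0 tl] := exists_torsion HP Ksplit.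
have [|x xrs xmax] := @exists_max _ (rem 0%R rs) (ord w).
  by case: (rem _ _) (mem _ l0 tl).
have [x0 tx] : x != 0 /\ torsion x.
  by move: xrs; rewrite mem_rem_uniq // !inE => /andP[? /rsP].
exists x; split=> // z z0 tz; have := xmax _ (mem _ z0 tz).
rewrite le_eqVlt => /predU1P[zx|]; [right | by left].
have [c wc] := torsion_ratio x0 tx z0 tz zx; exists c.
apply/eqP; rewrite -subr_eq0; apply/negPn/negP => h0.
have th : torsion (z - i_ c%:P * x) by apply: torsionB => //; exact: torsion_const.
by move: wc; rewrite vgeE // lezD1 ltNge => /negP; apply; exact: xmax (mem _ h0 th).
Qed.

End Infinity.

End CharAt.

(** * Even characters at infinity *)

Section CharAtInfinity.
Variables (F : finFieldType) (P : {poly F}) (HP : monic_irreducible_poly P).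
Variable (K : splittingFieldType {fraction {poly F}}).
Hypothesis Ksplit : splittingFieldFor 1 (carlitz_over K P) {:K}.
Notation q := #|F|.
Notation i_ := (iota_K K).
Notation d := (size P).-1.
Notation C := (cop (iota_K K)).
Notation torsion z := (C P z = 0).
Variable chi : gal_of {:K} -> algC.
Hypothesis chiM : forall s t : gal_of {:K}, chi (s * t)%g = chi s * chi t.
Hypothesis chi_neq0 : forall s, chi s != 0.
Notation E := (char_field chi).
Notation M := (subvs_of (char_field chi)).

Hypothesis chi_even : forall (s : gal_of {:K}) (c : F), c != 0 ->
  (forall z, torsion z -> s z = i_ c%:P * z) -> chi s = 1.

Section Density.
Variables (w : place_of K) (e : nat) (wI : lies_above w (Infty F) e).

(* [u^j] for [u = lam^-(q-1)], with [lam] the torsion point of largest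
   valuation, dominates its conjugates, so Tr(u^j x) / Tr(u^j) tends to [x]. *)
Lemma infty_dense (x : K) (n : nat) : x \in E -> exists2 y, y \in 1%VS & vge w n%:Z (y - x).
Proof.
move=> xE; have [lam [lam0 tlam top]] := torsion_top HP Ksplit wI.
pose G := ('Gal({:K} / 1))%g.
(* The automorphisms acting on the torsion through constants, on which chi is 1 by [chi_even]. *)
pose S0 := [set s : gal_of {:K} | `[< exists c : F, s lam = i_ c%:P * lam >]].
have S0P s : s \in S0 -> exists2 c : F, c != 0 & forall z, torsion z -> s z = i_ c%:P * z.
  rewrite inE => /asboolP[c cE]; exists c.
    apply/eqP => c0; move: cE; rewrite c0 rmorph0 mul0r => /eqP.
    by rewrite fmorph_eq0 (negPf lam0).
  move=> z /(torsion_gen HP Ksplit lam0 tlam)[b ->].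
  by rewrite gal_cop cE -!copC -!copM mulrC.
have S0group : group_set S0.
  apply/group_setP; split.
    by rewrite inE; apply/asboolP; exists 1; rewrite gal_id rmorph1 mul1r.
  move=> s t /S0P[c _ sE] /S0P[c' _ tE]; rewrite inE; apply/asboolP.
  exists (c * c'); rewrite galM ?memvf // (sE _ tlam).
  have -> : t (i_ c%:P * lam) = i_ c%:P * t lam by rewrite rmorphM /= gal_iota.
  by rewrite (tE _ tlam) polyCM (rmorphM i_) mulrA.
(* |S0| divides |G| = q^d - 1, which is -1 in K. *)
have mE : (#|S0|%:R : K) != 0.
  have := cardSg (_ : Group S0group \subset [group of G]).
  move=> /(_ _)/dvdnP[|k kE]; first by apply/fintype.subsetP => s _; exact: gal_all.
  have [GE _] := card_G HP Ksplit lam0 tlam.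
  apply/eqP => m0; have : ((q ^ d).-1%:R : K) = 0 by rewrite -GE kE natrM m0 mulr0.
  have qd : ((q ^ d).-1%:R : K) + 1 = 0.
    rewrite natr1 prednK ?expn_gt0 ?finField_card_gt0 //.
    have : (0 < d)%N by have := monic_irreducible_size HP; case: (size P) => [|[]].
    by case: (d) => // k' _; rewrite expnS natrM (iota_card K) mul0r.
  by move=> h; move: qd; rewrite h add0r => /eqP; rewrite oner_eq0.
have om : ord w (#|S0|%:R) = 0.
  have [p pr pF] := finPcharP F.
  have -> : (#|S0|%:R : K) = i_ (#|S0|%:R : F)%:P by rewrite polyC_natr rmorph_nat.
  apply: (above_infty_const wI); apply: contraNneq mE => h.
  by rewrite -(rmorph_nat i_) -polyC_natr h rmorph0.
(* The exponent q - 1 makes u invariant under [S0], since c^(q-1) = 1. *)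
pose u := (lam ^+ q.-1)^-1.
have u0 : u != 0 by rewrite invr_eq0 expf_neq0.
have q0 : (0 < q.-1)%N by have := finField_card_gt1 F; lia.
have su0 s : s \in S0 -> s u = u.
  move=> /S0P[c c0 sE]; rewrite /u fmorphV rmorphXn /= sE // exprMn.
  have c1 : c ^+ q.-1 = 1.
    by apply: (mulfI c0); rewrite -exprS prednK ?finField_card_gt0 // expf_card mulr1.
  pose fC : {rmorphism F -> K} := (i_ \o polyC)%FUN.
  have -> : i_ c%:P ^+ q.-1 = fC (c ^+ q.-1) by rewrite rmorphXn.
  by rewrite c1 rmorph1 mul1r.
have su1 s : s \notin S0 -> ord w u + 1 <= ord w (s u).
  move=> sS; have sl0 : s lam != 0 by rewrite fmorph_eq0.
  have [lt|[c cE]] := top _ sl0 (gal_torsion s tlam); last first.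
    by case/negP: sS; rewrite inE; apply/asboolP; exists c.
  rewrite /u fmorphV rmorphXn !ordV ?expf_neq0 // !ordX // lezD1 ltrN2.
  by rewrite ltr_pMn2r.
pose B := - \sum_(s : gal_of {:K}) `|ord w (s x - x)|.
have wB (s : gal_of {:K}) : vge w B (s x - x).
  have [->|n0] := eqVneq (s x - x) 0; first exact: vge0.
  rewrite vgeE // lerNl; apply: le_trans (ler_norm _) _; rewrite normrN.
  rewrite (bigD1 s) //= lerDl; exact: sumr_ge0.
(* Each conjugate outside [S0] gains at least j over u^j; this has to exceed n together with the
   possible loss [B]. *)
have [j jE] : exists j, j = (n + absz B).+1 by eexists.
have j0 : (0 < j)%N by rewrite jE.
have TrE (a : K) : galTrace 1 {:K} a = \sum_(s in S0) s a + \sum_(s | s \notin S0) s a.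
  rewrite /galTrace (eq_bigl predT) => [|s]; last by rewrite gal_all.
  by rewrite (bigID (mem S0)).
have Tr1 (a : K) : galTrace 1 {:K} a \in 1%VS.
  by apply: mem_galTrace; [exact: (galois_K HP Ksplit) | exact: memvf].
have wu s : s \notin S0 -> vge w ((ord w u + 1) *+ j) (s u ^+ j).
  move=> sS; apply: vgeX; rewrite vgeE ?fmorph_eq0 //; exact: su1.
have tuE : galTrace 1 {:K} (u ^+ j) = #|S0|%:R * u ^+ j + \sum_(s | s \notin S0) s u ^+ j.
  rewrite TrE; congr (_ + _); last by apply: eq_bigr => s _; rewrite rmorphXn.
  rewrite (eq_bigr (fun=> u ^+ j)) => [|s sS]; last by rewrite rmorphXn /= su0.
  by rewrite sumr_const mulr_natl.
have [tu0 otu] : galTrace 1 {:K} (u ^+ j) != 0 /\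
    ord w (galTrace 1 {:K} (u ^+ j)) = ord w u *+ j.
  rewrite tuE; have [||h0 ->] := @ord_dominant _ _ w (#|S0|%:R * u ^+ j) (\sum_(s | s \notin S0) s u ^+ j).
  - by rewrite mulf_neq0 ?expf_neq0.
  - move=> n0; rewrite ordM ?expf_neq0 // om add0r ordX //.
    have := vge_sum (v := w) (P := fun s => s \notin S0) (index_enum _) wu.
    rewrite vgeE //; apply: lt_le_trans; rewrite ltr_pMn2r // ltrDl //.
  - by split=> //; rewrite ordM ?expf_neq0 // om add0r ordX.
exists (galTrace 1 {:K} (u ^+ j * x) / galTrace 1 {:K} (u ^+ j)).
  by rewrite rpredM ?rpredV.
have -> : galTrace 1 {:K} (u ^+ j * x) / galTrace 1 {:K} (u ^+ j) - x =
   (\sum_(s | s \notin S0) s u ^+ j * (s x - x)) / galTrace 1 {:K} (u ^+ j).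
  apply: (mulIf tu0); rewrite mulrBl !divfK // TrE tuE mulrDr opprD addrACA.
  rewrite (eq_bigr (fun=> u ^+ j * x)) => [|s sS]; last first.
    have [c c0 sE] := S0P _ sS; rewrite rmorphM rmorphXn /= su0 //.
    by congr (_ * _); apply: ((char_fieldP chi x).1 xE); exact: chi_even c0 sE.
  rewrite sumr_const.
  have -> : u ^+ j * x *+ #|S0| - x * (#|S0|%:R * u ^+ j) = 0.
    rewrite -[u ^+ j * x *+ #|S0|]mulr_natl; move: (#|S0|%:R : K) (u ^+ j) => a b; ring.
  rewrite add0r.
  rewrite mulr_sumr -sumrB; apply: eq_bigr => s _; rewrite rmorphM rmorphXn /= mulrBr.
  by rewrite [x * _]mulrC.
apply: (@vgeW _ _ _ _ ((ord w u + 1) *+ j + B - ord w u *+ j)).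
  by rewrite mulrnDl addrAC [_ *+ j + 1 *+ j]addrC addrK natz jE; lia.
apply: vgeM; last by rewrite vgeE ?invr_eq0 // (ordV w tu0) otu.
by apply: vge_sum => s sS; rewrite vgeM // wu.
Qed.


Lemma base_ord_dvd y : y \in 1%VS -> y != 0 -> exists m : int, ord w y = e%:Z * m.
Proof.
have [_ we] := lies_above_ord wI.
move=> /iota_frac[f [h [h0 ->]]] y0.
have f0 : f != 0 by apply: contraNneq y0 => ->; rewrite rmorph0 mul0r.
exists (place_val (Infty F) f - place_val (Infty F) h).
by rewrite ordM ?invr_eq0 ?iota_eq0 // ordV ?iota_eq0 // !we // mulrBr.
Qed.

(** An element of k closer to x than the order of x has the same order as x. *)
Lemma infty_ord_dvd x : x \in E -> x != 0 -> exists m : int, ord w x = e%:Z * m.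
Proof.
move=> xE x0; have [y y1 wy] := infty_dense (absz (ord w x)).+1 xE.
have [y0 oy] : y != 0 /\ ord w y = ord w x.
  rewrite -(subrK x y) addrC; apply: ord_dominant => // n0; move: wy; rewrite vgeE //.
  by apply: lt_le_trans; apply: le_lt_trans (lez_abs _) _; rewrite ltz_nat.
by rewrite -oy; exact: base_ord_dvd.
Qed.

(** x is close to an element of k, which is close to a constant c by [above_infty_residue], and c^q
    = c. *)
Lemma infty_congr x : x \in E -> vge w 0 x -> vge w e%:Z (x - x ^+ q).
Proof.
move=> xE wx; have [y y1 wy] := infty_dense e xE.
have [c wc] : exists c : F, vge w 1 (y - i_ c%:P).
  apply: (above_infty_residue wI) => //; rewrite -(subrK x y) vgeD //.
  by apply: vgeW wy.
(* Orders on k are multiples of e, so a positive one is at least e. *)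
have {}wc : vge w e%:Z (y - i_ c%:P).
  have [->|n0] := eqVneq (y - i_ c%:P) 0; first exact: vge0.
  have [|m om] := base_ord_dvd _ n0; first by rewrite rpredB // iota_in1.
  have [e0 _] := wI; move: wc; rewrite !vgeE // om => h.
  rewrite -[X in X <= _]mulr1 ler_pM2l ?ltz_nat //.
  by move: h; case: (m) => [[|k]|k] //; [rewrite mulr0 | rewrite NegzE mulrN; lia].
pose fC : {rmorphism F -> K} := (i_ \o polyC)%FUN.
pose z := x - i_ c%:P.
have wz : vge w e%:Z z.
  have -> : z = (y - i_ c%:P) - (y - x) by rewrite /z; ring.
  exact: vgeB.
have -> : x - x ^+ q = z - z ^+ q.
  have xE' : x = z + fC c by rewrite /z /fC /= subrK.
  have cq : fC c ^+ q = fC c by rewrite -rmorphXn expf_card.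
  rewrite [in LHS]xE' (exprDcard fC) cq; ring.
apply: vgeB => //; apply: vgeW (vgeX q wz).
rewrite -(prednK (finField_card_gt0 F)) mulrS lerDl; exact: mulrn_wge0.
Qed.

End Density.

(** By [infty_congr] the identity is a Frobenius, and every other one has the same value by
    [frobenius_unique]. *)
Lemma char_at_infty : char_at chi (Infty F) = 1.
Proof.
have X1 : `|place_val (Infty F) 'X|%N = 1%N.
  by rewrite /place_val /poly_deg size_polyX.
rewrite -(chi1 chiM chi_neq0); apply: (char_at_eq (s0 := 1%g)).
- move=> w e wI; have [w' [g [g0 w'I ww]]] := extend_above wI.
  have [x wx] := place_normalised w.
  have x0 : x != 0 by apply: contra_eq_neq wx => ->; rewrite val_fun0.
  have ox : ord w x = 1 by rewrite /ord wx.
  have [||m om] := @infty_ord_dvd _ _ w'I (vsval x); first exact: subvsP.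
    by rewrite vsval_eq0.
  move: om; rewrite ww // ox PoszM -mulrA => /mulfI; rewrite gt_eqF ?ltz_nat //.
  move=> /(_ isT) /eqP; rewrite eq_sym => /eqP em.
  have : (e %| 1)%N by have := dvdz_mulr m (dvdzz e%:Z); rewrite em.
  by rewrite dvdn1 => /eqP.
- split; first exact: gal_all.
  move=> w e wI; have [w' [g [g0 w'I ww]]] := extend_above wI.
  apply/(frobenius_transfer HP Ksplit _ _ g0 ww) => x xE wx; rewrite gal_id expn1.
  have := infty_congr w'I xE wx; apply: vgeW; rewrite lez_nat.
  by case: wI => e0 _; rewrite leq_pmulr.
- move=> s [_ sF]; have [w' [e' w'I]] := exists_place_infty K.
  have [|w [g [e [g0 wI geE ww]]]] := restrict_above E w'I.
    by exists 'X; rewrite ?polyX_eq0.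
  have ge : (g <= e')%N by case: wI => e0 _; rewrite geE leq_pmulr.
  have iX0 : i_ 'X != 0 by rewrite iota_eq0 polyX_eq0.
  have [x wx] := place_normalised w.
  have x0 : x != 0 by apply: contra_eq_neq wx => ->; rewrite val_fun0.
  have ox : ord w x = 1 by rewrite /ord wx.
  have [||m om] := @infty_ord_dvd _ _ w'I (vsval x); first exact: subvsP.
    by rewrite vsval_eq0.
  have e'g : e' = g.
    apply/eqP; rewrite eqn_leq ge andbT; move: om; rewrite ww // ox mulr1 => om.
    by apply: dvdn_leq => //; have := dvdz_mulr m (dvdzz e'%:Z); rewrite -om.
  (* The Galois-invariant uniformiser is 1/T, of order e' = g. *)
  apply: (@frobenius_unique _ _ HP _ Ksplit _ chiM chi_neq0 w' g (i_ 'X)^-1 (q ^ 1)) => //.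
  + by rewrite expn1 finField_card_gt0.
  + by rewrite rpredV; exact: (subvP (sub1v E)) (iota_in1 K 'X).
  + by rewrite invr_eq0.
  + by move=> u; rewrite fmorphV /= gal_iota.
  + by rewrite ordV // (above_infty_X w'I) opprK e'g.
  + by apply/(frobenius_transfer HP Ksplit _ _ g0 ww); exact: sF wI.
  + by move=> y yE wy; rewrite gal_id expn1 -e'g; exact: infty_congr.
Qed.

End CharAtInfinity.

(** * The Euler product *)

Lemma irreducible_factor (k : fieldType) (f : {poly k}) : (1 < size f)%N ->
  exists2 g, irreducible_poly g & g \is monic /\ g %| f.
Proof.
have [n] := ubnP (size f); elim: n f => // n IH f fn f1.
have f0 : f != 0 by rewrite -size_poly_gt0 ltnW.
have [irr|red] := pselect (irreducible_poly f).
  have l0 : (lead_coef f)^-1 != 0 by rewrite invr_eq0 lead_coef_eq0.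
  exists ((lead_coef f)^-1 *: f); last first.
    by rewrite monicE lead_coefZ mulVf ?lead_coef_eq0 // dvdpZl.
  split; first by rewrite size_scale.
  move=> g g1 gf; have gf' : g %| f by rewrite dvdpZr in gf.
  by apply: eqp_trans (irr.2 g g1 gf') _; rewrite eqp_sym eqp_scale.
have [g [g1 gf ngf]] : exists g : {poly k}, [/\ size g != 1%N, g %| f & ~~ (g %= f)].
  apply: contrapT => no; apply: red; split=> // g g1 gf; apply/negPn/negP => ngf.
  by apply: no; exists g.
have gs : (size g < size f)%N by rewrite ltn_neqAle dvdp_leq // andbT dvdp_size_eqp.
have g0 : g != 0 by apply: contraNneq f0 => g0; move: gf; rewrite g0 dvd0p.
have [||h hirr [hm hg]] := IH g.
- by rewrite -ltnS; apply: leq_trans fn; rewrite ltnS.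
- by rewrite ltn_neqAle eq_sym g1 size_poly_gt0.
by exists h => //; split=> //; exact: dvdp_trans gf.
Qed.

Section TruncatedCongruence.
Variables (R : comNzRingType) (N : nat).

Definition tcongr (f g : {poly R}) := forall n, (n <= N)%N -> f`_n = g`_n.

Lemma tcongr_refl f : tcongr f f. Proof. by []. Qed.
Lemma tcongr_sym f g : tcongr f g -> tcongr g f.
Proof. by move=> h n nN; rewrite h. Qed.
Lemma tcongr_trans g f h : tcongr f g -> tcongr g h -> tcongr f h.
Proof. by move=> a b n nN; rewrite a ?b. Qed.
Lemma tcongrM f f' g g' : tcongr f f' -> tcongr g g' -> tcongr (f * g) (f' * g').
Proof.
move=> ff gg n nN; rewrite !coefM; apply: eq_bigr => i _.
by rewrite ff ?gg // ?(leq_trans (leq_subr _ _) nN) // (leq_trans _ nN) // -ltnS.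
Qed.
Lemma tcongr_prod1 I (r : seq I) (P : pred I) (f : I -> {poly R}) :
  (forall i, P i -> tcongr (f i) 1) -> tcongr (\prod_(i <- r | P i) f i) 1.
Proof.
move=> h; elim/big_rec: _ => [//|i x Pi hx].
by rewrite -[1]mulr1; apply: tcongrM => //; exact: h.
Qed.

Lemma geometric_tcongr (c : R) d : (0 < d)%N ->
  tcongr ((1 - c *: 'X^d) * \sum_(j < N.+1) (c *: 'X^d) ^+ j) 1.
Proof.
move=> d0; set x := c *: 'X^d.
have -> : (1 - x) * \sum_(j < N.+1) x ^+ j = 1 - x ^+ N.+1.
  by have := subrX1 x N.+1; rewrite -[X in X = _]opprB -[x - 1]opprB mulNr => /oppr_inj.
move=> n nN; rewrite coefB exprZn -exprM coefZ coefXn.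
have : (n < d * N.+1)%N by apply: (@leq_trans N.+1) => //; rewrite leq_pmull.
by rewrite ltn_neqAle => /andP[/negPf-> _]; rewrite mulr0 subr0.
Qed.

End TruncatedCongruence.

(** * Euler products by sieving *)

Section Sieve.
Variables (F : finFieldType) (R : comNzRingType) (X : {poly F} -> R).
Hypothesis X1 : X 1 = 1.
Hypothesis XM : forall a b, X (a * b) = X a * X b.

Definition monic_deg n (a : {poly F}) := (a \is monic) && (size a == n.+1).

Definition monic_sum n := \sum_(a : {poly_n.+1 F} | monic_deg n (val a)) X (val a).

Definition sifted_sum (s : seq {poly F}) n :=
  \sum_(a : {poly_n.+1 F} | monic_deg n (val a) && all (fun Q => ~~ (Q %| val a)) s)
    X (val a).

Lemma sifted_sum_nil n : sifted_sum [::] n = monic_sum n.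
Proof. by apply: eq_bigl => a; rewrite andbT. Qed.

Lemma val_npolyp n (a : {poly F}) : (size a <= n)%N -> val (npolyp n a) = a.
Proof. by move=> an; exact: npolypK. Qed.

(** The monic a of degree n divisible by Q are the Q b with b monic of degree n - deg Q. The primes
    in [s] differ from Q, so they divide Q b only if they divide b. *)
Lemma sifted_sum_cons s (Q : {poly F}) n : monic_irreducible_poly Q ->
  (forall Q', Q' \in s -> monic_irreducible_poly Q' /\ Q' != Q) ->
  sifted_sum (Q :: s) n = sifted_sum s n -
   (if ((size Q).-1 <= n)%N then X Q * sifted_sum s (n - (size Q).-1) else 0).
Proof.
move=> HQ Hs; have Q1 := monic_irreducible_size HQ; have Q0 := monic_irreducible_neq0 HQ.
have Qm := monic_irreducible_monic HQ.
have ndvd (Q' b : {poly F}) : Q' \in s -> (Q' %| Q * b) = (Q' %| b).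
  move=> /Hs[HQ' nQ]; rewrite (dvdp_irreducibleM HQ').
  have -> // : (Q' %| Q) = false.
  apply/negP => Q'Q; case/negP: nQ; rewrite -eqp_monic ?(monic_irreducible_monic HQ') //.
  case: HQ => [[_ irr] _]; apply: irr => //.
  by have := monic_irreducible_size HQ'; case: (size Q') => [|[]].
have E : sifted_sum s n = \sum_(a : {poly_n.+1 F} | [&& monic_deg n (val a),
       all (fun Q => ~~ (Q %| val a)) s & Q %| val a]) X (val a) + sifted_sum (Q :: s) n.
  rewrite {1}/sifted_sum (bigID (fun a : {poly_n.+1 F} => Q %| val a)) /=; congr (_ + _).
    by apply: eq_bigl => a; rewrite andbA.
  by apply: eq_bigl => a /=; case: (monic_deg _ _) => //=; rewrite andbC.
apply/eqP; rewrite eq_sym subr_eq {}E addrC; apply/eqP; congr (_ + _).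
case: leqP => [dn|nd]; last first.
  rewrite big_pred0 // => a; apply/negP => /and3P[/andP[am /eqP sa] _ Qa].
  have := dvdp_leq (monic_neq0 am) Qa; rewrite sa; move: nd.
  by case: (size Q) => [|k] //= nk; rewrite ltnS leqNgt nk.
set m := (n - _)%N; rewrite /sifted_sum mulr_sumr.
have sizeM (b : {poly F}) : b != 0 -> size (Q * b)%R = ((size Q).-1 + size b)%N.
  by move=> b0; rewrite size_mul // -{1}(prednK (ltnW Q1)) addSn.
rewrite (reindex_onto (fun b : {poly_m.+1 F} => npolyp n.+1 (Q * val b))
   (fun a : {poly_n.+1 F} => npolyp m.+1 (val a %/ Q))); last first.
  move=> a /and3P[/andP[am /eqP sa] _ Qa]; apply: val_inj.
  have sq : (size (val a %/ Q)%R <= m.+1)%N by rewrite size_divp // sa /m subSn.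
  by rewrite /= val_npolyp mulrC // (val_npolyp sq) divpK // sa.
have sz (b : {poly_m.+1 F}) : (size (Q * val b)%R <= n.+1)%N.
  have [b0|b0] := eqVneq (val b) 0; first by rewrite b0 mulr0 size_poly0.
  rewrite sizeM // -(subnKC dn) -addnS leq_add2l; exact: size_npoly.
apply: eq_big => [b|b _]; last by rewrite val_npolyp // XM.
rewrite val_npolyp // mulKp // dvdp_mulr // andbT.
have -> : npolyp m.+1 (val b) == b.
  by apply/eqP/val_inj; rewrite val_npolyp // size_npoly.
rewrite andbT; congr (_ && _); last by apply: eq_in_all => Q' Q's; rewrite ndvd.
rewrite /monic_deg monicMl //; have [b0|b0] := eqVneq (val b) 0.
  by rewrite b0 mulr0 !size_poly0.
by congr (_ && _); rewrite sizeM // -(subnKC dn) -addnS eqn_add2l.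
Qed.

Variable N : nat.

Let G s : {poly R} := \poly_(n < N.+1) sifted_sum s n.

Lemma sieve_product s : uniq s -> (forall Q, Q \in s -> monic_irreducible_poly Q) ->
  tcongr N ((\prod_(Q <- s) (1 - X Q *: 'X^((size Q).-1))) * G [::]) (G s).
Proof.
elim: s => [|Q s IH] /= => [_ _|/andP[Qs us] Hs]; first by rewrite big_nil mul1r.
have HQ : monic_irreducible_poly Q by apply: Hs; rewrite mem_head.
have Hs' Q' : Q' \in s -> monic_irreducible_poly Q'.
  by move=> Q's; apply: Hs; rewrite inE Q's orbT.
have {}IH := IH us Hs'.
rewrite big_cons -mulrA; apply: (tcongr_trans (tcongrM (@tcongr_refl _ _ _) IH)).
move=> n nN; rewrite mulrBl mul1r coefB -scalerAl coefZ coefXnM !coef_poly !ltnS nN.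
rewrite (sifted_sum_cons _ HQ).
  case: ltnP => nd; first by rewrite mulr0.
  by rewrite (leq_trans (leq_subr _ _) nN).
move=> Q' Q's; split; first exact: Hs'.
by apply: contraNneq Qs => <-.
Qed.

(** A monic polynomial of degree between 1 and N has a prime factor of degree at most N, so only a =
    1 survives. *)
Lemma sieve_complete s : (forall Q : {poly F}, monic_irreducible_poly Q -> (size Q <= N.+1)%N -> Q \in s) ->
  (forall Q, Q \in s -> monic_irreducible_poly Q) -> tcongr N (G s) 1.
Proof.
move=> cs Hs n nN; rewrite coef_poly ltnS nN coef1 /sifted_sum; case: n nN => [|n] nN /=.
  rewrite (big_pred1 (npolyp 1 1)) => [|a].
    by rewrite val_npolyp ?size_poly1 // X1.
  apply/andP/eqP => [[/andP[am /eqP sa] _]|->].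
    apply: val_inj; rewrite val_npolyp ?size_poly1 //.
    have /size_poly1P[c c0 aE] : size (val a) == 1%N by rewrite sa.
    by move: am; rewrite monicE aE lead_coefC => /eqP c1; rewrite -[LHS]/(val a) aE c1.
  rewrite /monic_deg val_npolyp ?size_poly1 // monic1; split=> //.
  apply/allP => Q /Hs HQ; rewrite dvdp1.
  by have := monic_irreducible_size HQ; case: (size Q) => [|[]].
rewrite big_pred0 // => a; apply/negP => /andP[/andP[am /eqP sa] /allP ndv].
have [|Q irr [Qm Qa]] := @irreducible_factor _ (val a); first by rewrite sa.
have : Q \in s.
  apply: cs => //; apply: leq_trans (dvdp_leq (monic_neq0 am) Qa) _.
  by rewrite sa ltnS.
by move=> /ndv; rewrite Qa.
Qed.

(** Modulo X^(N+1) both sides are inverse to the product of the Euler denominators: the left one by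
    the geometric series, the right one by the completed sieve. *)
Lemma euler_product (s : seq {poly F}) : uniq s ->
  (forall Q : {poly F}, monic_irreducible_poly Q -> (size Q <= N.+1)%N -> Q \in s) ->
  (forall Q, Q \in s -> monic_irreducible_poly Q) ->
  tcongr N (\prod_(Q <- s) \sum_(j < N.+1) (X Q *: 'X^((size Q).-1)) ^+ j)
    (\poly_(n < N.+1) monic_sum n).
Proof.
move=> us cs Hs.
have GE : G [::] = \poly_(n < N.+1) monic_sum n.
  by apply/polyP => n; rewrite !coef_poly sifted_sum_nil.
rewrite -GE; set A := \prod_(Q <- s) _; pose B := \prod_(Q <- s) (1 - X Q *: 'X^((size Q).-1)).
have BA : tcongr N (B * A) 1.
  rewrite /B /A -big_split /= big_seq; apply: tcongr_prod1 => Q /Hs HQ.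
  apply: geometric_tcongr; by have := monic_irreducible_size HQ; case: (size Q) => [|[]].
have BG : tcongr N (B * G [::]) 1.
  exact: tcongr_trans (sieve_product us Hs) (sieve_complete cs Hs).
rewrite -[A]mulr1; apply: (tcongr_trans (tcongrM (@tcongr_refl _ _ A) (tcongr_sym BG))).
rewrite mulrA [A * B]mulrC -[G _ in X in tcongr _ _ X]mul1r.
exact: tcongrM.
Qed.

End Sieve.

Section ArtinCoefficients.
Variables (F : finFieldType) (K : splittingFieldType {fraction {poly F}}).
Variables (chi : gal_of {:K} -> algC) (X : {poly F} -> algC).
Hypothesis X1 : X 1 = 1.
Hypothesis XM : forall a b, X (a * b) = X a * X b.
Hypothesis chi_fin : forall Q, monic_irreducible_poly Q -> char_at chi (Fin Q) = X Q.
Hypothesis chi_infty : char_at chi (Infty F) = 1.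

Lemma artin_coefE N : artin_coef chi N = \sum_(n < N.+1) monic_sum X n.
Proof.
pose pr (Q : {poly_N.+1 F}) := (val Q \is monic) && `[< irreducible_poly (val Q) >].
pose s := [seq val Q | Q : {poly_N.+1 F} <- enum pr].
have us : uniq s by rewrite map_inj_uniq ?enum_uniq //; exact: val_inj.
have Hs (Q : {poly F}) : Q \in s -> monic_irreducible_poly Q.
  by move=> /mapP[a]; rewrite mem_enum => /andP[am /asboolP irr] ->.
have cs (Q : {poly F}) : monic_irreducible_poly Q -> (size Q <= N.+1)%N -> Q \in s.
  move=> [irr Qm] sQ; rewrite -(val_npolyp sQ); apply/map_f; rewrite mem_enum.
  by rewrite /pr unfold_in val_npolyp // Qm; apply/asboolP.
rewrite /artin_coef.
have -> : \prod_(Q : {poly_N.+1 F} | pr Q) euler_factor chi N (Fin (val Q)) =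
    \prod_(Q <- s) \sum_(j < N.+1) (X Q *: 'X^((size Q).-1)) ^+ j.
  rewrite big_map -big_enum /= big_seq [RHS]big_seq; apply: eq_bigr => Q.
  rewrite mem_enum => /andP[Qm /asboolP irr]; rewrite /euler_factor chi_fin //.
have := euler_product X1 XM us cs Hs; set A := \prod_(Q <- s) _ => AE.
rewrite coefM (reindex_inj rev_ord_inj) /=; apply: eq_bigr => n _.
rewrite subSS subKn -1?ltnS // AE -1?ltnS // coef_poly ltn_ord.
rewrite /euler_factor chi_infty /= scale1r coef_sum.
rewrite (bigD1 (rev_ord n)) //= ?expr1 coefXn subSS eqxx big1 ?addr0 ?mul1r //.
move=> j jn; rewrite ?expr1 coefXn.
by rewrite (_ : (_ == _) = false) //; apply/negP => /eqP h; case/negP: jn; apply/eqP/val_inj.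
Qed.

End ArtinCoefficients.

(** * Power sums *)

Section ResidueClasses.
Variables (F : finFieldType) (P : {poly F}) (HP : monic_irreducible_poly P).
Notation A_P := {poly %/ P with HP}.
Notation d := (size P).-1.
Notation red := (residue_class HP).

Lemma val_residue_class (a : {poly F}) : (size a <= d)%N -> val (red a) = a.
Proof.
move=> ad; apply: in_qpoly_small; rewrite mk_monicE //.
by apply: leq_ltn_trans ad _; rewrite ltn_predL size_poly_gt0 monic_irreducible_neq0.
Qed.

Lemma residue_class_neq0 (a : {poly F}) : a != 0 -> (size a <= d)%N -> red a != 0.
Proof.
move=> a0 ad; apply: contraNneq a0 => ra0; rewrite -(val_residue_class ad) ra0 //.
Qed.

Lemma monic_sum_residue (R : comNzRingType) (f : A_P -> R) n : (n < d)%N ->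
  monic_sum (f \o red) n = \sum_(x : A_P | monic_deg n (val x)) f x.
Proof.
move=> nd; rewrite /monic_sum [RHS](reindex_onto (fun a : {poly_n.+1 F} => red (val a))
   (fun x => npolyp n.+1 (val x))); last first.
  by move=> x /andP[_ /eqP sx]; rewrite val_npolyp ?sx // residue_classK.
apply: eq_bigl => a; have sa : (size (val a) <= d)%N by rewrite (leq_trans (size_npoly a)).
rewrite val_residue_class //.
have -> : npolyp n.+1 (val a) == a by apply/eqP/val_inj; rewrite val_npolyp // size_npoly.
by rewrite andbT.
Qed.

Lemma monic_degD n (a b : {poly F}) : (size b <= n)%N ->
  monic_deg n (a + b) = monic_deg n a.
Proof.
have aux (c e : {poly F}) : (size e <= n)%N -> monic_deg n c -> monic_deg n (c + e).
  move=> en /andP[cm /eqP sc]; have ec : (size e < size c)%N by rewrite sc ltnS.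
  by rewrite /monic_deg monicE lead_coefDl // -monicE cm size_polyDl // sc eqxx.
move=> bn; apply/idP/idP => [h|]; last exact: aux.
by rewrite -(addrK b a); apply: aux => //; rewrite size_polyN.
Qed.

Section CharacterSum.
Variables (R : idomainType) (f : A_P -> R).
Hypothesis fM : forall x y, f (x * y) = f x * f y.
Hypothesis f0 : f 0 = 0.
Hypothesis fC : forall c : F, c != 0 -> f (red c%:P) = 1.
Variables (g : A_P) (g0 : g != 0) (fg : f g != 1).

Lemma character_sum0 : \sum_x f x = 0.
Proof.
have E : f g * (\sum_x f x) = \sum_x f x.
  rewrite mulr_sumr [RHS](reindex_inj (mulfI g0)); apply: eq_bigr => x _.
  by rewrite fM.
apply/eqP; move/eqP: E; rewrite -subr_eq0 -[X in _ - X]mul1r -mulrBl mulf_eq0.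
by rewrite subr_eq0 (negPf fg).
Qed.

(** Adding a polynomial of degree less than d permutes the monic polynomials of degree n >= d.
    Averaging over all such shifts turns every term into a complete character sum. *)
Lemma monic_sum_large n : #|A_P|%:R != 0 :> R -> (d <= n)%N -> monic_sum (f \o red) n = 0.
Proof.
move=> A0 dn; apply: (mulfI A0); rewrite mulr0 mulr_natl -sumr_const.
have shift (x : A_P) : monic_sum (f \o red) n =
    \sum_(a : {poly_n.+1 F} | monic_deg n (val a)) f (red (val a) + x).
  rewrite /monic_sum.
  have sx : (size (val x) < n.+1)%N by rewrite ltnS (leq_trans (size_val_qpoly _)).
  have sax (a : {poly_n.+1 F}) : (size (val a + val x)%R <= n.+1)%N.
    by rewrite (leq_trans (size_polyD _ _)) // geq_max size_npoly ltnW.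
  pose h (a : {poly_n.+1 F}) := npolyp n.+1 (val a + val x).
  have hi : injective h.
    move=> a b /(congr1 val); rewrite !val_npolyp // => /addIr; exact: val_inj.
  rewrite (reindex_inj hi); apply: eq_big => [a|a _]; last first.
    by rewrite /= val_npolyp // rmorphD /=; congr (f (_ + _)); exact: residue_classK.
  by rewrite val_npolyp // monic_degD.
rewrite (eq_bigr _ (fun x _ => shift x)) exchange_big big1 // => a _.
rewrite -[RHS]character_sum0 [RHS](reindex_inj (addrI (red (val a)))) //.
Qed.

(** Nonzero classes are grouped by the leading coefficient of their representative. As [f] is 1 on
    constants, each of the q - 1 groups has the sum over monic representatives. Used with values in
    [algC] and, for the reduction, in A/P. *)
Lemma monic_sum_total : #|[pred c : F | c != 0]|%:R != 0 :> R ->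
  \sum_(n < d) monic_sum (f \o red) n = 0.
Proof.
move=> F0; have mE : \sum_(n < d) monic_sum (f \o red) n = \sum_(x : A_P | val x \is monic) f x.
  rewrite (eq_bigr _ (fun (n : 'I_d) _ => monic_sum_residue f (ltn_ord n))).
  under eq_bigr do rewrite big_mkcond.
  rewrite exchange_big [RHS]big_mkcond; apply: eq_bigr => x _ /=.
  case: ifP => xm; last by rewrite big1 // => n _; rewrite /monic_deg xm.
  have xs : (0 < size (val x))%N by rewrite size_poly_gt0 monic_neq0.
  have xd : ((size (val x)).-1 < d)%N by rewrite prednK // size_val_qpoly.
  rewrite (bigD1 (Ordinal xd)) //= /monic_deg xm prednK // eqxx big1 ?addr0 // => n.
  by move=> nx; case: eqP => // xn; case/negP: nx; apply/eqP/val_inj; rewrite /= xn.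
have : \sum_(x : A_P | x != 0) f x = 0.
  by have := character_sum0; rewrite (bigD1 0) //= f0 add0r.
have v0 (x : A_P) : (lead_coef (val x) != 0) = (x != 0).
  by rewrite lead_coef_eq0 -(inj_eq val_inj).
rewrite (partition_big (fun x : A_P => lead_coef (val x)) (fun c => c != 0)) /=; last first.
  by move=> x; rewrite v0.
rewrite (eq_bigr (fun=> \sum_(x : A_P | val x \is monic) f x)); last first.
  move=> c c0; have rc0 : red c%:P != 0.
    apply: residue_class_neq0; rewrite ?polyC_eq0 // size_polyC c0.
    by have := monic_irreducible_size HP; case: (size P) => [|[]].
  have valM (x : A_P) : val (red c%:P * x) = c *: val x.
    rewrite -[x in LHS]residue_classK -rmorphM mul_polyC val_residue_class //.
    by rewrite (leq_trans (size_scale_leq _ _)) // size_val_qpoly.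
  rewrite (reindex_inj (mulfI rc0)); apply: eq_big => [x|x _]; last first.
    by rewrite fM fC // mul1r.
  rewrite valM lead_coefZ mulf_eq0 negb_or rc0 /= monicE.
  have -> : (c * lead_coef (val x) == c) = (lead_coef (val x) == 1).
    by apply/eqP/eqP => [h|->]; [apply: (mulfI c0); rewrite h mulr1 | rewrite mulr1].
  by apply: andb_idl => /eqP h; rewrite -v0 h oner_eq0.
by rewrite sumr_const -mE -mulr_natl => /eqP; rewrite mulf_eq0 (negPf F0) => /eqP.
Qed.

End CharacterSum.
End ResidueClasses.

Section PowerSums.
Variables (F : finFieldType) (P : {poly F}) (HP : monic_irreducible_poly P).
Notation q := #|F|.
Notation A_P := {poly %/ P with HP}.
Notation d := (size P).-1.
Notation red := (residue_class HP).

Lemma residue_class_inj (a b : {poly F}) : (size a <= d)%N -> (size b <= d)%N ->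
  red a = red b -> a = b.
Proof. by move=> ad bd /(congr1 val); rewrite !val_residue_class. Qed.

(* Summing over v of degree < l gives a polynomial in the shift x of degree less
   than q^l taking the same value at the q^l classes v, hence a constant. *)
Lemma shifted_power_sum l m (x : A_P) : (l <= d)%N -> (m < q ^ l)%N ->
  \sum_(v : {poly_l F}) (x + red (val v)) ^+ m = \sum_(v : {poly_l F}) red (val v) ^+ m.
Proof.
move=> ld ml; pose H : {poly A_P} := \sum_(v : {poly_l F}) ('X + (red (val v))%:P) ^+ m.
have HE y : H.[y] = \sum_(v : {poly_l F}) (y + red (val v)) ^+ m.
  by rewrite horner_sum; apply: eq_bigr => v _; rewrite horner_exp !hornerE.
have sH : (size H <= q ^ l)%N.
  rewrite (leq_trans (size_sum _ _ _)) //; apply/bigmax_leqP => v _.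
  rewrite (leq_trans (size_poly_exp_leq _ _)) //.
  by rewrite -[red _]opprK polyCN size_XsubC mul1n.
have shift (w : {poly_l F}) : H.[red (val w)] = H.[0].
  rewrite !HE [RHS](reindex_inj (addrI w)); apply: eq_bigr => v _.
  by rewrite add0r -rmorphD.
pose rs := [seq red (val w) | w : {poly_l F}].
have urs : uniq rs.
  rewrite map_inj_uniq ?enum_uniq // => v w vw; apply: val_inj.
  by apply: residue_class_inj vw; rewrite (leq_trans (size_npoly _)).
have H0 : H - H.[0]%:P = 0.
  apply: (roots_geq_poly_eq0 (rs := rs)) => //.
  - by apply/allP => _ /mapP[w _ ->]; rewrite /root !hornerE shift subrr.
  - rewrite size_map -cardE card_npoly (leq_trans (size_polyD _ _)) // geq_max sH.
    by rewrite size_polyN (leq_trans (size_polyC_leq1 _)) // expn_gt0 finField_card_gt0.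
move/eqP: H0; rewrite subr_eq0 => /eqP HC.
rewrite -HE HC hornerC HE; apply: eq_bigr => v _; by rewrite add0r.
Qed.

(** With j = l + 1, write b = T^(l+1) + c T^l + v. By [shifted_power_sum] the sum over v does not
    depend on c. *)
Lemma monic_power_sum_small j m : (j < d)%N -> (m < q ^ j.-1)%N -> (0 < j)%N ->
  monic_sum (fun b => red b ^+ m) j = 0.
Proof.
case: j => // l jd ml _; have ld : (l <= d)%N by rewrite ltnW // ltnW.
pose h (cv : F * {poly_l F}) : {poly_l.+2 F} :=
  npolyp l.+2 ('X^(l.+1) + (cv.1 *: 'X^l + val cv.2))%R.
have sl (c : F) (v : {poly_l F}) : (size (c *: 'X^l + val v)%R <= l.+1)%N.
  rewrite (leq_trans (size_polyD _ _)) // geq_max (leq_trans (size_scale_leq _ _)) ?size_polyXn //.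
  by rewrite (leq_trans (size_npoly v)).
have mdX (c : F) (v : {poly_l F}) : monic_deg l.+1 ('X^(l.+1) + (c *: 'X^l + val v)).
  by rewrite monic_degD // /monic_deg monicXn size_polyXn eqxx.
have sh (c : F) (v : {poly_l F}) : (size ('X^(l.+1) + (c *: 'X^l + val v))%R <= l.+2)%N.
  by have /andP[_ /eqP->] := mdX c v.
rewrite /monic_sum (reindex_onto h (fun b => ((val b)`_l, npolyp l (val b)))); last first.
  move=> b /andP[bm /eqP sb]; apply/val_inj; rewrite /h /= val_npolyp.
    apply/polyP => i; rewrite coefD coefXn coefD coefZ coefXn.
    have -> : (polyn (npolyp l (polyn b)))`_i = (if (i < l)%N then (val b)`_i else 0).
      exact: coef_npolyp.
    case: (ltngtP i l) => il.
    - by rewrite ltn_eqF ?mulr0 ?add0r // ltnS ltnW.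
    - rewrite mulr0 addr0 addr0; case: eqP => [->|/eqP il1].
        by move: bm; rewrite monicE lead_coefE sb /= => /eqP->.
      by rewrite nth_default // sb ltn_neqAle eq_sym il1.
    - by rewrite il ltn_eqF // add0r mulr1 addr0.
  have := sh (val b)`_l (npolyp l (val b)); exact.
rewrite (eq_bigl predT) => [|[c v]]; last first.
  rewrite val_npolyp // mdX /= xpair_eqE; apply/andP; split.
    rewrite !coefD coefXn coefZ coefXn eqxx mulr1 ltn_eqF // add0r.
    by rewrite [X in _ + X]big_coef_npoly // addr0.
  apply/eqP/val_inj/polyP => i; rewrite /= coef_npolyp !coefD coefXn coefZ coefXn.
  case: ltnP => il; last by rewrite big_coef_npoly.
  by rewrite !ltn_eqF ?mulr0 ?add0r // ltnS ltnW.
rewrite -(pair_big predT predT (fun c v => red (val (h (c, v))) ^+ m)) /=.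
rewrite (eq_bigr (fun=> \sum_(v : {poly_l F}) red (val v) ^+ m)) => [|c _]; last first.
  rewrite -(shifted_power_sum (red ('X^(l.+1) + c *: 'X^l)) ld ml).
  by apply: eq_bigr => v _; rewrite val_npolyp // -rmorphD addrA.
have q0 : (q%:R : A_P) = 0.
  have [p pr pF] := finPcharP F.
  have pA : p \in [pchar A_P] := rmorph_pchar (red \o polyC)%FUN pF.
  have pq : (p %| q)%N.
    have := card_finField_pnat pF => /p_natP[n qE].
    rewrite qE; case: n qE => [|n] qE; last by rewrite expnS dvdn_mulr.
    by have := finField_card_gt1 F; rewrite qE.
  by apply/eqP; rewrite -(dvdn_pcharf pA).
by rewrite sumr_const -mulr_natl q0 mul0r.
Qed.

End PowerSums.

Lemma prod_sub_ffact (R : comNzRingType) n j :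
  \prod_(i <- iota 0 j) (n%:R - i%:R) = (n ^_ j)%:R :> R.
Proof.
elim: j => [|j IH]; first by rewrite big_nil.
rewrite -addn1 iotaD big_cat big_seq1 IH add0n addn1 ffactnSr /=.
have [jn|nj] := leqP j n; first by rewrite -natrB // -natrM.
by rewrite ffact_small // !mul0r.
Qed.

(** * Power sums modulo T^p - T - a *)

Section ArtinSchreier.
Variables (p : nat) (pr : prime p) (a : 'F_p).
Hypothesis a0 : a != 0.
Notation P := (artin_schreier a).

Lemma size_artin_schreier : size P = p.+1.
Proof.
rewrite /artin_schreier -addrA size_polyDl size_polyXn //.
rewrite (leq_ltn_trans (size_polyD _ _)) // !size_polyN size_polyX.
by rewrite gtn_max ltnS prime_gt1 // (leq_ltn_trans (size_polyC_leq1 _)) // ltnS prime_gt0.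
Qed.

Lemma artin_schreier_monic : P \is monic.
Proof.
rewrite /artin_schreier -addrA monicE lead_coefDl ?lead_coefXn // size_polyXn.
rewrite (leq_ltn_trans (size_polyD _ _)) // !size_polyN size_polyX.
by rewrite gtn_max ltnS prime_gt1 // (leq_ltn_trans (size_polyC_leq1 _)) // ltnS prime_gt0.
Qed.

(** Stated for any prime factor Q of P, because the irreducibility of P is deduced from it. *)
Lemma artin_schreier_frobenius (Q : {poly 'F_p}) (HQ : monic_irreducible_poly Q) k :
  Q %| P -> residue_class HQ 'X ^+ (p ^ k) =
    residue_class HQ 'X + k%:R * residue_class HQ a%:P.
Proof.
move=> QP; set x := residue_class HQ 'X; set c := residue_class HQ a%:P.
have xp : x ^+ p = x + c.
  have : residue_class HQ P == 0 by rewrite residue_class_eq0.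
  rewrite /artin_schreier !rmorphB rmorphXn /= -/x -/c.
  by rewrite subr_eq0 subr_eq addrC => /eqP.
have fC : {rmorphism 'F_p -> {poly %/ Q with HQ}} := (residue_class HQ \o polyC)%FUN.
have cp : c ^+ p = c.
  rewrite /c -rmorphXn /= -polyC_exp.
  by have := expf_card a; rewrite (card_Fp pr) => ->.
have pA : p \in [pchar {poly %/ Q with HQ}] := rmorph_pchar fC (pchar_Fp pr).
elim: k => [|k IH]; first by rewrite expr1 mul0r addr0.
rewrite expnSr exprM IH; have := exprDcard fC; rewrite (card_Fp pr) => ->.
rewrite xp exprMn cp -natr1 mulrDl mul1r -addrA [c + _]addrC; congr (_ + (_ * _ + _)).
by rewrite -(pFrobenius_autE pA) pFrobenius_aut_nat.
Qed.

(** For a prime factor Q of degree m, the class of T satisfies theta = theta^(p^m) = theta + m a in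
    A/Q. So p divides m, and Q has the full degree p. *)
Lemma artin_schreier_irreducible : irreducible_poly P.
Proof.
have [|Q irr [Qm QP]] := @irreducible_factor _ P.
  by rewrite size_artin_schreier ltnS prime_gt0.
have HQ : monic_irreducible_poly Q by split.
have fC : {rmorphism 'F_p -> {poly %/ Q with HQ}} := (residue_class HQ \o polyC)%FUN.
have pA : p \in [pchar {poly %/ Q with HQ}] := rmorph_pchar fC (pchar_Fp pr).
have Q1 := monic_irreducible_size HQ.
have : residue_class HQ 'X ^+ (p ^ (size Q).-1) = residue_class HQ 'X.
  by rewrite -[X in (X ^ _)%N](card_Fp pr) -(card_qfpoly HQ) expf_card.
rewrite artin_schreier_frobenius // => /eqP; rewrite -subr_eq0 addrAC subrr add0r mulf_eq0.
have ra0 : residue_class HQ a%:P != 0.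
  apply: residue_class_neq0; rewrite ?polyC_eq0 // (leq_trans (size_polyC_leq1 _)) //.
  by case: (size Q) Q1 => [|[]].
rewrite (negPf ra0) orbF -(dvdn_pcharf pA) => pQ.
have QE : Q = P.
  apply/eqP; rewrite -eqp_monic ?artin_schreier_monic // -dvdp_size_eqp //.
  rewrite eqn_leq dvdp_leq ?monic_neq0 ?artin_schreier_monic // size_artin_schreier.
  rewrite -(prednK (ltnW Q1)) ltnS dvdn_leq //.
  by case: (size Q) Q1 => [|[]].
by rewrite -QE.
Qed.

Lemma artin_schreier_mi : monic_irreducible_poly P.
Proof. by split; [exact: artin_schreier_irreducible | exact: artin_schreier_monic]. Qed.

Variable HP : monic_irreducible_poly P.
Notation A_P := {poly %/ P with HP}.
Notation red := (residue_class HP).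

Let pA : p \in [pchar A_P].
Proof. exact: (rmorph_pchar (red \o polyC)%FUN (pchar_Fp pr)). Qed.

Let kappa : {rmorphism 'F_p -> A_P} := (red \o polyC)%FUN.
Let c := red a%:P.

Let c0 : c != 0.
Proof.
apply: residue_class_neq0; rewrite ?polyC_eq0 // size_artin_schreier /=.
by rewrite (leq_trans (size_polyC_leq1 _)) ?prime_gt0.
Qed.

Let red_frob (b : {poly 'F_p}) k : red b ^+ (p ^ k) = (map_poly kappa b).[red 'X + k%:R * c].
Proof.
rewrite -artin_schreier_frobenius // -{1}[b]coefK poly_def rmorph_sum.
rewrite -[X in (X ^ k)%N](card_Fp pr) (expr_card_sum kappa) horner_coef size_map_poly.
apply: eq_bigr => i _; rewrite coef_map /= -mul_polyC rmorphM rmorphXn exprMn.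
by have := rmorph_expr_card kappa k b`_i => /= ->; rewrite -!exprM mulnC.
Qed.

Notation S j n := (monic_sum (fun b => red b ^+ (p ^ n - 1)) j).

Let dE : (size P).-1 = p.
Proof. by rewrite size_artin_schreier. Qed.

Lemma power_sum_binomial j : (j < p)%N ->
  exists g : A_P, forall n, S j n = g * 'C(n, j)%:R.
Proof.
move=> jp.
pose f : {poly A_P} := \sum_(b : {poly_j.+1 'F_p} | monic_deg j (val b))
   (red (val b))^-1 *: map_poly kappa (val b).
have fE n : f.[red 'X + n%:R * c] = S j n.
  rewrite horner_sum; apply: eq_bigr => b /andP[bm /eqP sb].
  rewrite hornerZ -red_frob; have rb0 : red (val b) != 0.
    by apply: residue_class_neq0; rewrite ?monic_neq0 // sb dE.
  apply: (mulfI rb0); rewrite mulrA mulfV // mul1r -exprS subn1 prednK //.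
  by rewrite expn_gt0 prime_gt0.
have sf : (size f <= j.+1)%N.
  rewrite (leq_trans (size_sum _ _ _)) //; apply/bigmax_leqP => b _.
  by rewrite (leq_trans (size_scale_leq _ _)) // size_map_poly size_npoly.
pose rs := [seq red 'X + i%:R * c | i <- iota 0 j].
have aux (i k : nat) : (i < j)%N -> (k <= i)%N -> i%:R * c = k%:R * c -> i = k.
  move=> ij ki /(mulIf c0)/eqP; rewrite -subr_eq0 -natrB // -(dvdn_pcharf pA) => pik.
  apply/eqP; rewrite eqn_leq ki andbT -subn_eq0; apply: contraLR pik; rewrite -lt0n => ik0.
  by rewrite gtnNdvd // (leq_ltn_trans (leq_subr _ _)) // (ltn_trans ij).
have urs : uniq rs.
  rewrite map_inj_in_uniq ?iota_uniq // => i k; rewrite !mem_iota !add0n => /andP[_ ij] /andP[_ kj].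
  by move=> /addrI ik; have [/aux->|/ltnW/aux <-] := leqP k i.
have fr : all (root f) rs.
  apply/allP => x /mapP[i]; rewrite mem_iota add0n => ij ->; rewrite /root fE.
  apply/eqP; have j0 : (0 < j)%N by case: (j) ij.
  apply: monic_power_sum_small => //; first by rewrite dE.
  rewrite (card_Fp pr) subn1 prednK ?expn_gt0 ?prime_gt0 // leq_exp2l ?prime_gt1 //.
  by case: (j) ij.
have [||h fE'] := @uniq_roots_prod_XsubC _ f rs; rewrite ?uniq_rootsE //.
have sp : size (\prod_(z <- rs) ('X - z%:P)) = j.+1.
  by rewrite size_prod_XsubC size_map size_iota.
have hC : h = (h`_0)%:P.
  apply: size1_polyC; rewrite leqNgt; apply/negP => h1; move: sf.
  have h0 : h != 0 by apply: contraTneq h1 => ->; rewrite size_poly0.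
  rewrite fE' size_Mmonic ?monic_prod_XsubC // sp addnS /= -add1n leq_add2r leqNgt.
  by rewrite h1.
(* At theta + n a the root product is a^j n(n - 1)...(n - j + 1) = a^j j! C(n, j). *)
exists (h`_0 * c ^+ j * (j`!)%:R) => n.
rewrite -fE fE' hornerM hC hornerC coefC eqxx horner_prod -!mulrA; congr (_ * _).
rewrite big_map (eq_bigr (fun i => c * (n%:R - i%:R))) => [|i _]; last first.
  by rewrite !hornerE; ring.
rewrite big_split /= big_const_seq iter_mulr_1 count_predT size_iota; congr (_ * _).
by rewrite prod_sub_ffact -natrM mulnC bin_ffact.
Qed.

(** theta^(p^n) = theta + n a equals theta only if p divides n. *)
Lemma theta_expr_neq n : (0 < n < p)%N -> red 'X ^+ (p ^ n - 1) != 1.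
Proof.
move=> /andP[n0 np]; apply: contraTneq isT => h.
have : red 'X ^+ (p ^ n) = red 'X.
  by rewrite -[(p ^ n)%N](@subnK 1) ?expn_gt0 ?prime_gt0 // addn1 exprSr h mul1r.
rewrite artin_schreier_frobenius // => /eqP; rewrite -subr_eq0 addrAC subrr add0r mulf_eq0.
by rewrite (negPf c0) orbF -(dvdn_pcharf pA) gtnNdvd.
Qed.

Lemma const_expr (x : 'F_p) n : x != 0 -> red x%:P ^+ (p ^ n - 1) = 1.
Proof.
move=> x0; have rx0 : red x%:P != 0.
  apply: residue_class_neq0; rewrite ?polyC_eq0 // size_artin_schreier /=.
  by rewrite (leq_trans (size_polyC_leq1 _)) ?prime_gt0.
apply: (mulfI rx0); rewrite mulr1 -exprS subn1 prednK ?expn_gt0 ?prime_gt0 //.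
by have := rmorph_expr_card kappa n x; rewrite (card_Fp pr).
Qed.

Lemma power_sum_total n : (0 < n < p)%N -> \sum_(j < p) S j n = 0.
Proof.
move=> np; have m0 : (p ^ n - 1 == 0)%N = false.
  by apply/eqP; case/andP: np => n0 _; have := @ltn_exp2l p 0 n (prime_gt1 pr); rewrite n0; lia.
have := @monic_sum_total _ P HP _ (fun x : A_P => x ^+ (p ^ n - 1)).
rewrite dE; apply.
- by move=> x y; rewrite exprMn.
- by rewrite expr0n m0.
- by move=> x x0; rewrite const_expr.
- apply: (_ : red 'X != 0); apply: residue_class_neq0; rewrite ?polyX_eq0 // dE size_polyX.
  exact: prime_gt1.
- exact: theta_expr_neq.
have cC : #|[pred x : 'F_p | x != 0]| = p.-1.
  by have := cardC1 (0 : 'F_p); rewrite (card_Fp pr) => <-; apply: eq_card => x.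
by rewrite cC -(dvdn_pcharf pA); have p1 := prime_gt1 pr; rewrite gtnNdvd //; lia.
Qed.

(** The scalar from [power_sum_binomial] does not depend on n, so it is read off at n = j. There the
    terms beyond j vanish, and comparison with the expansion of (1 - 1)^j isolates the last one. *)
Lemma power_sum_sign j n : (j < p)%N -> S j n = (-1) ^+ j * 'C(n, j)%:R.
Proof.
elim/ltn_ind: j n => -[|j] IH n jp.
  have [g gE] := power_sum_binomial jp.
  rewrite gE !bin0 mulr1; have := gE 0; rewrite bin0 mulr1 => <-.
  rewrite /monic_sum (eq_bigr (fun=> 1)) => [|b _]; last by rewrite expr0.
  rewrite sumr_const.
  rewrite mulr1 expr0; have -> // : #|[pred b : {poly_1 'F_p} | monic_deg 0 (val b)]| = 1%N.
  have s1 : (size (1 : {poly 'F_p})%R <= 1)%N by rewrite size_poly1.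
  apply: (@fintype.eq_card1 _ (npolyp 1 1)) => b; rewrite unfold_in /= inE.
  apply/idP/eqP => [/andP[bm /eqP sb]|->]; last by rewrite val_npolyp // /monic_deg monic1 size_poly1.
  apply: val_inj; rewrite val_npolyp //.
  by move: bm; rewrite monicE lead_coefE sb /= => /eqP b1; rewrite [LHS]size1_polyC ?sb // b1.
have [g gE] := power_sum_binomial jp.
suff gs : g = (-1) ^+ j.+1 by rewrite gE gs.
have := @power_sum_total j.+1 jp; rewrite -(big_mkord xpredT (fun i => S i j.+1)).
rewrite (big_cat_nat (n := j.+2)) //= [X in _ + X]big_nat_cond.
rewrite [X in _ + X]big1 => [|i /andP[/andP[ji ip] _]]; last first.
  by have [gi ->] := power_sum_binomial ip; rewrite bin_small // mulr0.
rewrite addr0 big_mkord big_ord_recr /= gE binn mulr1.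
rewrite (eq_bigr (fun i : 'I_j.+1 => (-1) ^+ i * 'C(j.+1, i)%:R)) => [|i _]; last first.
  by rewrite IH // (ltn_trans (ltn_ord i)).
have : (1 - 1 : A_P) ^+ j.+1 = 0 by rewrite subrr expr0n.
rewrite exprDn big_ord_recr /= subnn mul1r binn.
rewrite (eq_bigr (fun i : 'I_j.+1 => (-1) ^+ i * 'C(j.+1, i)%:R)) => [h1 h2|i _].
  by apply: (addrI (\sum_(i < j.+1) (-1) ^+ i * 'C(j.+1, i)%:R)); rewrite h2 h1.
by rewrite expr1n mul1r mulr_natr.
Qed.

Lemma partial_power_sum N n : (N < p)%N -> (0 < n)%N ->
  \sum_(j < N.+1) S j n = (-1) ^+ N * 'C(n.-1, N)%:R.
Proof.
move=> Np; case: n => // n _.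
elim: N Np => [|N IH] Np; first by rewrite big_ord1 power_sum_sign // !bin0.
rewrite big_ord_recr IH ?(ltnW Np) // power_sum_sign //= binS natrD exprS.
by ring.
Qed.

End ArtinSchreier.

(** * Residues, roots of unity and the congruent-to-one part *)

Section ResidueMap.
Variables (R : realDomainType) (E : fieldType) (v : valuation R E).
Notation O := (val_int v).
Notation kappa := (residue_field v).
Local Open Scope quotient_scope.

Definition small (x : E) : bool := (0 < v x)%E.

Lemma smallE x : x != 0 -> small x = (0 < ord v x).
Proof. by move=> x0; rewrite /small ordE // lte_fin. Qed.

Lemma small0 : small 0.
Proof. by rewrite /small val_fun0 ltry. Qed.

Lemma small1 : small 1 = false.
Proof. by rewrite smallE ?oner_neq0 // ord_one ltxx. Qed.

Lemma smallM x y : vge v 0 x -> vge v 0 y -> small (x * y) = small x || small y.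
Proof.
have [->|x0] := eqVneq x 0; first by rewrite mul0r small0.
have [->|y0] := eqVneq y 0; first by rewrite mulr0 small0 orbT.
rewrite !vgeE // !smallE ?mulf_neq0 // ordM // => x1 y1.
apply/idP/orP => [h|[h|h]]; last 2 first.
- by rewrite ltr_wpDr.
- by rewrite ltr_wpDl.
by move: x1; rewrite le_eqVlt => /orP[/eqP xE|]; [move: h; rewrite -xE add0r; right | left].
Qed.

Lemma smallN x : small (- x) = small x.
Proof.
have [->|x0] := eqVneq x 0; first by rewrite oppr0.
by rewrite !smallE ?oppr_eq0 // ordN.
Qed.

Lemma smallD x y : small x -> small y -> small (x + y).
Proof.
by move=> vx vy; apply: lt_le_trans (val_funD v x y); rewrite lt_min [X in X && _]vx.
Qed.

Lemma small_sum I (r : seq I) (F : I -> E) : (forall i, small (F i)) ->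
  small (\sum_(i <- r) F i).
Proof. by move=> vF; elim/big_ind: _ => [|x y|//]; [exact: small0 | exact: smallD]. Qed.

Lemma small_prod I (r : seq I) (F : I -> E) : (forall i, vge v 0 (F i)) ->
  small (\prod_(i <- r) F i) = has (fun i => small (F i)) r.
Proof.
move=> vF; elim: r => [|i r IH]; first by rewrite big_nil small1.
by rewrite big_cons smallM ?IH // vge_prod.
Qed.

Definition pi_int : {rmorphism O -> kappa} := \pi_({ideal_quot (@val_max R E v)}).

Lemma pi_int_eq (x y : O) : (pi_int x == pi_int y) = small (val x - val y).
Proof. by rewrite -[LHS]Quotient.idealrBE. Qed.

Lemma pi_int_eq0 (x : O) : (pi_int x == 0) = small (val x).
Proof. by rewrite -(rmorph0 pi_int) pi_int_eq subr0. Qed.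

Lemma pi_int_surj (r : kappa) : exists x : O, pi_int x = r.
Proof. by exists (repr r); exact: reprK. Qed.

Lemma exists_int (x : E) : vge v 0 x -> exists y : O, val y = x.
Proof. by move=> vx; exists (ValInt vx). Qed.

Lemma vge_int (x : O) : vge v 0 (val x).
Proof. by case: x. Qed.

Lemma residue_val (x : O) : residue v (val x) = pi_int x.
Proof. by rewrite /residue valKd. Qed.

End ResidueMap.

Section RootsOfUnity.
Variables (p : nat) (S : padic_setup p).
Notation v := (vp S).
Notation E := (Qpbar S).
Notation O := (val_int v).
Notation pi := (pi_int v).

Lemma small_nat n : (p %| n)%N -> small v n%:R.
Proof.
move=> /dvdnP[m ->]; rewrite natrM smallM ?vge_nat //.
by rewrite [X in _ || X]/small vp_p lte_fin ltr01 orbT.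
Qed.

Lemma vge_unity (x : E) N : (0 < N)%N -> x ^+ N = 1 -> vge v 0 x.
Proof.
move=> N0 xN; have x0 : x != 0.
  by apply: contra_eqN xN => /eqP->; rewrite expr0n eqn0Ngt N0 eq_sym oner_eq0.
have := ordX v N x0; rewrite xN ord_one => /esym/eqP.
by rewrite mulrn_eq0 eqn0Ngt N0 vgeE // => /eqP->.
Qed.

(** For x different from 1 the sum 1 + x + ... + x^(N-1) is 0, but its reduction is N = -1. *)
Lemma unity_small (x : E) N : (p %| N.+1)%N -> (0 < N)%N -> x ^+ N = 1 ->
  small v (x - 1) -> x = 1.
Proof.
move=> pN N0 xN sx; have vx := vge_unity N0 xN.
have := subrX1 x N; rewrite xN subrr => /esym/eqP; rewrite mulf_eq0 subr_eq0.
case/orP=> [/eqP //|/eqP s0]; suff : small v 1 by rewrite small1.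
have -> : (1 : E) = N.+1%:R + \sum_(i < N) (x ^+ i - 1).
  by rewrite big_split /= s0 sumr_const card_ord -natr1 mulNrn; ring.
apply: smallD; first exact: small_nat.
apply: small_sum => i; rewrite subrX1 smallM ?sx //; first by rewrite vgeB ?vge1.
by apply: vge_sum => j _; exact: vge0X.
Qed.

Lemma unity_eq (x y : algC) N : (p %| N.+1)%N -> (0 < N)%N -> x ^+ N = 1 -> y ^+ N = 1 ->
  residue v (setup_embed S x) = residue v (setup_embed S y) -> x = y.
Proof.
move=> pN N0 xN yN.
have eN (z : algC) : z ^+ N = 1 -> setup_embed S z ^+ N = 1 by move=> zN; rewrite -rmorphXn zN rmorph1.
have y0 : y != 0.
  by apply: contra_eqN yN => /eqP->; rewrite expr0n eqn0Ngt N0 eq_sym oner_eq0.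
have [X XE] := exists_int (vge_unity N0 (eN x xN)).
have [Y YE] := exists_int (vge_unity N0 (eN y yN)).
rewrite -XE -YE !residue_val => /eqP; rewrite pi_int_eq XE YE => sxy.
have eyV := eN y yN; have yVN : (y^-1) ^+ N = 1 by rewrite exprVn yN invr1.
suff : setup_embed S (x / y) = 1.
  by rewrite -(rmorph1 (setup_embed S)) => /fmorph_inj xy; rewrite -[x](divfK y0) xy mul1r.
apply: (unity_small pN N0); first by rewrite -rmorphXn exprMn xN yVN mulr1 rmorph1.
rewrite -(rmorph1 (setup_embed S)) -rmorphB.
have -> : x / y - 1 = (x - y) * y^-1 by rewrite mulrBl mulfV.
rewrite rmorphM smallM ?rmorphB ?sxy ?vgeB ?(vge_unity N0) ?eN //.
Qed.

(** For a lift Y of y, Y^N - 1 is small and is the product of the Y - w over the N-th roots of unity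
    w; one of these factors must be small. *)
Lemma unity_lift (y : residue_field v) N : (0 < N)%N -> y ^+ N = 1 ->
  exists z : algC, z ^+ N = 1 /\ residue v (setup_embed S z) = y.
Proof.
move=> N0 yN; have [Y YE] := pi_int_surj y.
have [z0 z0P] := C_prim_root_exists N0.
have wP : N.-primitive_root (setup_embed S z0) by rewrite fmorph_primitive_root.
have : small v (val (Y ^+ N) - val (1 : O)).
  by rewrite -pi_int_eq rmorphXn rmorph1 /= YE yN.
have := congr1 (fun f => f.[val Y]) (factor_Xn_sub_1 wP).
rewrite !hornerE horner_prod rmorphXn rmorph1 /= => <-.
have w1 i : (setup_embed S z0) ^+ i ^+ N = 1 by rewrite exprAC (prim_expr_order wP) expr1n.
rewrite small_prod => [|i]; last first.
  by rewrite !hornerE vgeB ?vge_int // (vge_unity N0).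
case/hasP=> i _; rewrite !hornerE => si.
exists (z0 ^+ i); split; first by rewrite exprAC (prim_expr_order z0P) expr1n.
rewrite rmorphXn /=; have [Z ZE] := exists_int (vge_unity N0 (w1 i)).
by rewrite -ZE residue_val -YE; apply/eqP; rewrite eq_sym pi_int_eq ZE.
Qed.

End RootsOfUnity.

Section CongruentToOne.
Variables (p : nat) (S : padic_setup p).
Notation v := (vp S).
Notation E := (Qpbar S).
Notation O := (val_int v).
Notation pi := (pi_int v).

(** The set from which [recip_roots] chooses is inhabited by the reciprocals of the roots, which are
    nonzero as L(0) = 1. *)
Lemma recip_roots_spec (L : {poly algC}) : L`_0 = 1 ->
  map_poly (setup_embed S) L = \prod_(x <- recip_roots S L) (1 - x *: 'X).
Proof.
move=> L0; rewrite /recip_roots; case: xgetP => [s -> //|/(_ _)/= noroots]; exfalso.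
pose f := map_poly (setup_embed S) L; have [r fE] := closed_field_poly_normal f.
have f0 : f.[0] = 1 by rewrite horner_coef0 coef_map L0; exact: rmorph1.
have r0 x : x \in r -> x != 0.
  move=> xr; apply: contra_eq_neq f0 => x0; rewrite fE hornerZ horner_prod.
  rewrite (big_rem _ xr) /= x0 polyC0 subr0 hornerX mul0r mulr0.
  by rewrite eq_sym oner_eq0.
apply: (noroots [seq x^-1 | x <- r]).
have : f.[0] = lead_coef f * \prod_(x <- r) (- x).
  by rewrite {1}fE hornerZ horner_prod; congr (_ * _); apply: eq_bigr => x _; rewrite !hornerE.
rewrite f0 => lE; rewrite -/f {1}fE big_map.
have -> : \prod_(x <- r) ('X - x%:P) = (\prod_(x <- r) (- x)) *: \prod_(x <- r) (1 - x^-1 *: 'X).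
  rewrite -scaler_prod big_seq [RHS]big_seq; apply: eq_bigr => x xr.
  by rewrite scalerBr scalerA mulNr mulfV ?r0 // scaleN1r opprK alg_polyC addrC polyCN.
by rewrite scalerA -lE scale1r.
Qed.

(** If x were not integral, its inverse would be small; in L(1/x) = 0 all terms but the constant 1
    would then be small. *)
Lemma recip_roots_vge (L : {poly algC}) x : L`_0 = 1 ->
  (forall i, vge v 0 (setup_embed S L`_i)) -> x \in recip_roots S L -> vge v 0 x.
Proof.
move=> L0 vL xs; rewrite -[vge _ _ _]negbK; apply/negP => vx.
have x0 := vge_gt_neq0 vx.
have sx : small v x^-1.
  by move: vx; rewrite vgeE // smallE ?invr_eq0 // ordV // -ltNge oppr_gt0.
have vx1 : vge v 0 x^-1 := ltW sx.
have : (map_poly (setup_embed S) L).[x^-1] = 0.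
  rewrite recip_roots_spec // horner_prod (big_rem _ xs) /=.
  by rewrite !hornerE mulfV // subrr mul0r.
have [L00|] := eqVneq L 0.
  by have := oner_neq0 algC; rewrite -L0 L00 coef0 eqxx.
rewrite -size_poly_gt0 horner_coef size_map_poly; case: (size L) => // n _.
rewrite big_ord_recl expr0 mulr1 coef_map L0 /= (rmorph1 (setup_embed S)) => /eqP; rewrite addr_eq0 => /eqP h.
suff : small v 1 by rewrite small1.
rewrite h smallN; apply: small_sum => i; rewrite coef_map smallM ?vge0X ?vL //.
rewrite /bump /= add1n exprS [small v (_ * _)]smallM ?vge0X // sx orbT //.
Qed.

Lemma size_congr1_part (s : seq E) (P : pred E) : (forall x, P x -> x != 0) ->
  size (\prod_(x <- s | P x) (1 - x *: 'X)) = (count P s).+1.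
Proof.
move=> P0; elim: s => [|x s IH]; first by rewrite big_nil size_poly1.
rewrite big_cons /=; case: ifP => // Px.
have x0 := P0 x Px; have s2 : size (1 - x *: 'X) = 2.
  by rewrite addrC size_polyDl size_polyN size_scale // ?size_polyX ?size_poly1.
rewrite size_mul -?size_poly_gt0 ?s2 // ?IH // addnC add1n.
Qed.

(* Modulo the maximal ideal the factors with alpha_j = 1 are copies of 1 - X,
   and the others are units at X = 1. *)
Lemma congr1_part_deg (L : {poly algC}) m : L`_0 = 1 ->
  (forall i, exists y : O, val y = setup_embed S L`_i /\ pi y = ((1 - 'X) ^+ m)`_i) ->
  poly_deg (congr1_part S L) = m.
Proof.
move=> L0 Lm; pose s := recip_roots S L.
have vL i : vge v 0 (setup_embed S L`_i) by have [y [<- _]] := Lm i; exact: vge_int.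
have [s' sE] : exists s' : seq O, s = map val s'.
  have : forall x, x \in s -> vge v 0 x by move=> x; exact: recip_roots_vge.
  elim: s => [|x s IH] vs; first by exists [::].
  have [|s' ->] := IH; first by move=> y ys; apply: vs; rewrite inE ys orbT.
  have [|y <-] := @exists_int _ _ v x; first by apply: vs; rewrite mem_head.
  by exists (y :: s').
pose LO := \prod_(y <- s') (1 - y *: 'X : {poly O}).
have LOE : map_poly val LO = map_poly (setup_embed S) L.
  rewrite recip_roots_spec // -/s sE rmorph_prod big_map; apply: eq_bigr => y _.
  by rewrite rmorphB rmorph1; congr (_ - _); rewrite [LHS]map_polyZ map_polyX.
have piLO : \prod_(y <- s') (1 - pi y *: 'X) = (1 - 'X) ^+ m.
  have <- : map_poly pi LO = (1 - 'X) ^+ m.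
    apply/polyP => i; have [y [yE <-]] := Lm i; rewrite coef_map; congr (pi _).
    apply: val_inj; rewrite yE.
    have /= := congr1 (fun f : {poly E} => f`_i) LOE; rewrite [RHS]coef_map => <-.
    exact: (esym (coef_map (\val : {rmorphism O -> E}) LO i)).
  rewrite rmorph_prod; apply: eq_bigr => y _; rewrite rmorphB rmorph1.
  by congr (_ - _); rewrite [RHS]map_polyZ map_polyX.
pose c := count (fun y => pi y == 1) s'.
have -> : poly_deg (congr1_part S L) = c.
  rewrite /poly_deg /congr1_part size_congr1_part => [|x]; last first.
    by apply: contraTneq => ->; rewrite sub0r -[(_ < _)%E]/(small v _) smallN small1.
  rewrite -/s sE count_map; apply: eq_count => y /=.
  by rewrite -(rmorph1 pi) pi_int_eq.
pose G := \prod_(y <- s' | pi y != 1) (1 - pi y *: 'X).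
have splitG : (1 - 'X) ^+ c * G = (1 - 'X) ^+ m.
  rewrite -piLO (bigID (fun y => pi y == 1)) /=; congr (_ * _).
  rewrite (eq_bigr (fun=> 1 - 'X)) => [|y /eqP->]; last by rewrite scale1r.
  by rewrite big_const_seq iter_mulr_1.
(* G(1) is the reduction of the product of the 1 - y, all units of the valuation ring. *)
have G1 : G.[1] != 0.
  rewrite horner_prod (eq_bigr (fun y => pi (1 - y))) => [|y _]; last first.
    by rewrite !hornerE rmorphB rmorph1.
  rewrite -rmorph_prod pi_int_eq0 rmorph_prod -big_filter small_prod => [|y]; last exact: vge_int.
  apply/hasPn => y; rewrite mem_filter => /andP[y1 _]; apply: contra y1.
  by rewrite -pi_int_eq0 rmorphB rmorph1 subr_eq0 eq_sym.
(* [residue_field] carries the structure of a commutative ring only; powers of 1 - X cancel because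
   X - 1 is monic. *)
have reg k : GRing.lreg ((1 - 'X : {poly residue_field v}) ^+ k).
  apply: lregX; rewrite -opprB; apply/lregN/monic_lreg; exact: monicXsubC.
have one0 k : (0 < k)%N -> ((1 - 'X : {poly residue_field v}) ^+ k).[1] = 0.
  by move=> k0; rewrite horner_exp !hornerE subrr expr0n eqn0Ngt k0.
have [cm|mc|//] := ltngtP c m.
  have E1 : G = (1 - 'X) ^+ (m - c).
    by apply: (reg c); rewrite /= splitG -exprD subnKC // ltnW.
  by move: G1; rewrite E1 one0 ?eqxx // subn_gt0.
have E1 : (1 - 'X) ^+ (c - m) * G = 1.
  by apply: (reg m); rewrite /= mulrA -exprD subnKC ?splitG ?mulr1 // ltnW.
have := congr1 (fun f => f.[1]) E1; rewrite hornerM one0 ?subn_gt0 // mul0r hornerC => /eqP.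
by rewrite eq_sym oner_eq0.
Qed.

End CongruentToOne.

(** * Powers of the Teichmueller character *)

Lemma coef_one_subX (R : comNzRingType) m n :
  ((1 - 'X : {poly R}) ^+ m)`_n = (-1) ^+ n * 'C(m, n)%:R.
Proof.
have E : (1 - 'X : {poly R}) ^+ m = \poly_(k < m.+1) ((-1) ^+ k * 'C(m, k)%:R).
  rewrite exprBn poly_def; apply: eq_bigr => k _.
  by rewrite expr1n mulr1 -mul_polyC polyCM polyC_exp polyCN polyCMn mulr_natr mulrnAl.
rewrite E coef_poly; case: ltnP => // mn; by rewrite bin_small // mulr0.
Qed.

Lemma monic_deg0 (F : finFieldType) (b : {poly_1 F}) :
  monic_deg 0 (val b) = (b == npolyp 1 1).
Proof.
have s1 : (size (1 : {poly F})%R <= 1)%N by rewrite size_poly1.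
apply/idP/eqP => [/andP[bm /eqP sb]|->]; last by rewrite val_npolyp // /monic_deg monic1 size_poly1.
apply: val_inj; rewrite val_npolyp //.
by move: bm; rewrite monicE lead_coefE sb /= => /eqP b1; rewrite [LHS]size1_polyC ?sb // b1.
Qed.

Section TeichmullerCharacter.
Variables (p : nat) (S : padic_setup p) (F : finFieldType) (P : {poly F}).
Hypothesis pF : (p %| #|F|)%N.
Variable D : cyclotomic_data S P.
Notation HP := (cyc_prime D).
Notation A_P := {poly %/ P with HP}.
Notation K := (cyc_field D).
Notation Ksplit := (cyc_fieldP D).
Notation v := (vp S).
Notation O := (val_int v).
Notation N := (#|F| ^ poly_deg P).-1.
Notation red := (residue_class HP).
Notation C := (cop (iota_K K)).
Notation torsion z := (C P z = 0).

Let card_A : #|A_P| = (#|F| ^ poly_deg P)%N.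
Proof. exact: card_qfpoly. Qed.

Let NS : N.+1 = #|A_P|.
Proof. by rewrite card_A prednK // expn_gt0 finField_card_gt0. Qed.

Let N0 : (0 < N)%N.
Proof. by rewrite -ltnS NS finNzRing_gt1. Qed.

Let pN : (p %| N.+1)%N.
Proof.
rewrite NS card_A /poly_deg; have := monic_irreducible_size HP.
by case: (size P) => [|[|m]] // _; rewrite expnS dvdn_mulr.
Qed.

Lemma qpoly_unity (x : A_P) : x != 0 -> x ^+ N = 1.
Proof.
by move=> x0; apply: (mulfI x0); rewrite mulr1 -exprS NS expf_card.
Qed.

Lemma teichmuller_spec (x : A_P) : x != 0 ->
  teichmuller x ^+ N = 1 /\ residue v (setup_embed S (teichmuller x)) = cyc_embed D x.
Proof.
move=> x0; rewrite /teichmuller; case: xgetP => [z -> //|noz].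
have [|z zP] := @unity_lift _ _ (cyc_embed D x) N N0; last by case: (noz z).
by rewrite -rmorphXn qpoly_unity // rmorph1.
Qed.

(** The explicit value at 0 makes the character multiplicative on all of A/P. *)
Definition teich0 (x : A_P) : algC := if x == 0 then 0 else teichmuller x.

Lemma teich0_unity x : x != 0 -> teich0 x ^+ N = 1.
Proof. by move=> x0; rewrite /teich0 (negPf x0); have [] := teichmuller_spec x0. Qed.

Lemma teich0_eq0 x : (teich0 x == 0) = (x == 0).
Proof.
apply/idP/idP => [|/eqP->]; last by rewrite /teich0 !eqxx.
apply: contraLR => x0; apply: contra_eq_neq (teich0_unity x0) => ->.
by rewrite expr0n eqn0Ngt N0 eq_sym oner_eq0.
Qed.

Lemma teich0_int x : exists y : O, val y = setup_embed S (teich0 x) /\ pi_int v y = cyc_embed D x.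
Proof.
have [->|x0] := eqVneq x 0; first by exists 0; rewrite /teich0 eqxx !rmorph0.
have [t1 tr] := teichmuller_spec x0.
have : vge v 0 (setup_embed S (teichmuller x)).
  by apply: (vge_unity N0); rewrite -rmorphXn t1 rmorph1.
move=> /exists_int[y yE]; exists y; rewrite /teich0 (negPf x0) yE; split=> //.
by rewrite -residue_val yE.
Qed.

(** Both sides are N-th roots of unity with the same residue, and reduction is injective on
    these. *)
Lemma teich0M x y : teich0 (x * y) = teich0 x * teich0 y.
Proof.
have [->|x0] := eqVneq x 0; first by rewrite mul0r /teich0 eqxx mul0r.
have [->|y0] := eqVneq y 0; first by rewrite mulr0 /teich0 eqxx mulr0.
apply: (@unity_eq p S _ _ N pN N0); rewrite ?exprMn ?teich0_unity ?mulf_neq0 ?mul1r //.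
have [X [XE Xr]] := teich0_int x; have [Y [YE Yr]] := teich0_int y.
have [Z [<- Zr]] := teich0_int (x * y).
by rewrite rmorphM -XE -YE -rmorphM !residue_val rmorphM Zr Xr Yr rmorphM.
Qed.

Lemma teich0_1 : teich0 1 = 1.
Proof.
have t0 : teich0 1 != 0 by rewrite teich0_eq0 oner_eq0.
by apply: (mulfI t0); rewrite -teich0M !mulr1.
Qed.

Lemma teich0X x n : teich0 (x ^+ n) = teich0 x ^+ n.
Proof. by elim: n => [|n IH]; rewrite ?teich0_1 // !exprS teich0M IH. Qed.

Lemma teich0_inj : injective teich0.
Proof.
move=> x y xy; apply: (fmorph_inj (cyc_embed D)).
have [X [XE <-]] := teich0_int x; have [Y [YE <-]] := teich0_int y.
by congr (pi_int v _); apply: val_inj; rewrite /= XE YE xy.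
Qed.

(** The witness in [O] records integrality and residue together, so that powers and sums are taken
    in the valuation ring. *)
Lemma teich0_sum_int I (r : seq I) (Q : pred I) (G : I -> A_P) i :
  exists y : O, val y = setup_embed S (\sum_(j <- r | Q j) teich0 (G j) ^+ i) /\
    pi_int v y = cyc_embed D (\sum_(j <- r | Q j) G j ^+ i).
Proof.
elim: r => [|j r [y [yE yr]]]; first by exists 0; rewrite !big_nil !rmorph0.
rewrite !big_cons; case: (Q j); last by exists y.
have [z [zE zr]] := teich0_int (G j); exists (z ^+ i + y).
by rewrite !rmorphD !rmorphXn yr zr -yE -zE.
Qed.

Lemma artin_class_spec (s : gal_of {:K}) : artin_class s != 0 /\
  forall z, torsion z -> s z = C (val (artin_class s)) z.
Proof.
rewrite /artin_class; case: xgetP => [b -> [b0 bE]|nob].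
  by split=> // z /(torsionP P) tz; rewrite bE // horner_carlitz_over.
have [b [b0 bE]] := gal_class HP Ksplit s.
case: (nob b); split=> // z /torsionP tz; by rewrite bE // horner_carlitz_over.
Qed.

Lemma cop_residue (a : {poly F}) z : torsion z -> C (val (red a)) z = C a z.
Proof.
have [->|z0] := eqVneq z 0; first by rewrite !copr0.
by move=> tz; apply: cop_mod.
Qed.

Lemma artin_class_unique (s : gal_of {:K}) (a : {poly F}) :
  (forall z, torsion z -> s z = C a z) -> artin_class s = red a.
Proof.
move=> sE; apply: (class_inj Ksplit) => z tz.
have [_ h] := artin_class_spec s; rewrite -(h z tz) (sE z tz); by rewrite cop_residue.
Qed.

Lemma artin_classM (s t : gal_of {:K}) :
  artin_class (s * t)%g = artin_class s * artin_class t.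
Proof.
have [_ sE] := artin_class_spec s; have [_ tE] := artin_class_spec t.
have st : forall z, torsion z -> (s * t)%g z = C (val (artin_class s) * val (artin_class t)) z.
  by move=> z tz; rewrite galM ?memvf // sE // gal_cop tE // copM.
by rewrite (artin_class_unique st) rmorphM; congr (_ * _); exact: residue_classK.
Qed.

Section Power.
Variable i : nat.
Hypothesis i0 : (0 < i)%N.
Hypothesis i_even : forall c : F, c != 0 -> red c%:P ^+ i = 1.
Hypothesis i_nontrivial : exists g : A_P, g != 0 /\ g ^+ i != 1.

Let chi : gal_of {:K} -> algC := @omega_pow p S F P D i.
Let f (x : A_P) : algC := teich0 x ^+ i.

Let chiE s : chi s = f (artin_class s).
Proof.
by rewrite /chi /omega_pow /f /teich0; have [/negPf-> _] := artin_class_spec s.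
Qed.

Let fM x y : f (x * y) = f x * f y.
Proof. by rewrite /f teich0M exprMn. Qed.

Let f0 : f 0 = 0.
Proof. by rewrite /f /teich0 eqxx expr0n eqn0Ngt i0. Qed.

Let f1 : f 1 = 1.
Proof. by rewrite /f teich0_1 expr1n. Qed.

Let fC (c : F) : c != 0 -> f (red c%:P) = 1.
Proof. by move=> c0; rewrite /f -teich0X i_even // teich0_1. Qed.

Let fg : exists g : A_P, g != 0 /\ f g != 1.
Proof.
have [g [g0 gi]] := i_nontrivial; exists g; split=> //.
by apply: contraNneq gi; rewrite /f -teich0X -teich0_1 => /teich0_inj->.
Qed.

Let chiM (s t : gal_of {:K}) : chi (s * t)%g = chi s * chi t.
Proof. by rewrite !chiE artin_classM fM. Qed.

Let chi_neq0 s : chi s != 0.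
Proof.
by rewrite chiE /f expf_neq0 // teich0_eq0; have [] := artin_class_spec s.
Qed.

Lemma char_at_omega_fin (Q : {poly F}) : monic_irreducible_poly Q ->
  char_at chi (Fin Q) = f (red Q).
Proof.
move=> HQ; have [QP|QP] := eqVneq (red Q) 0; last first.
  have [s sE] := class_gal Ksplit QP.
  have sQ z : torsion z -> s z = C Q z by move=> tz; rewrite sE // cop_residue.
  by rewrite (char_at_fin HP Ksplit chiM chi_neq0 HQ sQ) chiE (artin_class_unique sQ).
(* Only Q = P has class 0; it is ramified, and [f 0 = 0]. *)
have /eqP := QP; rewrite residue_class_eq0 => PQ; rewrite QP f0.
have <- : P = Q.
  apply/eqP; rewrite -eqp_monic ?(monic_irreducible_monic HP) ?(monic_irreducible_monic HQ) //.
  have [[_ irr] _] := HQ; apply: irr => //.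
  by have := monic_irreducible_size HP; case: (size P) => [|[]].
apply: (char_at_ramified HP Ksplit chiM chi_neq0).
have [g [g0 g1]] := fg; have [s sE] := class_gal Ksplit g0.
by exists s; rewrite chiE (artin_class_unique sE) residue_classK.
Qed.

Lemma char_at_omega_infty : char_at chi (Infty F) = 1.
Proof.
apply: (char_at_infty HP Ksplit chiM chi_neq0) => s c c0 sE.
rewrite chiE (@artin_class_unique s c%:P) ?fC // => z tz.
by rewrite sE // copC.
Qed.

Lemma artin_coef_omega n :
  artin_coef chi n = \sum_(m < n.+1) monic_sum (f \o red) m.
Proof.
apply: artin_coefE => /=.
- by rewrite rmorph1.
- by move=> a b; rewrite rmorphM fM.
- exact: char_at_omega_fin.
- exact: char_at_omega_infty.
Qed.

(** The partial sum contains the whole block of degrees below d, which vanishes in total; the terms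
    of degree at least d vanish one by one. *)
Lemma artin_coef_omega_large n : ((size P).-1 <= n.+1)%N -> artin_coef chi n = 0.
Proof.
have [g [g0 g1]] := fg.
move=> dn; rewrite artin_coef_omega -(big_mkord xpredT (monic_sum (f \o red))).
rewrite (big_cat_nat (n := (size P).-1)) //= big_mkord.
rewrite (monic_sum_total fM f0 fC g0 g1) ?add0r; last first.
  rewrite pnatr_eq0 -lt0n; apply/card_gt0P; exists 1.
  by rewrite unfold_in /= oner_neq0.
rewrite big_nat_cond big1 // => m /andP[/andP[dm _] _].
apply: (monic_sum_large fM g0 g1) => //.
by rewrite pnatr_eq0 -lt0n card_A expn_gt0 finField_card_gt0.
Qed.

Lemma artin_L_omega n : (artin_L chi)`_n = artin_coef chi n.
Proof.
rewrite /artin_L; case: xgetP => [L -> //|noL]; exfalso.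
apply: (noL (\poly_(n < (size P).-1) artin_coef chi n)) => m /=.
rewrite coef_poly; case: ltnP => // dm.
by rewrite artin_coef_omega_large // ltnW.
Qed.

Lemma deg_g_omega m :
  (forall n, (n.+1 < (size P).-1)%N ->
     \sum_(j < n.+1) monic_sum (fun b => red b ^+ i) j = (-1) ^+ n * 'C(m, n)%:R) ->
  (m.+1 < (size P).-1)%N -> deg_g D i = m.
Proof.
move=> sumE md; apply: congr1_part_deg => [|n].
  rewrite artin_L_omega artin_coef_omega big_ord1 /monic_sum.
  rewrite (big_pred1 (npolyp 1 1)) => [|b]; last exact: monic_deg0.
  by rewrite /= val_npolyp ?size_poly1 // rmorph1.
(* For n + 1 >= d both coefficients are 0, the binomial one because m < d - 1 <= n. *)
rewrite coef_one_subX artin_L_omega; case: (ltnP n.+1 (size P).-1) => [nd|dn]; last first.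
  rewrite artin_coef_omega_large // bin_small ?mulr0; last by rewrite -ltnS (leq_trans md).
  by exists 0; rewrite !rmorph0.
have sumO k : exists y : O, val y = setup_embed S (monic_sum (f \o red) k) /\
    pi_int v y = cyc_embed D (monic_sum (fun b => red b ^+ i) k).
  exact: (teich0_sum_int _ _ (fun b : {poly_k.+1 F} => red (val b)) i).
suff [y [yE yr]] : exists y : O, val y = setup_embed S (\sum_(k < n.+1) monic_sum (f \o red) k) /\
    pi_int v y = cyc_embed D (\sum_(k < n.+1) monic_sum (fun b => red b ^+ i) k).
  exists y; rewrite artin_coef_omega yE yr sumE //; split=> //.
  by rewrite rmorphM rmorphXn rmorphN1 rmorph_nat.
elim: n.+1 => [|k [y [yE yr]]]; first by exists 0; rewrite !big_ord0 !rmorph0.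
have [z [zE zr]] := sumO k; exists (y + z).
by rewrite !big_ord_recr !rmorphD /= yr zr -yE -zE.
Qed.

End Power.
End TeichmullerCharacter.

Lemma deg_g_artin_schreier (p : nat) (pr : prime p) (S : padic_setup p) (a : 'F_p)
    (D : cyclotomic_data S (artin_schreier a)) n : a != 0 -> (0 < n < p)%N ->
  deg_g D (p ^ n - 1) = n.-1.
Proof.
move=> a0 np; have /andP[n0 n_lt] := np.
have dE : (size (artin_schreier a)).-1 = p by rewrite size_artin_schreier.
apply: deg_g_omega.
- by rewrite (card_Fp pr).
- by rewrite subn_gt0 -(expn0 p) ltn_exp2l ?prime_gt1.
- by move=> c c0; exact: const_expr.
- exists (residue_class (cyc_prime D) 'X); split; last exact: theta_expr_neq.
  by apply: residue_class_neq0; rewrite ?polyX_eq0 // dE size_polyX prime_gt1.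
- by move=> m; rewrite dE => mp; apply: partial_power_sum => //; apply: ltnW.
by rewrite dE prednK.
Qed.

(** * Existence of cyclotomic data *)

Lemma map_XsubC (R R' : nzRingType) (f : {rmorphism R -> R'}) x :
  map_poly f ('X - x%:P) = 'X - (f x)%:P.
Proof. by rewrite rmorphB /= map_polyX map_polyC. Qed.

Lemma exists_split_extension (k : fieldType) (f : {poly k}) : f != 0 ->
  exists (L : fieldExtType k) (zs : seq L),
    map_poly (in_alg L) f %= \prod_(z <- zs) ('X - z%:P).
Proof.
have [n] := ubnP (size f); elim: n => // n IH in k f *; rewrite ltnS => fn f0.
 have [f1|f1] := leqP (size f) 1.
  exists k^o, [::]; rewrite big_nil -size_poly_eq1 size_map_poly.
  by rewrite eqn_leq f1 size_poly_gt0.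
have [g girr [_ gf]] := irreducible_factor f1.
have [K _ [x gx _]] := irredp_FAdjoin girr.
have fx : root (map_poly (in_alg K) f) x.
  by rewrite -(divpK gf) rmorphM rootM gx orbT.
have [h fE] := factor_theorem _ _ fx.
have h0 : h != 0 by apply: contraTneq f0 => h0; rewrite -(map_poly_eq0 (in_alg K)) fE h0 mul0r eqxx.
have sh : (size h < n)%N.
  by rewrite -(size_map_poly (in_alg K)) in fn; move: fn;
    rewrite fE size_Mmonic ?monicXsubC // size_XsubC addn2.
have [L [zs hE]] := IH K h sh h0.
have fL : map_poly (in_alg L) (map_poly (in_alg K) f) %= \prod_(z <- x%:A :: zs) ('X - z%:P).
  by rewrite big_cons fE rmorphM /= map_XsubC mulrC eqp_mull.
move: fL; rewrite -map_poly_comp -(eq_map_poly (fun c : k => baseField_scaleE c (1 : L))) => fL.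
by exists (baseFieldType L), (x%:A :: zs).
Qed.

Lemma exists_splitting_field (k : fieldType) (f : {poly k}) : f != 0 ->
  exists K : splittingFieldType k, splittingFieldFor 1 (map_poly (in_alg K) f) {:K}.
Proof.
move=> f0; have [L [ys fy]] := exists_split_extension f0.
(* [L] may be too large; K is the subfield generated by the roots. *)
pose K := subvs_of <<1 & ys>>; pose toL := linfun (vsval : K -> L).
pose zs := map (vsproj <<1 & ys>>) ys.
have zsE : map toL zs = ys.
  by rewrite -map_comp map_id_in // => y yys; rewrite /= lfunE /= vsprojK ?seqv_sub_adjoin.
have splitK : splittingFieldFor 1 (map_poly (in_alg K) f) {:K}.
  exists zs.
    rewrite -(eqp_map (vsval : {rmorphism K -> L})) rmorph_prod -map_poly_comp.
    rewrite (eq_map_poly (g := in_alg L)) => [|x]; last exact: rmorph_alg.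
    have -> // : \prod_(z <- zs) map_poly (vsval : {rmorphism K -> L}) ('X - z%:P) =
        \prod_(y <- ys) ('X - y%:P).
    rewrite -[in RHS]zsE [RHS]big_map; apply: eq_bigr => z _.
    by rewrite [LHS](@map_XsubC K L) /= lfunE.
  apply/vspaceP => u; rewrite memvf.
  have : val u \in (toL @: <<1 & zs>>)%VS by rewrite aimg_adjoin_seq aimg1 zsE (valP u).
  by case/memv_imgP => w ws; rewrite lfunE => /val_inj->.
have fK : splitting_field_axiom K.
  by exists (map_poly (in_alg K) f) => //; apply/polyOverP => i; rewrite coef_map memvZ ?mem1v.
pose Kmixin := FieldExt_isSplittingField.Build k K fK.
pose K' : splittingFieldType k := HB.pack K Kmixin.
by exists K'; exact: splitK.
Qed.

Section QuotientLift.
Variables (F : finFieldType) (P : {poly F}) (HP : monic_irreducible_poly P).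
Variables (R : comNzRingType) (ev : {rmorphism {poly F} -> R}) (evP : ev P = 0).
Notation A_P := {poly %/ P with HP}.

(** The proof of [ev P = 0] is an argument so that the morphism instances, valid only under it, can
    be attached to this function. *)
Definition quotient_lift of ev P = 0 := fun b : A_P => ev (val b).
Notation lift := (quotient_lift evP).

Let ev_red (f g : {poly F}) : residue_class HP f = residue_class HP g -> ev f = ev g.
Proof.
move/eqP; rewrite -subr_eq0 -rmorphB residue_class_eq0 => /dvdpP[h hE].
by apply/eqP; rewrite -subr_eq0 -rmorphB hE rmorphM evP mulr0.
Qed.

Fact quotient_lift_zmod : zmod_morphism lift.
Proof. by move=> b c; rewrite /quotient_lift -rmorphB. Qed.

Fact quotient_lift_monoid : monoid_morphism lift.
Proof.
split; first by rewrite -(rmorph1 ev); apply: ev_red; apply: etrans (residue_classK _) (esym (rmorph1 _)).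
move=> b c; rewrite /quotient_lift -rmorphM; apply: ev_red.
rewrite rmorphM; apply: etrans (residue_classK _) _; apply/esym.
by congr (_ * _); exact: residue_classK.
Qed.

HB.instance Definition _ := GRing.isZmodMorphism.Build A_P R lift quotient_lift_zmod.
HB.instance Definition _ := GRing.isMonoidMorphism.Build A_P R lift quotient_lift_monoid.

Definition quotient_rmorphism : {rmorphism A_P -> R} := lift.

End QuotientLift.

Section ExistsData.
Variables (p : nat) (pr : prime p) (S : padic_setup p) (a : 'F_p) (a0 : a != 0).
Notation v := (vp S).
Notation kappa := (residue_field v).
Notation P := (artin_schreier a).
Let HP : monic_irreducible_poly P := artin_schreier_mi pr a0.

Let pchark : p \in [pchar kappa].
Proof.
rewrite inE pr /= -(rmorph_nat (pi_int v)) pi_int_eq0 rmorph_nat.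
by apply: small_nat; exact: dvdnn.
Qed.

(** The polynomial has a root in the closed field; the root is integral, and its residue is
    taken. *)
Lemma exists_artin_schreier_root : exists x : kappa, x ^+ p - x = (a : nat)%:R.
Proof.
pose f : {poly Qpbar S} := 'X^p - 'X - (a : nat)%:R%:P.
have sX : (size ('X + (a : nat)%:R%:P : {poly Qpbar S})%R < size ('X^p : {poly Qpbar S})%R)%N.
  by rewrite size_polyXn -[X in 'X + X]opprK -polyCN size_XsubC ltnS prime_gt1.
have fE : f = 'X^p - ('X + (a : nat)%:R%:P) by rewrite opprD addrA.
have fm : f \is monic by rewrite fE monicE lead_coefDl ?size_polyN // lead_coefXn.
have sf : size f != 1 by rewrite fE size_polyDl ?size_polyN // size_polyXn eqSS -lt0n prime_gt0.
have [x fx] := closed_rootP _ sf.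
have vx : vge v 0 x.
  apply: vge_integral fm fx _ => i; rewrite !coefB coefXn coefX coefC.
  by rewrite !vgeB ?vge_nat //; case: (i == 0)%N; rewrite ?vge_nat ?vge0.
have [y yE] := exists_int vx; exists (pi_int v y).
rewrite -rmorphXn -rmorphB -(rmorph_nat (pi_int v)); congr (pi_int v _).
apply: val_inj; rewrite rmorphB rmorphXn rmorph_nat /= yE.
by move: fx; rewrite /root !hornerE subr_eq0 => /eqP.
Qed.

Lemma exists_embedding : inhabited {rmorphism {poly %/ P with HP} -> kappa}.
Proof.
have [x xE] := exists_artin_schreier_root.
(* [pPrimeCharType] views the residue field as an algebra over the prime field, so that T |-> x is
   an evaluation. *)
pose ev : {rmorphism {poly 'F_p} -> pPrimeCharType pchark} := horner_alg (x : pPrimeCharType pchark).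
have evP : (ev : {rmorphism {poly 'F_p} -> kappa}) P = 0.
  rewrite /artin_schreier !rmorphB rmorphXn /= horner_algX horner_algC.
  by apply/eqP; rewrite subr_eq0; apply/eqP; rewrite xE; exact: (esym (mulr1 _)).
by split; exact: (quotient_rmorphism HP evP).
Qed.

(** Refuting the conjecture needs an actual instance, since it quantifies over all cyclotomic
    data. *)
Lemma exists_cyclotomic_data : inhabited (cyclotomic_data S P).
Proof.
have f0 : map_poly (@tofrac {poly 'F_p}) (carlitz P) != 0.
  have Pn0 := monic_irreducible_neq0 HP.
  apply: contraTneq isT => /(congr1 (fun f : {poly _} => f`_1)).
  (* The coefficient of x in C_P is P itself, so C_P is nonzero over k. *)
  rewrite coef_map coef0 => /eqP; rewrite tofrac_eq0 carlitzE coef_sum.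
  rewrite -(prednK (_ : 0 < size P)%N) ?size_poly_gt0 // big_ord_recl big1 => [|i _].
    by rewrite addr0 coefZ expn0 coefXn eqxx mulr1 ccoef0 (negPf Pn0).
  rewrite coefZ coefXn (card_Fp pr) // lift0; case: eqP => [h|_]; last by rewrite mulr0.
  by have := @ltn_exp2l p 0 i.+1 (prime_gt1 pr); rewrite -h.
have [K Ks] := exists_splitting_field f0.
have [e] := exists_embedding.
have Ks' : splittingFieldFor 1 (carlitz_over K P) {:K}.
  by rewrite /carlitz_over map_poly_comp.
exact: inhabits (CyclotomicData Ks' e).
Qed.

End ExistsData.

(** * The counterexamples *)

Lemma q_magic_pred_expn p n : q_magic p (p ^ n - 1).
Proof. by exists 0%N, n; rewrite mul0n add0n. Qed.

Lemma pred_expn_range p n : (1 < p)%N -> (1 < n < p)%N -> (1 <= p ^ n - 1 <= p ^ p - 2)%N.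
Proof.
move=> p1 /andP[n1 np]; have : (p ^ n <= p ^ p.-1)%N by rewrite leq_pexp2l; lia.
have : (p ^ 1 < p ^ n)%N by rewrite ltn_exp2l.
have : (p ^ p = p * p ^ p.-1)%N by rewrite -expnS prednK; lia.
by rewrite expn1; move: (p ^ p)%N (p ^ n)%N (p ^ p.-1)%N => x y z; nia.
Qed.

Theorem corollary1 (S : forall p : nat, prime p -> padic_setup p) :
  (* the degree formula for p >= 5 *)
  (forall (p : nat) (pr : prime p) (n : nat) (a : 'F_p),
     (5 <= p)%N -> (3 <= n <= p - 1)%N -> a != 0 ->
     [/\ artin_schreier a \is monic,
         irreducible_poly (artin_schreier a),
         q_magic p (p ^ n - 1),
         (1 <= p ^ n - 1 <= p ^ poly_deg (artin_schreier a) - 2)%N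
       & forall D : cyclotomic_data (S p pr) (artin_schreier a),
           deg_g D (p ^ n - 1) = (n - 1)%N /\ (2 <= n - 1)%N]) /\
  (* Goss's conjecture is false *)
  ~ goss_conjecture S /\
  (* there are infinitely many counterexamples (p, P_a, p ^ n - 1) *)
  infinite_set
    [set t : {p : nat & ({poly 'F_p} * nat)%type} |
      exists (p : nat) (pr : prime p) (n : nat) (a : 'F_p),
        [/\ (5 <= p)%N, (3 <= n <= p - 1)%N, a != 0,
            t = existT (fun p : nat => ({poly 'F_p} * nat)%type) p
                  (artin_schreier a, (p ^ n - 1)%N)
          & exists D : cyclotomic_data (S p pr) (artin_schreier a),
              (1 < deg_g D (p ^ n - 1))%N]]%classic /\
  (* the excess over 1 is n - 2 ... *)
  (forall (p : nat) (pr : prime p) (n : nat) (a : 'F_p)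
          (D : cyclotomic_data (S p pr) (artin_schreier a)),
     (5 <= p)%N -> (3 <= n <= p - 1)%N -> a != 0 ->
     (deg_g D (p ^ n - 1) - 1 = n - 2)%N) /\
  (* ... unbounded ... *)
  (forall B : nat, exists (p : nat) (pr : prime p) (n : nat) (a : 'F_p)
          (D : cyclotomic_data (S p pr) (artin_schreier a)),
     [/\ (5 <= p)%N, (3 <= n <= p - 1)%N, a != 0
       & (B < deg_g D (p ^ n - 1) - 1)%N]) /\
  (* ... and equal to p - 3 at n = p - 1 *)
  (forall (p : nat) (pr : prime p) (a : 'F_p)
          (D : cyclotomic_data (S p pr) (artin_schreier a)),
     (5 <= p)%N -> a != 0 ->
     (deg_g D (p ^ (p - 1) - 1) - 1 = p - 3)%N) /\
  (* the construction produces no counterexample for p = 2, 3 *)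
  (forall (p : nat) (pr : prime p) (n : nat) (a : 'F_p)
          (D : cyclotomic_data (S p pr) (artin_schreier a)),
     p = 2%N \/ p = 3%N -> (1 <= n <= p - 1)%N -> a != 0 ->
     [/\ deg_g D (p ^ n - 1) = (n - 1)%N, (n - 1 <= p - 2)%N
       & (p - 2 <= 1)%N]).
Proof.
have degE p (pr : prime p) n (a : 'F_p) (D : cyclotomic_data (S p pr) (artin_schreier a)) :
    (0 < n)%N -> (n <= p - 1)%N -> a != 0 -> deg_g D (p ^ n - 1) = (n - 1)%N.
  move=> n0 np a0; rewrite [(n - 1)%N]subn1; apply: deg_g_artin_schreier => //.
  by have := prime_gt1 pr; lia.
have exD p (pr : prime p) (a : 'F_p) : a != 0 ->
    inhabited (cyclotomic_data (S p pr) (artin_schreier a)).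
  by move=> a0; exact: exists_cyclotomic_data.
have big B : exists (p : nat) (pr : prime p), (B < p)%N.
  by have [p Bp pr] := prime_above B; exists p, pr.
have one0 p : (1 : 'F_p) != 0 by exact: oner_neq0.
have range p (pr : prime p) n (a : 'F_p) : (1 < n <= p - 1)%N ->
    (1 <= p ^ n - 1 <= p ^ poly_deg (artin_schreier a) - 2)%N.
  move=> np; rewrite /poly_deg size_artin_schreier //; apply: pred_expn_range (prime_gt1 pr) _.
  by have := prime_gt1 pr; lia.
split=> [p pr n a p5 /andP[n3 np] a0|].
  split.
  - exact: artin_schreier_monic.
  - exact: artin_schreier_irreducible.
  - exact: q_magic_pred_expn.
  - by apply: range => //; lia.
  - by move=> D; rewrite degE //; lia.
split.
  (* The least case p = 5, n = 3, with a = 1: the degree is 2. *)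
  move=> goss; have pr5 : prime 5 by [].
  have [D] := exD 5 pr5 1 (one0 5).
  have := goss 5 pr5 'F_5 (artin_schreier 1) (5 ^ 3 - 1)%N (pchar_Fp pr5)
    (artin_schreier_monic pr5 _) (artin_schreier_irreducible pr5 (one0 5)).
  rewrite card_Fp // => /(_ (q_magic_pred_expn 5 3) (range 5 pr5 3 1 isT) D).
  by rewrite degE.
split.
  (* Projecting to the first component would leave only finitely many primes. *)
  move=> fin; have [s sE] := (finite_seqP _).1 (finite_image (fun t => projT1 t) fin).
  have [p [pr ps]] := big (5 + \max_(i <- s) i)%N.
  have [D] := exD p pr 1 (one0 p).
  suff sp : p \in s by have := leq_bigmax_seq (F := id) p sp isT;
    rewrite leqNgt (leq_ltn_trans (leq_addl 5 _) ps).
  have : [set` s]%classic p; last by [].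
  rewrite -sE; exists (existT _ p (artin_schreier (1 : 'F_p), (p ^ 3 - 1)%N)) => //=.
  exists p, pr, 3%N, 1; split=> //; try lia.
  by exists D; rewrite degE //; lia.
split=> [p pr n a D p5 np a0|]; first by rewrite degE //; lia.
split=> [B|].
  have [p [pr pB]] := big (B + 5)%N; have [D] := exD p pr 1 (one0 p).
  (* At n = p - 1 the excess is p - 3, which exceeds B because p > B + 5. *)
  by exists p, pr, (p - 1)%N, 1, D; split; rewrite ?degE //; lia.
split=> [p pr a D p5 a0|p pr n a D p23 np a0]; first by rewrite degE //; lia.
by split; rewrite ?degE //; lia.
Qed.
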